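(* Let $\mathbf k$ be an algebraically closed field, $V$ an $\mathbb N$-graded vertex $\mathbf k$-algebra with an $\mathrm{Aut}\,\mathcal O$-action, and $C$ a smooth projective curve over $\mathbf k$ with vertex algebra sheaf $\mathcal V_C$. For an open subset $U\subset C$ with a global coordinate $t$ (e.g. given by an étale map $U\to\mathbb A^1_{\mathbf k}$), use the trivialization $\mathcal V_C|_U\simeq_tV\otimes\mathcal O_U$ and define, for $n\ge0$, $a\in V$, $f\in\mathcal O_U$, $$\Theta_n(a\otimes f)=\sum_{0\le i\le j\le n}T^{(i)}(a)\otimes\partial_t^{(j-i)}[f]\otimes(\delta t)^j .$$ Then $\Theta=\{\Theta_n\}_{n\ge0}$ is a PD-connection on $\mathcal V_C$, and this assignment is canonical: the definition is independent of the choice of the coordinate $t$ (so the local definitions glue to a PD-connection on $\mathcal V_C$ over all of $C$).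
   Context: **Vertex algebras.** A vertex $\mathbf k$-algebra is a $\mathbf k$-module $V$ with $\mathbf 1\in V$ and a linear map $Y(\cdot,z)\colon V\to\mathrm{End}(V)[[z,z^{-1}]]$, $Y(a,z)=\sum_{n\in\mathbb Z}a_{(n)}z^{-1-n}$, such that $a_{(n)}b=0$ for $n\gg0$; $\mathbf 1_{(n)}a=\delta_{n,-1}a$; $a_{(-1)}\mathbf 1=a$ and $a_{(n)}\mathbf 1=0$ for $n\ge0$; and the Jacobi identity holds, equivalently for all $r,s\in\mathbb Z$: $[a_{(r)},b_{(s)}]=\sum_{j\ge0}\binom rj(a_{(j)}b)_{(r+s-j)}$ and $(a_{(r)}b)_{(s)}=\sum_{j\ge0}(-1)^j\binom rj\big(a_{(r-j)}b_{(s+j)}-(-1)^rb_{(r+s-j)}a_{(j)}\big)$. Put $T^{(n)}a=a_{(-1-n)}\mathbf 1$, $e^{zT}=\sum_nz^nT^{(n)}$. $V$ is $\mathbb N$-graded if $V=\bigoplus_{s\ge0}V_s$, $\mathbf 1\in V_0$, and $a_{(n)}$ has degree $\deg a-1-n$ for homogeneous $a$. **$\mathrm{Aut}\,\mathcal O$-actions.** $\mathrm{Aut}\,\mathcal O$ is the group (functor) of continuous automorphisms $\rho(t)=a_1t+a_2t^2+\cdots$ ($a_1$ a unit) of $\mathbf k[[t]]$. An action on $V$ is a representation $\Pi\colon\mathrm{Aut}\,\mathcal O\to GL_{\mathbf k}(V)$ such that, with $\Pi(\rho_z)=e^{-zT}\Pi(\rho)e^{\rho(z)T}$ and $G_pV=\bigoplus_{s\le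 p}V_s$: (i) all coefficients of $z^n$ in $\Pi(\rho_z)$ preserve $G_\bullet V$; (ii) $\Pi(\rho_z)a-(\rho'(z))^{-\Delta}a\in G_{\Delta-1}V[[z]]$ for $a\in V_\Delta$; (iii) $\Pi(t\mapsto xt)a=x^{-\deg a}a$ for $x\in\mathbf k^\times$; (iv) $\Pi(\rho)Y(\Pi(\rho_z)^{-1}a,\rho(z))\Pi(\rho)^{-1}=Y(a,z)$. **Vertex algebra sheaf.** Let $\pi\colon\mathscr{A}ut_C\to C$ be the $\mathrm{Aut}\,\mathcal O$-torsor of pairs $(P,t)$, $P\in C$, $t$ a formal coordinate at $P$, with action $(P,t)\cdot\rho=(P,\rho(t))$. Then $\mathcal V_C=(V\otimes\pi_*\mathcal O_{\mathscr{A}ut_C})^{\mathrm{Aut}\,\mathcal O}$, the sheaf of sections of the quotient of $\mathscr{A}ut_C\times V$ by $(P,t,a)\sim(P,\rho(t),\Pi(\rho)^{-1}a)$. A coordinate $t$ on an open $U$ gives a trivialization $\mathcal V_C|_U\simeq_tV\otimes\mathcal O_U$. **Principal parts.** For $X\to S$ (here $C\to\mathrm{Spec}\,\mathbf k$), $\mathcal P^n_{X/S}=(\mathcal O_X\otimes_{\mathcal O_S}\mathcal O_X)/\mathcal J^{n+1}$ with $\mathcal J$ the kernel of multiplication; $d_0^n,d_1^n\colon\mathcal O_X\to\mathcal P^n_{X/S}$ are $a\mapsto a\otimes1$ and $a\mapsto1\otimes a$, $\delta=d_1^n-d_0^n$, and $\mathcal P^n$ is a left $\mathcal O_X$-module via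 $d_0^n$ and a right one via $d_1^n$. There are projections $\varphi_{m,n}\colon\mathcal P^n\to\mathcal P^m$ ($n\ge m$) and comultiplications $\delta^{m,n}\colon\mathcal P^{m+n}\to\mathcal P^m\otimes\mathcal P^n$, $x\otimes y\mapsto(x\otimes1)\otimes(1\otimes y)$. Over $U$ with coordinate $t$, $\mathcal P^n_{C/\mathbf k}$ is free over $\mathcal O_U$ with basis $(\delta t)^j$, $0\le j\le n$. $\partial_t^{(j)}$ denotes the $j$-th divided-power derivative ($\partial_t^{(j)}t^m=\binom mjt^{m-j}$). **PD-connection.** A PD-connection on an $\mathcal O_X$-module $\mathcal E$ is a family of right $\mathcal O_X$-linear maps $\Theta_n\colon\mathcal E\to\mathcal E\otimes\mathcal P^n_{X/S}$, $n\ge0$ ($\mathcal O_X$ acting on the target through $d_1^n$), such that $\Theta_0=\mathrm{id}$; $(\mathrm{id}\otimes\varphi_{m,n})\circ\Theta_n=\Theta_m$ for $n\ge m$; and $(\Theta_m\otimes\mathrm{id})\circ\Theta_n=(\mathrm{id}\otimes\delta^{m,n})\circ\Theta_{m+n}$ as maps $\mathcal E\to\mathcal E\otimes\mathcal P^m\otimes\mathcal P^n$.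
   Formalization: The relation Π(ρ_z)=e^{-zT}Π(ρ)e^{ρ(z)T} is imposed as a condition on the action, with ρ_z(t)=ρ(z+t)-ρ(z) a k[[z]]-point of Aut O; as mere notation, independence of t fails (Heisenberg algebra with L_n+bJ_n for n≥1, L_0 kept). *)

(* Defs.v *)
From HB Require Import structures.
From mathcomp Require Import all_boot all_algebra.
From mathcomp Require Import boolp classical_sets functions mpoly.
Set Implicit Arguments.
Unset Strict Implicit.
Unset Printing Implicit Defensive.
Import GRing.Theory.
Local Open Scope ring_scope.
Local Open Scope quotient_scope.
Local Open Scope classical_set_scope.

Definition pseries (R : Type) : Type := nat -> R.

Section PowerSeries.
Variable R : comNzRingType.
Implicit Types f g h : pseries R.

HB.instance Definition _ := GRing.Zmodule.copy (pseries R) (nat -> R).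

Definition ps_const (c : R) : pseries R := fun n => if n == 0%N then c else 0.
Definition ps_mul f g : pseries R :=
  fun n => \sum_(i < n.+1) f i * g (n - i)%N.

Definition ps_trunc N f : {poly R} := \poly_(i < N) f i.

Lemma ps_mul_tr N f g n : (n < N)%N -> ps_mul f g n = (ps_trunc N f * ps_trunc N g)`_n.
Proof.
move=> ltnN; rewrite coefM; apply: eq_bigr => i _; rewrite !coef_poly.
by rewrite !(leq_ltn_trans _ ltnN) ?leq_subr ?leq_ord // -ltnS.
Qed.

Lemma ps_mulC : commutative ps_mul.
Proof.
by move=> f g; apply/funext => n; rewrite !(@ps_mul_tr n.+1) // mulrC.
Qed.

Lemma ps_mulA : associative ps_mul.
Proof.
move=> f g h; apply/funext => n.
have E u v w : ps_mul u (ps_mul v w) n =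
    (ps_trunc n.+1 u * (ps_trunc n.+1 v * ps_trunc n.+1 w))`_n.
  rewrite coefM; apply: eq_bigr => i _; rewrite coef_poly ltn_ord.
  by congr (_ * _); rewrite (@ps_mul_tr n.+1) // ltnS leq_subr.
by rewrite E ps_mulC E mulrA mulrC.
Qed.

Lemma ps_mul1 : left_id (ps_const 1) ps_mul.
Proof.
move=> f; apply/funext => n; rewrite /ps_mul big_ord_recl /= subn0 mul1r.
by rewrite big1 ?addr0 // => i _; rewrite /ps_const /= mul0r.
Qed.

Lemma ps_mulD : left_distributive ps_mul +%R.
Proof.
move=> f g h; apply/funext => n; rewrite /ps_mul [RHS]/GRing.add /=.
by rewrite -big_split; apply: eq_bigr => i _; rewrite mulrDl.
Qed.

Lemma ps_const1_neq0 : ps_const 1 != 0.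
Proof.
by apply/eqP => /(congr1 (fun f => f 0%N)) /eqP; rewrite (negbTE (oner_neq0 _)).
Qed.

HB.instance Definition _ := GRing.Zmodule_isComNzRing.Build (pseries R)
  ps_mulA ps_mulC ps_mul1 ps_mulD ps_const1_neq0.

Definition ps_scale (c : R) f : pseries R := fun n => c * f n.

Lemma ps_scaleA a b f : ps_scale a (ps_scale b f) = ps_scale (a * b) f.
Proof. by apply/funext => n; rewrite /ps_scale mulrA. Qed.
Lemma ps_scale1 : left_id 1 ps_scale.
Proof. by move=> f; apply/funext => n; rewrite /ps_scale mul1r. Qed.
Lemma ps_scaleDr : right_distributive ps_scale +%R.
Proof. by move=> a f g; apply/funext => n; rewrite /ps_scale mulrDr. Qed.
Lemma ps_scaleDl f : {morph ps_scale^~ f : a b / a + b}.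
Proof. by move=> a b; apply/funext => n; rewrite /ps_scale mulrDl. Qed.

HB.instance Definition _ := GRing.Zmodule_isLmodule.Build R (pseries R)
  ps_scaleA ps_scale1 ps_scaleDr ps_scaleDl.

Lemma ps_scaleAl (a : R) f g : a *: (f * g) = (a *: f) * g.
Proof.
apply/funext => n.
change (a * ps_mul f g n = ps_mul (ps_scale a f) g n); rewrite mulr_sumr.
by apply: eq_bigr => i _; rewrite mulrA.
Qed.

HB.instance Definition _ := GRing.Lmodule_isLalgebra.Build R (pseries R)
  ps_scaleAl.
HB.instance Definition _ := GRing.Lalgebra_isComAlgebra.Build R (pseries R).

Definition psX : pseries R := fun n => (n == 1%N)%:R.

(* [ps_comp s r] is s(r(t)), meaningful when [r 0 = 0]. *)
Definition ps_comp (s r : pseries R) : pseries R :=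
  fun n => \sum_(m < n.+1) s m * (r ^+ m) n.

Definition ps_deriv f : pseries R := fun n => f n.+1 *+ n.+1.

(* f(t + z) - f(z), a power series in t with coefficients in R[[z]]. *)
Definition ps_recenter f : pseries (pseries R) :=
  fun j i => if j == 0%N then 0 else f (i + j)%N *+ 'C(i + j, j).

Definition ps_zpow (u v : pseries R) (e : int) : pseries R :=
  match e with Posz p => u ^+ p | Negz p => v ^+ p.+1 end.

(* the automorphisms t |-> r(t) of R[[t]], that is, the R-points of Aut O *)
Definition is_aut (r : pseries R) : Prop :=
  r 0%N = 0 /\ exists y, r 1%N * y = 1.

End PowerSeries.

Arguments psX {R}.

(* M (x)_A N for a right A-module M and a left A-module N, as an abelian
   group. The actions are explicit arguments because modules of principal
   parts carry two different A-module structures. Two formal sums of pure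
   tensors are identified when all balanced maps agree on them. *)
Section Tensor.
Variables (A : Type) (M N : zmodType) (ra : M -> A -> M) (la : A -> N -> N).

Definition balanced (W : zmodType) (b : M -> N -> W) : Prop :=
  [/\ forall m m' n, b (m + m') n = b m n + b m' n,
      forall m n n', b m (n + n') = b m n + b m n' &
      forall m a n, b (ra m a) n = b m (la a n)].

Definition tens_eq (s s' : seq (M * N)) : bool :=
  `[< forall (W : zmodType) (b : M -> N -> W), balanced b ->
        \sum_(p <- s) b p.1 p.2 = \sum_(p <- s') b p.1 p.2 >].

Lemma tens_eq_equiv : equiv_class_of tens_eq.
Proof.
split=> [s|s s'|s' s s''] //; first exact/asboolP.
  by apply/asboolP/asboolP => H W b bb; rewrite H.
by move=> /asboolP H /asboolP H'; apply/asboolP => W b bb; rewrite H ?H'.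
Qed.

Canonical tens_eq_rel := EquivRelPack tens_eq_equiv.
Definition tens : Type := {eq_quot tens_eq}.
HB.instance Definition _ := Choice.on tens.
HB.instance Definition _ := EqQuotient.on tens.

Definition pure (m : M) (n : N) : tens := \pi_tens [:: (m, n)].

(* the map induced by [b], meaningful when [b] is balanced *)
Definition tlift (W : zmodType) (b : M -> N -> W) (u : tens) : W :=
  \sum_(p <- repr u) b p.1 p.2.

Lemma tlift_pi (W : zmodType) (b : M -> N -> W) s : balanced b ->
  tlift b (\pi_tens s) = \sum_(p <- s) b p.1 p.2.
Proof.
move=> bb; have /eqP : \pi_tens (repr (\pi_tens s)) = \pi_tens s
  by rewrite reprK.
by rewrite piE => /asboolP H; apply: H.
Qed.

Definition tens_add (u v : tens) : tens := \pi_tens (repr u ++ repr v).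
Definition tens_opp (u : tens) : tens :=
  \pi_tens [seq (- p.1, p.2) | p <- repr u].
Definition tens_zero : tens := \pi_tens [::].

Lemma tens_ext u v :
  (forall (W : zmodType) (b : M -> N -> W), balanced b -> tlift b u = tlift b v) -> u = v.
Proof.
move=> H; rewrite -[u]reprK -[v]reprK; apply/eqP; rewrite piE.
by apply/asboolP => W b /H.
Qed.

Lemma tlift_add (W : zmodType) (b : M -> N -> W) u v : balanced b ->
  tlift b (tens_add u v) = tlift b u + tlift b v.
Proof. by move=> bb; rewrite tlift_pi // big_cat. Qed.

Lemma balanced_opp (W : zmodType) (b : M -> N -> W) m n : balanced b -> b (- m) n = - b m n.
Proof.
case=> bD _ _; apply/eqP; rewrite -addr_eq0 -bD addNr.
by apply/eqP; apply: (addrI (b 0 n)); rewrite -bD !addr0.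
Qed.

Lemma tlift_opp (W : zmodType) (b : M -> N -> W) u : balanced b ->
  tlift b (tens_opp u) = - tlift b u.
Proof.
move=> bb; rewrite tlift_pi // big_map -sumrN.
by apply: eq_bigr => p _ /=; rewrite balanced_opp.
Qed.

Lemma tlift_zero (W : zmodType) (b : M -> N -> W) : balanced b -> tlift b tens_zero = 0.
Proof. by move=> bb; rewrite tlift_pi // big_nil. Qed.

Lemma tens_addA : associative tens_add.
Proof. by move=> u v w; apply: tens_ext => W b bb; rewrite !tlift_add // addrA. Qed.
Lemma tens_addC : commutative tens_add.
Proof. by move=> u v; apply: tens_ext => W b bb; rewrite !tlift_add // addrC. Qed.
Lemma tens_add0 : left_id tens_zero tens_add.
Proof.
by move=> u; apply: tens_ext => W b bb; rewrite tlift_add // tlift_zero ?add0r.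
Qed.
Lemma tens_addN : left_inverse tens_zero tens_opp tens_add.
Proof.
move=> u; apply: tens_ext => W b bb.
by rewrite tlift_add // tlift_zero // tlift_opp // addNr.
Qed.

HB.instance Definition _ := GRing.isZmodule.Build tens
  tens_addA tens_addC tens_add0 tens_addN.

Lemma tliftD (W : zmodType) (b : M -> N -> W) : balanced b ->
  {morph tlift b : u v / u + v}.
Proof. by move=> bb u v; apply: tlift_add. Qed.

Lemma tlift_pure (W : zmodType) (b : M -> N -> W) m n : balanced b ->
  tlift b (pure m n) = b m n.
Proof. by move=> bb; rewrite tlift_pi // big_seq1. Qed.

Lemma pure_balanced : balanced pure.
Proof.
have P (W : zmodType) (b : M -> N -> W) m n := @tlift_pure W b m n.
split=> [m m' n|m n n'|m a n]; apply: tens_ext => W b bb;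
  by rewrite ?tliftD // !P //; case: bb.
Qed.

Lemma tens_sum (u : tens) : u = \sum_(p <- repr u) pure p.1 p.2.
Proof.
apply: tens_ext => W b bb; rewrite [LHS]/tlift.
have [D0 DD] : tlift b 0 = 0 /\ {morph tlift b : x y / x + y}.
  by split; [exact: tlift_zero | exact: tliftD].
rewrite (big_morph (tlift b) DD D0).
by apply: eq_bigr => p _; rewrite tlift_pure.
Qed.

Lemma tens_morph_eq (W : zmodType) (f g : tens -> W) :
  {morph f : u v / u + v} -> {morph g : u v / u + v} ->
  (forall m n, f (pure m n) = g (pure m n)) -> f =1 g.
Proof.
have z0 (h : tens -> W) : {morph h : u v / u + v} -> h 0 = 0.
  by move=> hD; apply: (addrI (h 0)); rewrite -hD !addr0.
move=> fD gD E u; rewrite [u]tens_sum (big_morph f fD (z0 _ fD)).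
by rewrite (big_morph g gD (z0 _ gD)); apply: eq_bigr.
Qed.

End Tensor.

(* f (x) g, meaningful when f and g are compatible with the actions *)
Definition tmap A (M N : zmodType) (ra : M -> A -> M) (la : A -> N -> N)
    A' (M' N' : zmodType) (ra' : M' -> A' -> M') (la' : A' -> N' -> N')
    (f : M -> M') (g : N -> N') (u : tens ra la) : tens ra' la' :=
  tlift (fun m n => pure ra' la' (f m) (g n)) u.

Record ideal_of (R : comPzRingType) := IdealOf {
  in_ideal :> R -> Prop;
  ideal0 : in_ideal 0;
  idealB : forall x y, in_ideal x -> in_ideal y -> in_ideal (x - y);
  idealM : forall x y, in_ideal y -> in_ideal (x * y);
  ideal_proper : ~ in_ideal 1 }.

Section RingQuotient.
Variables (R : comPzRingType) (I : ideal_of R).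

Definition rq_eq (x y : R) : bool := `[< I (x - y) >].

Lemma idealN x : I x -> I (- x).
Proof. by move=> Ix; rewrite -sub0r; apply: idealB => //; exact: ideal0. Qed.
Lemma idealD x y : I x -> I y -> I (x + y).
Proof. by move=> Ix Iy; rewrite -[y]opprK; apply: idealB => //; exact: idealN. Qed.

Lemma rq_eq_equiv : equiv_class_of rq_eq.
Proof.
split=> [x|x y|y x z].
- by apply/asboolP; rewrite subrr; exact: ideal0.
- by apply/asboolP/asboolP => /idealN; rewrite opprB.
- move=> /asboolP xy /asboolP yz; apply/asboolP.
  by rewrite -(subrKA y); exact: idealD.
Qed.

Canonical rq_eq_rel := EquivRelPack rq_eq_equiv.
Definition rquot : Type := {eq_quot rq_eq}.
HB.instance Definition _ := Choice.on rquot.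
HB.instance Definition _ := EqQuotient.on rquot.

Definition rq_pi (x : R) : rquot := \pi_rquot x.

Lemma rq_piE x y : rq_pi x = rq_pi y <-> I (x - y).
Proof.
rewrite /rq_pi; split=> [/eqP|H]; first by rewrite piE => /asboolP.
by apply/eqP; rewrite piE; apply/asboolP.
Qed.

Lemma rq_ind (P : rquot -> Prop) : (forall x, P (rq_pi x)) -> forall u, P u.
Proof. by move=> H u; rewrite -[u]reprK; apply: H. Qed.

Lemma rq_repr x : I (repr (rq_pi x) - x).
Proof. by apply/rq_piE; rewrite /rq_pi reprK. Qed.

Definition rq_add (u v : rquot) := rq_pi (repr u + repr v).
Definition rq_opp (u : rquot) := rq_pi (- repr u).
Definition rq_mul (u v : rquot) := rq_pi (repr u * repr v).

Lemma rq_addE x y : rq_add (rq_pi x) (rq_pi y) = rq_pi (x + y).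
Proof.
apply/rq_piE; rewrite opprD addrACA; apply: idealD; exact: rq_repr.
Qed.
Lemma rq_oppE x : rq_opp (rq_pi x) = rq_pi (- x).
Proof. by apply/rq_piE; rewrite -opprD; apply: idealN; exact: rq_repr. Qed.
Lemma rq_mulE x y : rq_mul (rq_pi x) (rq_pi y) = rq_pi (x * y).
Proof.
apply/rq_piE; set a := repr _; set b := repr _.
have -> : a * b - x * y = a * (b - y) + y * (a - x).
  by rewrite !mulrBr [y * a]mulrC [y * x]mulrC addrA subrK.
by apply: idealD; apply: idealM; exact: rq_repr.
Qed.

Lemma rq_addA : associative rq_add.
Proof. by do 3!elim/rq_ind=> ?; rewrite !rq_addE addrA. Qed.
Lemma rq_addC : commutative rq_add.
Proof. by do 2!elim/rq_ind=> ?; rewrite !rq_addE addrC. Qed.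
Lemma rq_add0 : left_id (rq_pi 0) rq_add.
Proof. by elim/rq_ind=> ?; rewrite !rq_addE add0r. Qed.
Lemma rq_addN : left_inverse (rq_pi 0) rq_opp rq_add.
Proof. by elim/rq_ind=> ?; rewrite rq_oppE rq_addE addNr. Qed.

HB.instance Definition _ := GRing.isZmodule.Build rquot
  rq_addA rq_addC rq_add0 rq_addN.

Lemma rq_mulA : associative rq_mul.
Proof. by do 3!elim/rq_ind=> ?; rewrite !rq_mulE mulrA. Qed.
Lemma rq_mulC : commutative rq_mul.
Proof. by do 2!elim/rq_ind=> ?; rewrite !rq_mulE mulrC. Qed.
Lemma rq_mul1 : left_id (rq_pi 1) rq_mul.
Proof. by elim/rq_ind=> ?; rewrite rq_mulE mul1r. Qed.
Lemma rq_mulD : left_distributive rq_mul rq_add.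
Proof. by do 3!elim/rq_ind=> ?; rewrite !(rq_mulE, rq_addE) mulrDl. Qed.
Lemma rq_1neq0 : rq_pi 1 != rq_pi 0.
Proof. by apply/eqP => /rq_piE; rewrite subr0; exact: ideal_proper. Qed.

HB.instance Definition _ := GRing.Zmodule_isComNzRing.Build rquot
  rq_mulA rq_mulC rq_mul1 rq_mulD rq_1neq0.

Lemma rq_piD x y : rq_pi (x + y) = rq_pi x + rq_pi y.
Proof. by rewrite -rq_addE. Qed.
Lemma rq_piM x y : rq_pi (x * y) = rq_pi x * rq_pi y.
Proof. by rewrite -rq_mulE. Qed.
Lemma rq_pi1 : rq_pi 1 = 1. Proof. by []. Qed.

End RingQuotient.

Fixpoint ideal_pow (R : comPzRingType) (J : R -> Prop) (n : nat) (x : R) :=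
  if n is m.+1 then
    exists2 s : seq (R * R),
      (forall p, p \in s -> J p.1 /\ ideal_pow J m p.2) &
      x = \sum_(p <- s) p.1 * p.2
  else True.

Section PrincipalParts.
Variables (k : comNzRingType) (A : comAlgType k).

Definition AA_ra (a : A) (c : k) : A := c *: a.
Definition AA_la (c : k) (a : A) : A := c *: a.

Definition AA : Type := tens AA_ra AA_la.
HB.instance Definition _ := GRing.Zmodule.on AA.
Definition AAp (a b : A) : AA := pure AA_ra AA_la a b.

Lemma AA_bal : balanced AA_ra AA_la AAp. Proof. exact: pure_balanced. Qed.

Lemma AA_mul1_bal (a b : A) : balanced AA_ra AA_la (fun c d => AAp (a * c) (b * d)).
Proof.
case: AA_bal => D1 D2 D3; split=> [m m' n|m n n'|m c n].
- by rewrite mulrDr D1.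
- by rewrite mulrDr D2.
- by rewrite /AA_ra /AA_la -!scalerAr D3.
Qed.

Definition AA_mulp (a b : A) (v : AA) : AA :=
  tlift (fun c d => AAp (a * c) (b * d)) v.

Lemma AA_mul1D a b : {morph AA_mulp a b : u v / u + v}.
Proof. exact/tliftD/AA_mul1_bal. Qed.
Lemma AA_mul1E a b c d : AA_mulp a b (AAp c d) = AAp (a * c) (b * d).
Proof. exact/tlift_pure/AA_mul1_bal. Qed.

Lemma AA_mul2_bal (v : AA) : balanced AA_ra AA_la (fun a b => AA_mulp a b v).
Proof.
case: AA_bal => D1 D2 D3.
have addD (f g : AA -> AA) : {morph f : u v / u + v} ->
  {morph g : u v / u + v} -> {morph (fun w => f w + g w) : u v / u + v}.
  by move=> fD gD x y; rewrite fD gD addrACA.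
split=> [m m' n|m n n'|m c n].
- apply: (@tens_morph_eq _ _ _ AA_ra AA_la _ (AA_mulp (m + m') n)
           (fun w => AA_mulp m n w + AA_mulp m' n w)) => [||c d].
  + exact: AA_mul1D.
  + by apply: addD; exact: AA_mul1D.
  + by rewrite -/(AAp c d) !AA_mul1E mulrDl D1.
- apply: (@tens_morph_eq _ _ _ AA_ra AA_la _ (AA_mulp m (n + n'))
           (fun w => AA_mulp m n w + AA_mulp m n' w)) => [||c d].
  + exact: AA_mul1D.
  + by apply: addD; exact: AA_mul1D.
  + by rewrite -/(AAp c d) !AA_mul1E mulrDl D2.
- apply: (@tens_morph_eq _ _ _ AA_ra AA_la _ (AA_mulp (AA_ra m c) n) (AA_mulp m (AA_la c n))).
  + exact: AA_mul1D.
  + exact: AA_mul1D.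
  + by move=> a b; rewrite -/(AAp a b) !AA_mul1E /AA_ra /AA_la -!scalerAl D3.
Qed.

Definition AA_mul (u v : AA) : AA := tlift (fun a b => AA_mulp a b v) u.

Lemma AA_mulDl v : {morph AA_mul^~ v : x y / x + y}.
Proof. exact/tliftD/AA_mul2_bal. Qed.
Lemma AA_mulpE a b v : AA_mul (AAp a b) v = AA_mulp a b v.
Proof. exact/(tlift_pure _ _ (AA_mul2_bal v)). Qed.
Lemma AA_mulE a b c d : AA_mul (AAp a b) (AAp c d) = AAp (a * c) (b * d).
Proof. by rewrite AA_mulpE AA_mul1E. Qed.

Lemma AA_ind (f g : AA -> AA) : {morph f : u v / u + v} ->
  {morph g : u v / u + v} -> (forall a b, f (AAp a b) = g (AAp a b)) -> f =1 g.
Proof. exact: tens_morph_eq. Qed.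

Lemma AA_mulDr u : {morph AA_mul u : x y / x + y}.
Proof.
move=> x y; move: u.
apply: (AA_ind (f := AA_mul^~ (x + y))
   (g := fun u => AA_mul u x + AA_mul u y)) => [|u v|a b].
- exact: AA_mulDl.
- by rewrite !AA_mulDl addrACA.
- by rewrite !AA_mulpE AA_mul1D.
Qed.

Lemma AA_mulC : commutative AA_mul.
Proof.
move=> u v; move: u.
apply: (AA_ind (f := AA_mul^~ v) (g := AA_mul v)) => [||a b].
- exact: AA_mulDl.
- exact: AA_mulDr.
move: v; apply: (AA_ind (f := AA_mul (AAp a b)) (g := AA_mul^~ (AAp a b))).
- exact: AA_mulDr.
- exact: AA_mulDl.
- by move=> c d; rewrite !AA_mulE [a * c]mulrC [b * d]mulrC.
Qed.

Lemma AA_mulA : associative AA_mul.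
Proof.
move=> u v w; move: u.
apply: (AA_ind (f := AA_mul^~ (AA_mul v w))
  (g := fun u => AA_mul (AA_mul u v) w)) => [|x y|a b].
- exact: AA_mulDl.
- by rewrite !AA_mulDl.
move: v; apply: (AA_ind (f := fun v => AA_mul (AAp a b) (AA_mul v w))
  (g := fun v => AA_mul (AA_mul (AAp a b) v) w)) => [x y|x y|c d].
- by rewrite !(AA_mulDl, AA_mulDr).
- by rewrite !(AA_mulDl, AA_mulDr).
move: w; apply: (AA_ind (f := fun w => AA_mul (AAp a b) (AA_mul (AAp c d) w))
  (g := AA_mul (AA_mul (AAp a b) (AAp c d)))) => [x y|x y|e f].
- by rewrite !AA_mulDr.
- by rewrite !AA_mulDr.
- by rewrite !AA_mulE !mulrA.
Qed.

Lemma AA_mul1 : left_id (AAp 1 1) AA_mul.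
Proof.
apply: (AA_ind (f := AA_mul (AAp 1 1)) (g := id)) => [||a b] //.
- exact: AA_mulDr.
- by rewrite AA_mulE !mul1r.
Qed.

Lemma AA_mulD : left_distributive AA_mul +%R.
Proof. by move=> x y z; apply: AA_mulDl. Qed.

HB.instance Definition _ := GRing.Zmodule_isComPzRing.Build AA
  AA_mulA AA_mulC AA_mul1 AA_mulD.

Definition AA_mult (u : AA) : A := tlift (fun a b => a * b) u.
Definition diag_ideal (u : AA) : Prop := AA_mult u = 0.

Lemma AA_mult_bal : balanced AA_ra AA_la (fun a b : A => a * b).
Proof.
split=> [m m' n|m n n'|m c n]; first exact: mulrDl; first exact: mulrDr.
by rewrite /AA_ra /AA_la -scalerAl -scalerAr.
Qed.
Lemma AA_multD : {morph AA_mult : u v / u + v}.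
Proof. exact/tliftD/AA_mult_bal. Qed.
Lemma AA_multE a b : AA_mult (AAp a b) = a * b.
Proof. exact/(tlift_pure _ _ AA_mult_bal). Qed.
Lemma AA_mult0 : AA_mult 0 = 0.
Proof. by apply: (addrI (AA_mult 0)); rewrite -AA_multD !addr0. Qed.
Lemma AA_multM u v : AA_mult (u * v) = AA_mult u * AA_mult v.
Proof.
move: u; apply: (@tens_morph_eq _ _ _ AA_ra AA_la _ (fun u : AA => AA_mult (u * v))
  (fun u : AA => AA_mult u * AA_mult v)) => [x y|x y|a b].
- by rewrite mulrDl AA_multD.
- by rewrite AA_multD mulrDl.
rewrite -/(AAp a b); move: v.
apply: (@tens_morph_eq _ _ _ AA_ra AA_la _ (fun v : AA => AA_mult (AAp a b * v))
  (fun v : AA => AA_mult (AAp a b) * AA_mult v)) => [x y|x y|c d].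
- by rewrite mulrDr AA_multD.
- by rewrite AA_multD mulrDr.
by rewrite -/(AAp c d) [AAp a b * _]AA_mulE !AA_multE mulrACA.
Qed.

Lemma diag_pow0 n : ideal_pow diag_ideal n 0.
Proof. by case: n => //= n; exists [::]; rewrite ?big_nil. Qed.
Lemma diag_powM n x y : ideal_pow diag_ideal n y -> ideal_pow diag_ideal n (x * y).
Proof.
case: n => //= n [s Js ->]; exists [seq (x * p.1, p.2) | p <- s].
  move=> _ /mapP[p /Js[Jp1 Jp2] ->]; split=> //=.
  by rewrite /diag_ideal AA_multM Jp1 mulr0.
by rewrite big_map mulr_sumr; apply: eq_bigr => p _; rewrite mulrA.
Qed.
Lemma diag_powD n x y : ideal_pow diag_ideal n x -> ideal_pow diag_ideal n y ->
  ideal_pow diag_ideal n (x + y).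
Proof.
case: n => //= n [s Js ->] [s' Js' ->]; exists (s ++ s'); last by rewrite big_cat.
by move=> p; rewrite mem_cat => /orP[/Js|/Js'].
Qed.
Lemma diag_powB n x y : ideal_pow diag_ideal n x -> ideal_pow diag_ideal n y ->
  ideal_pow diag_ideal n (x - y).
Proof. by move=> Jx Jy; apply: diag_powD => //; rewrite -mulN1r; apply: diag_powM. Qed.
Lemma diag_pow_proper n : ~ ideal_pow diag_ideal n.+1 1.
Proof.
case=> s Js E; have : AA_mult 1 = 0.
  rewrite E (big_morph _ AA_multD AA_mult0) big_seq big1 // => p /Js[Jp _].
  by rewrite AA_multM Jp mul0r.
by rewrite [AA_mult _]AA_multE mulr1; apply/eqP/oner_neq0.
Qed.

Definition diag_pow (n : nat) : ideal_of AA :=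
  IdealOf (diag_pow0 n.+1) (@diag_powB n.+1) (@diag_powM n.+1) (@diag_pow_proper n).

(* P^n = (A (x)_k A) / J^(n+1); [diag_pow n] is J^(n+1), not J^n. *)
Definition pparts (n : nat) : comNzRingType := rquot (diag_pow n).

Definition d0 n (a : A) : pparts n := rq_pi (diag_pow n) (AAp a 1).
Definition d1 n (a : A) : pparts n := rq_pi (diag_pow n) (AAp 1 a).
Definition delta n (a : A) : pparts n := d1 n a - d0 n a.

(* the projection P^n -> P^m, meaningful for m <= n *)
Definition pp_proj n m (p : pparts n) : pparts m :=
  rq_pi (diag_pow m) (repr p).

Definition pp_ra n (p : pparts n) (a : A) : pparts n := p * d1 n a.
Definition pp_la n (a : A) (p : pparts n) : pparts n := d0 n a * p.

Definition pp_comult m n (p : pparts (m + n)) : tens (@pp_ra m) (@pp_la n) :=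
  tlift (fun x y => pure (@pp_ra m) (@pp_la n) (d0 m x) (d1 n y)) (repr p : AA).

Section Module.
Variable E : lmodType A.

Definition mod_ra (e : E) (a : A) : E := a *: e.

Definition EP n : zmodType := tens mod_ra (@pp_la n).
Definition EPp n (e : E) (p : pparts n) : EP n := pure mod_ra (@pp_la n) e p.

(* the right A-module structure of E (x) P^n, through d1 *)
Definition EP_ra n (u : EP n) (a : A) : EP n :=
  tmap mod_ra (@pp_la n) id ((@pp_ra n)^~ a) u.

Definition EPP m n : zmodType := tens (@EP_ra m) (@pp_la n).

Definition EP_proj n m (u : EP n) : EP m :=
  tmap mod_ra (@pp_la m) id (@pp_proj n m) u.

(* id (x) delta^{m,n}, including the associativity isomorphism *)
Definition EP_comult m n (u : EP (m + n)) : EPP m n :=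
  tlift (fun e p =>
    tlift (fun q r => pure (@EP_ra m) (@pp_la n) (EPp e q) r) (pp_comult p)) u.

(* T (x) id for T : E -> E (x) P^m right A-linear *)
Definition EP_ext m n (T : E -> EP m) (u : EP n) : EPP m n :=
  tlift (fun e p => pure (@EP_ra m) (@pp_la n) (T e) p) u.

End Module.
End PrincipalParts.


Definition binz (r : int) (j : nat) : int :=
  match r with
  | Posz n => 'C(n, j)%:Z
  | Negz n => (-1) ^+ j * 'C(n + j, j)%:Z
  end.

Definition fin_sum (V : zmodType) (u : nat -> V) (s : V) : Prop :=
  exists N, forall M, (N <= M)%N -> \sum_(j < M) u j = s.

Record vertex_algebra (k : comNzRingType) := VertexAlgebra {
  va_sort :> lmodType k;
  vac : va_sort;
  nprod : va_sort -> int -> va_sort -> va_sort; (* [nprod a n b] is a_(n) b *)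
  nprod_linl : forall n b c a a',
    nprod (c *: a + a') n b = c *: nprod a n b + nprod a' n b;
  nprod_linr : forall n a c b b',
    nprod a n (c *: b + b') = c *: nprod a n b + nprod a n b';
  nprod_trunc : forall a b, exists N, forall n : nat,
    (N <= n)%N -> nprod a n%:Z b = 0;
  nprod_vacl : forall n a, nprod vac n a = if n == -1 then a else 0;
  nprod_vacr : forall a, nprod a (-1) vac = a;
  nprod_vacr0 : forall a (n : nat), nprod a n%:Z vac = 0;
  nprod_comm : forall a b c r s,
    fin_sum (fun j : nat => nprod (nprod a j%:Z b) (r + s - j%:Z) c *~ binz r j)
            (nprod a r (nprod b s c) - nprod b s (nprod a r c));
  nprod_assoc : forall a b c r s,
    fin_sum (fun j : nat =>
      (nprod a (r - j%:Z) (nprod b (s + j%:Z) c)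
       - nprod b (r + s - j%:Z) (nprod a j%:Z c) *~ (-1) ^+ `|r|%N)
        *~ ((-1) ^+ j * binz r j))
      (nprod (nprod a r b) s c) }.

(* [Negz n] is -1-n. *)
Definition transl k (V : vertex_algebra k) (n : nat) (a : V) : V :=
  nprod a (Negz n) (vac V).

Record grading k (V : vertex_algebra k) := Grading {
  gr : nat -> V -> Prop;
  gr0 : forall s, gr s 0;
  gr_lin : forall s c a b, gr s a -> gr s b -> gr s (c *: a + b);
  gr_span : forall a, exists (c : nat -> V) (N : nat),
    (forall s, gr s (c s)) /\ a = \sum_(s < N) c s;
  gr_indep : forall (c : nat -> V) N, (forall s, gr s (c s)) ->
    \sum_(s < N) c s = 0 -> forall s, (s < N)%N -> c s = 0;
  gr_vac : gr 0 (vac V);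
  gr_nprod : forall p q n a b, gr p a -> gr q b ->
    (forall m : nat, m%:Z = p%:Z - 1 - n + q%:Z -> gr m (nprod a n b)) /\
    (p%:Z - 1 - n + q%:Z < 0 -> nprod a n b = 0) }.

(* the sum of the V_s with s < p, that is G_(p-1) V *)
Definition filt k (V : vertex_algebra k) (G : grading V) (p : nat) (a : V) :=
  exists c : nat -> V, (forall s, gr G s (c s)) /\ a = \sum_(s < p) c s.

Section Extension.
Variables (k : comNzRingType) (V : lmodType k).

Definition scal_ra (v : V) (c : k) : V := c *: v.
Definition scal_la (R : lmodType k) (c : k) (r : R) : R := c *: r.

Definition ext (R : comAlgType k) : zmodType := tens scal_ra (@scal_la R).
Definition extp (R : comAlgType k) (v : V) (r : R) : ext R :=
  pure scal_ra (@scal_la R) v r.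
Definition ext_scale (R : comAlgType k) (r : R) (u : ext R) : ext R :=
  tmap scal_ra (@scal_la R) id (fun x => r * x) u.
Definition ext_map (R S : comAlgType k) (f : R -> S) (u : ext R) : ext S :=
  tmap scal_ra (@scal_la S) id f u.

End Extension.

(* A representation of the group functor Aut O on V. The product of r and s in
   Aut O, as automorphisms of R[[t]], is the series s(r(t)). *)
Record autO_rep (k : comNzRingType) (V : lmodType k) := AutORep {
  act : forall R : comAlgType k, pseries R -> ext V R -> ext V R;
  actD : forall (R : comAlgType k) (r : pseries R) u v, is_aut r ->
    act r (u + v) = act r u + act r v;
  actZ : forall (R : comAlgType k) (r : pseries R) x u, is_aut r ->
    act r (ext_scale x u) = ext_scale x (act r u);
  act1 : forall (R : comAlgType k) (u : ext V R), act psX u = u;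
  actM : forall (R : comAlgType k) (r s : pseries R) u,
    is_aut r -> is_aut s -> act (ps_comp s r) u = act r (act s u);
  act_nat : forall (R S : comAlgType k) (f : {lrmorphism R -> S})
      (r : pseries R) u, is_aut r ->
    ext_map f (act r u) = act (fun n => f (r n)) (ext_map f u) }.

Definition actk (k : comNzRingType) (V : lmodType k) (Pi : autO_rep V)
    (r : pseries k) (a : V) : V :=
  tlift (fun (v : V) (c : k^o) => c *: v) (act Pi (r : pseries k^o) (extp a 1)).

(* the coefficient of z^n in the operator V -> V[[z]] given by a
   k[[z]]-point of Aut O *)
Definition actz (k : comNzRingType) (V : lmodType k) (Pi : autO_rep V)
    (r : pseries (pseries k)) (n : nat) (a : V) : V :=
  tlift (fun (v : V) (f : pseries k) => f n *: v) (act Pi r (extp a 1)).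

Record autO_action (k : comNzRingType) (V : vertex_algebra k)
    (G : grading V) := AutOAction {
  aa_rep :> autO_rep V;
  (* Pi(rho_z) = e^(-zT) Pi(rho) e^(rho(z)T), where rho_z = ps_recenter rho *)
  aa_recenter : forall (r : pseries k) n a, is_aut r ->
    actz aa_rep (ps_recenter r) n a =
    \sum_(i < n.+1) (-1) ^+ i *: transl i
      (actk aa_rep r (\sum_(m < (n - i).+1) (r ^+ m) (n - i)%N *: transl m a));
  aa_filt : forall (r : pseries k) n p a, is_aut r ->
    filt G p a -> filt G p (actz aa_rep (ps_recenter r) n a);
  aa_lead : forall (r v : pseries k) n p a, is_aut r -> gr G p a ->
    v * ps_deriv r = 1 ->
    filt G p (actz aa_rep (ps_recenter r) n a - (v ^+ p) n *: a);
  aa_scale : forall (x y : k) p a, y * x = 1 -> gr G p a ->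
    actk aa_rep (x *: psX) a = y ^+ p *: a;
  (* Pi(rho) Y(Pi(rho_z)^-1 a, rho(z)) c = Y(a, z) Pi(rho) c, coefficientwise
     in z^l. Here s = rho_z^-1, and v is the inverse of u = rho(z)/z, so that
     rho(z)^e = z^e u^e. *)
  aa_field : forall (r : pseries k) (s : pseries (pseries k)) (v : pseries k)
      a c (l : int),
    is_aut r -> is_aut s -> ps_comp s (ps_recenter r) = psX ->
    v * (fun n => r n.+1) = 1 ->
    exists N, forall M, (N <= M)%N ->
      actk aa_rep r (\sum_(m < M) \sum_(i < M)
        let n : int := m%:Z + i%:Z - l - 1 in
        ps_zpow (fun n => r n.+1) v (-1 - n) i
          *: nprod (actz aa_rep s m a) n c)
      = nprod a (-1 - l) (actk aa_rep r c) }.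

(* The closed subset of P^N(k) defined by a set of homogeneous equations; its
   points are the lines in k^(N+1) on which the equations vanish. *)
Record projset (k : closedFieldType) := ProjSet {
  pdim : nat;
  peqs : set {mpoly k[pdim.+1]};
  peqs_homog : forall p, peqs p -> exists d, p \is d.-homog }.

Definition pt (k : closedFieldType) (X : projset k) : Type :=
  {L : {vspace 'rV[k]_(pdim X).+1} |
    \dim L = 1%N /\
    forall p, peqs p -> forall v : 'rV[k]_(pdim X).+1, v \in L -> p.@[v 0] = 0}.

Section Functions.
Variables (k : closedFieldType) (X : projset k).
Implicit Types (x y : pt X) (U W : set (pt X)) (f g : pt X -> k).

Notation form := {mpoly k[(pdim X).+1]}.

Definition nonvanishing (p : form) x : Prop :=
  forall v : 'rV[k]_(pdim X).+1, v \in sval x -> v != 0 -> p.@[v 0] != 0.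

Definition zopen U : Prop :=
  exists2 S : set form,
    (forall p, S p -> exists d, p \is d.-homog) &
    forall x, U x <-> exists2 p, S p & nonvanishing p x.

Definition nbhd x U : Prop := zopen U /\ U x.

Definition regular_at x f : Prop :=
  exists U (d : nat) (p q : form),
    [/\ nbhd x U, p \is d.-homog, q \is d.-homog &
      forall y, U y -> nonvanishing q y /\
        forall v : 'rV[k]_(pdim X).+1, v \in sval y -> v != 0 ->
          f y = p.@[v 0] / q.@[v 0]].

Definition regular_on U f : Prop := forall x, U x -> regular_at x f.

Lemma zopenT : zopen setT.
Proof.
exists [set 1]; first by move=> p ->; exists 0%N; exact: dhomog1.
move=> x; split=> // _; exists 1 => // v _ _.
by rewrite meval1 oner_neq0.
Qed.

Lemma zopenI U W : zopen U -> zopen W -> zopen (U `&` W).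
Proof.
move=> [S hS US] [S' hS' WS'].
exists [set r | exists p q d e,
  [/\ r = p * q, S p, S' q, p \is d.-homog & q \is e.-homog]].
  by move=> _ [p [q [d [e [-> _ _ hp hq]]]]]; exists (d + e)%N; exact: dhomogM.
move=> x; split=> [[/US[p Sp px] /WS'[q Sq qx]]|].
  have [d hp] := hS _ Sp; have [e hq] := hS' _ Sq.
  exists (p * q) => [|v vx v0]; first by exists p, q, d, e.
  by rewrite mevalM mulf_neq0 ?px ?qx.
move=> [_ [p [q [d [e [-> Sp Sq _ _]]]]] pq0]; split; [apply/US|apply/WS'].
  exists p => // v vx v0; have := pq0 v vx v0.
  by rewrite mevalM mulf_eq0 negb_or => /andP[].
exists q => // v vx v0; have := pq0 v vx v0.
by rewrite mevalM mulf_eq0 negb_or => /andP[].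
Qed.

Lemma nbhdT x : nbhd x setT. Proof. by split=> //; exact: zopenT. Qed.
Lemma nbhdI x U W : nbhd x U -> nbhd x W -> nbhd x (U `&` W).
Proof. by move=> [oU Ux] [oW Wx]; split=> //; exact: zopenI. Qed.

Lemma regular_cst x (c : k) : regular_at x (fun=> c).
Proof.
exists setT, 0%N, (c *: 1), 1; split; [exact: nbhdT|exact/dhomogZ/dhomog1|exact: dhomog1|].
move=> y _; split=> [v _ _|v _ _].
  by rewrite meval1 oner_neq0.
by rewrite mevalZ meval1 mulr1 divr1.
Qed.

Lemma regularD x f g : regular_at x f -> regular_at x g -> regular_at x (f + g).
Proof.
move=> [U [d [p [q [Ux hp hq fE]]]]] [W [e [p' [q' [Wx hp' hq' gE]]]]].
exists (U `&` W), (d + e)%N, (p * q' + p' * q), (q * q'); split.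
- exact: nbhdI.
- by apply: dhomogD; [|rewrite addnC]; exact: dhomogM.
- exact: dhomogM.
move=> y [/fE[q0 fy] /gE[q'0 gy]]; split=> [v vy v0|v vy v0].
  by rewrite mevalM mulf_neq0 ?q0 ?q'0.
have -> : (f + g) y = f y + g y by []; rewrite (fy v) // (gy v) // !(mevalD, mevalM).
by rewrite addf_div ?q0 ?q'0.
Qed.

Lemma regularM x f g : regular_at x f -> regular_at x g -> regular_at x (f * g).
Proof.
move=> [U [d [p [q [Ux hp hq fE]]]]] [W [e [p' [q' [Wx hp' hq' gE]]]]].
exists (U `&` W), (d + e)%N, (p * p'), (q * q'); split.
- exact: nbhdI.
- exact: dhomogM.
- exact: dhomogM.
move=> y [/fE[q0 fy] /gE[q'0 gy]]; split=> [v vy v0|v vy v0].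
  by rewrite mevalM mulf_neq0 ?q0 ?q'0.
have -> : (f * g) y = f y * g y by [].
by rewrite (fy v) // (gy v) // !mevalM mulf_div.
Qed.

Definition reg_pred x : {pred pt X -> k} := fun f => `[< regular_at x f >].

Lemma reg_subring x : subring_closed (reg_pred x).
Proof.
split=> [|f g|f g]; rewrite ?unfold_in.
- exact/asboolP/(regular_cst x 1).
- move=> /asboolP rf /asboolP rg; apply/asboolP/regularD => //.
  have -> : - g = (fun=> -1) * g by apply/funext => y; rewrite [RHS]mulN1r.
  exact/regularM/rg/regular_cst.
- by move=> /asboolP rf /asboolP rg; apply/asboolP/regularM.
Qed.

Definition reg_fun x : Type := {f : pt X -> k | reg_pred x f}.
HB.instance Definition _ x := SubChoice.on (reg_fun x).
HB.instance Definition _ x :=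
  GRing.SubChoice_isSubComPzRing.Build _ _ (reg_fun x) (reg_subring x).

Definition vanish_near x (f : reg_fun x) : Prop :=
  exists2 U, nbhd x U & forall y, U y -> \val f y = 0.

Lemma vanish0 x : @vanish_near x 0.
Proof. by exists setT; [exact: nbhdT | move=> y _; rewrite rmorph0]. Qed.
Lemma vanishB x (f g : reg_fun x) : @vanish_near x f -> vanish_near g -> vanish_near (f - g).
Proof.
move=> [U Ux f0] [W Wx g0]; exists (U `&` W); first exact: nbhdI.
move=> y [/f0 fy /g0 gy].
have -> : \val (f - g) y = \val f y - \val g y by rewrite rmorphB.
by rewrite fy gy subrr.
Qed.
Lemma vanishM x (f g : reg_fun x) : @vanish_near x g -> vanish_near (f * g).
Proof.
move=> [U Ux g0]; exists U => // y /g0 gy.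
have -> : \val (f * g) y = \val f y * \val g y by rewrite rmorphM.
by rewrite gy mulr0.
Qed.
Lemma vanish_proper x : ~ @vanish_near x 1.
Proof.
move=> [U [_ Ux] /(_ _ Ux)]; rewrite rmorph1 => /eqP.
by rewrite (negbTE (oner_neq0 _)).
Qed.

Definition vanish_ideal x : ideal_of (reg_fun x) :=
  IdealOf (@vanish0 x) (@vanishB x) (@vanishM x) (@vanish_proper x).

Definition lring x : Type := rquot (vanish_ideal x).
HB.instance Definition _ x := GRing.ComNzRing.on (lring x).

(* the germ of f at x (of 0, if f is not regular at x) *)
Definition germ x f : lring x := rq_pi (vanish_ideal x) (insubd 0 f).

Lemma germ_val x (f : reg_fun x) : germ x (\val f) = rq_pi (vanish_ideal x) f.
Proof. by rewrite /germ valKd. Qed.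

Lemma germ_cstD x c c' :
  germ x (fun=> c + c') = germ x (fun=> c) + germ x (fun=> c').
Proof.
have R c0 : reg_pred x (fun=> c0) by exact/asboolP/regular_cst.
rewrite -[fun=> c]/(\val (Sub _ (R c) : reg_fun x)).
rewrite -[fun=> c']/(\val (Sub _ (R c') : reg_fun x)) !germ_val -rq_piD.
by rewrite -germ_val.
Qed.
Lemma germ_cstM x c c' :
  germ x (fun=> c * c') = germ x (fun=> c) * germ x (fun=> c').
Proof.
have R c0 : reg_pred x (fun=> c0) by exact/asboolP/regular_cst.
rewrite -[fun=> c]/(\val (Sub _ (R c) : reg_fun x)).
rewrite -[fun=> c']/(\val (Sub _ (R c') : reg_fun x)) !germ_val -rq_piM.
by rewrite -germ_val.
Qed.
Lemma germ_cst1 x : germ x (fun=> 1) = 1.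
Proof. by rewrite -[RHS]rq_pi1 -germ_val. Qed.

Definition lring_scale x (c : k) (u : lring x) : lring x :=
  germ x (fun=> c) * u.

Lemma lring_scaleA x a b (u : lring x) :
  lring_scale a (lring_scale b u) = lring_scale (a * b) u.
Proof. by rewrite /lring_scale germ_cstM mulrA. Qed.
Lemma lring_scale1 x : left_id 1 (@lring_scale x).
Proof. by move=> u; rewrite /lring_scale germ_cst1 mul1r. Qed.
Lemma lring_scaleDr x : right_distributive (@lring_scale x) +%R.
Proof. by move=> a u v; rewrite /lring_scale mulrDr. Qed.
Lemma lring_scaleDl x u : {morph (@lring_scale x)^~ u : a b / a + b}.
Proof. by move=> a b; rewrite /lring_scale germ_cstD mulrDl. Qed.

HB.instance Definition _ x := GRing.Zmodule_isLmodule.Build k (lring x)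
  (@lring_scaleA x) (@lring_scale1 x) (@lring_scaleDr x) (@lring_scaleDl x).

Lemma lring_scaleAl x (a : k) (u v : lring x) : a *: (u * v) = (a *: u) * v.
Proof. exact: mulrA. Qed.

HB.instance Definition _ x := GRing.Lmodule_isLalgebra.Build k (lring x)
  (@lring_scaleAl x).
HB.instance Definition _ x := GRing.Lalgebra_isComAlgebra.Build k (lring x).

Definition gval x (u : lring x) : k := \val (repr u) x.

(* t - t(x) generates the maximal ideal of O_x for all x in U, which says that
   t : U -> A^1 is etale if X is a smooth curve. *)
Definition coordinate U (t : pt X -> k) : Prop :=
  regular_on U t /\
  forall x, U x -> forall u : lring x, gval u = 0 ->
    exists w, u = w * (germ x t - (t x)%:A).

(* A formal coordinate s at x is represented by the map O_x -> k[[s]] that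
   expands germs in powers of s; such maps O_x -> k[[s]] are exactly those that
   induce an isomorphism from the completion of O_x. *)
Definition fcoord x : Type :=
  {phi : {lrmorphism lring x -> pseries k} |
    exists u, phi u 0%N = 0 /\ phi u 1%N <> 0}.

Definition expand x (phi : fcoord x) (u : lring x) : pseries k := sval phi u.

(* the k-points of the torsor of formal coordinates *)
Definition autC : Type := {x : pt X & fcoord x}.

(* phi' represents r(s), if phi represents s. *)
Definition fc_act x (phi : fcoord x) (r : pseries k) (phi' : fcoord x) : Prop :=
  forall u, expand phi u = ps_comp (expand phi' u) r.

(* phi represents the formal coordinate t - t(x). *)
Definition fc_of x (t : pt X -> k) (phi : fcoord x) : Prop :=
  expand phi (germ x t) = (t x)%:A + psX.

(* The j-th divided-power derivative along t: at x, it is the j-th coefficient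
   of the expansion of f in powers of t - t(x). *)
Definition dpderiv (t : pt X -> k) (j : nat) f : pt X -> k := fun x =>
  xget 0 [set c | exists2 phi : fcoord x,
                    fc_of t phi & c = expand phi (germ x f) j].

End Functions.

Definition is_dvr (A : comNzRingType) : Prop :=
  (forall u v : A, u * v = 0 -> u = 0 \/ v = 0) /\
  exists pi : A, [/\ pi <> 0, ~ (exists v, v * pi = 1) &
    forall u, u <> 0 -> exists n v, (exists w, w * v = 1) /\ u = v * pi ^+ n].

(* As k is algebraically closed, smoothness is regularity of the local rings.
   The curve is not required to be connected. *)
Record curve (k : closedFieldType) := Curve {
  cset :> projset k;
  curve_smooth : forall x : pt cset, is_dvr (lring x) }.

(* [osec U s] says that s, a choice of one germ at each point, is a section
   over U; only the values of s on U matter. *)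
Record omodule (k : closedFieldType) (X : projset k) := OModule {
  stalk : forall x : pt X, lmodType (lring x);
  osec : set (pt X) -> (forall x, stalk x) -> Prop;
  osec_loc : forall U s, zopen U ->
    (osec U s <-> forall x, U x -> exists2 W, nbhd x W & osec (U `&` W) s);
  osec_ext : forall U s s', (forall x, U x -> s x = s' x) ->
    osec U s -> osec U s';
  osec_span : forall x e, exists U s, [/\ nbhd x U, osec U s & s x = e];
  osec_eq : forall U s s' x, nbhd x U -> osec U s -> osec U s' -> s x = s' x ->
    exists2 W, nbhd x W & forall y, W y -> s y = s' y;
  osecD : forall U s s', osec U s -> osec U s' ->
    osec U (fun x => s x + s' x);
  osecZ : forall U f s, regular_on U f -> osec U s ->
    osec U (fun x => germ x f *: s x) }.

Section PDConnection.
Variables (k : closedFieldType) (X : projset k) (E : omodule X).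

(* sections of E (x) P^n over U: locally, finite sums of terms
   s (x) (f (x) g) for s a section of E and f, g regular functions *)
Definition ep_sec n (U : set (pt X))
    (tau : forall x : pt X, EP (stalk E x) n) : Prop :=
  forall x, U x -> exists W (m : nat)
      (s : 'I_m -> forall x, stalk E x) (f g : 'I_m -> pt X -> k),
    [/\ nbhd x W,
      forall i, [/\ osec W (s i), regular_on W (f i) & regular_on W (g i)] &
      forall y, W y -> tau y =
        \sum_(i < m) EPp (s i y) (d0 n (germ y (f i)) * d1 n (germ y (g i)))].

(* A morphism of sheaves of abelian groups E -> E (x) P^n is given by its maps
   on stalks, subject to the condition that they send sections to sections. *)
Definition conn_maps : Type :=
  forall (n : nat) (x : pt X), stalk E x -> EP (stalk E x) n.

Record pd_connection (U : set (pt X)) (Th : conn_maps) : Prop := {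
  pd_add : forall n x, U x -> forall e e', Th n x (e + e') = Th n x e + Th n x e';
  pd_lin : forall n x, U x -> forall a e, Th n x (a *: e) = EP_ra (Th n x e) a;
  pd_sec : forall n W s, zopen W -> W `<=` U -> osec W s ->
    ep_sec W (fun x => Th n x (s x));
  pd_id : forall x, U x -> forall e, Th 0%N x e = EPp e 1;
  pd_proj : forall m n x, (m <= n)%N -> U x -> forall e,
    EP_proj m (Th n x e) = Th m x e;
  pd_cocycle : forall m n x, U x -> forall e,
    EP_ext (Th m x) (Th n x e) = EP_comult (Th (m + n)%N x e) }.

End PDConnection.

Section VertexSheaf.
Variables (k : closedFieldType) (X : projset k).
Variables (V : lmodType k) (Pi : autO_rep V).
Implicit Types (x y : pt X) (U W : set (pt X)) (s : autC X -> V).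

Definition autpt x (phi : fcoord x) : autC X := existT _ x phi.

Definition equivariant U s : Prop :=
  forall x, U x -> forall (phi phi' : fcoord x) (r : pseries k),
    is_aut r -> fc_act phi r phi' ->
    actk Pi r (s (autpt phi')) = s (autpt phi).

(* in the trivialization given by t, s is an element of V (x) O(W) *)
Definition in_triv W (t : pt X -> k) s : Prop :=
  exists (m : nat) (a : 'I_m -> V) (f : 'I_m -> pt X -> k),
    (forall i, regular_on W (f i)) /\
    forall x, W x -> forall phi : fcoord x, fc_of t phi ->
      s (autpt phi) = \sum_(i < m) f i x *: a i.

Definition vsec U s : Prop :=
  equivariant U s /\
  forall W t, zopen W -> W `<=` U -> coordinate W t ->
    forall x, W x -> exists2 W', nbhd x W' & in_triv (W `&` W') t s.

Definition vsec_pred x : {pred autC X -> V} :=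
  fun s => `[< exists2 U, nbhd x U & vsec U s >].

Lemma actk_bal : balanced (@scal_ra k V) (@scal_la k k^o)
  (fun (v : V) (c : k^o) => c *: v).
Proof.
split=> [m m' n|m n n'|m a n]; first exact: scalerDr; first exact: scalerDl.
by rewrite /scal_ra /scal_la scalerA mulrC.
Qed.

Lemma extpD (R : comAlgType k) a b (r : R) :
  extp (a + b) r = extp a r + extp b r :> ext V R.
Proof. by case: (pure_balanced (@scal_ra k V) (@scal_la k R)) => + _ _; apply. Qed.

Lemma extpZ (R : comAlgType k) c a :
  extp (c *: a) 1 = ext_scale c%:A (extp a 1) :> ext V R.
Proof.
have [bD bD' bZ] := pure_balanced (@scal_ra k V) (@scal_la k R).
rewrite /ext_scale /tmap tlift_pure ?mulr1 ?[LHS]bZ //.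
by split=> [m m' n|m n n'|m d n]; rewrite ?mulrDr /= ?bD ?bD' // bZ /scal_la -scalerAr.
Qed.

Lemma actkD r a b : is_aut r -> actk Pi r (a + b) = actk Pi r a + actk Pi r b.
Proof.
move=> hr; rewrite /actk extpD actD // tliftD //; exact: actk_bal.
Qed.

Lemma actkZ r c a : is_aut r -> actk Pi r (c *: a) = c *: actk Pi r a.
Proof.
move=> hr; rewrite /actk extpZ actZ //; move: (act Pi _ _).
have D := tliftD actk_bal.
have [bD bD' bZ] := pure_balanced (@scal_ra k V) (@scal_la k k^o).
have sb : balanced (@scal_ra k V) (@scal_la k k^o)
    (fun (v : V) (x : k^o) => extp v (c%:A * x) : ext V k^o).
  split=> [m m' n|m n n'|m d n]; rewrite /extp ?mulrDr ?bD ?bD' // bZ.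
  by rewrite /scal_la -scalerAr.
apply: (@tens_morph_eq _ _ _ _ _ _
  (fun u => tlift (fun (v : V) (x : k^o) => x *: v) (ext_scale (c%:A : k^o) u))
  (fun u => c *: tlift (fun (v : V) (x : k^o) => x *: v) u)).
- by move=> u v; rewrite /ext_scale /tmap (tliftD sb) D.
- by move=> u v; rewrite D scalerDr.
move=> m n; rewrite /ext_scale /tmap (tlift_pure _ _ sb).
rewrite !(tlift_pure _ _ actk_bal) scalerA; congr (_ *: _).
by rewrite [c%:A]mulr1.
Qed.

Lemma vsec0 U : vsec U (0 : autC X -> V).
Proof.
split=> [x Ux phi phi' r hr _|W t oW _ _ x Wx].
  by rewrite -[_ (autpt phi')]/(0 : V) -(scale0r 0) actkZ // !scale0r.
exists setT; first exact: nbhdT.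
exists 0%N, (fun=> 0), (fun=> fun=> 0); split; first by case.
by move=> y _ phi _; rewrite big_ord0.
Qed.

Lemma vsecD U s s' : vsec U s -> vsec U s' -> vsec U (s + s').
Proof.
move=> [es rs] [es' rs']; split=> [x Ux phi phi' r hr h|W t oW WU ct x Wx].
  by rewrite /= actkD // (es x Ux phi phi' r) // (es' x Ux phi phi' r).
have [W1 W1x [m [a [f [rf sE]]]]] := rs W t oW WU ct x Wx.
have [W2 W2x [n [b [g [rg s'E]]]]] := rs' W t oW WU ct x Wx.
exists (W1 `&` W2); first exact: nbhdI.
exists (m + n)%N.
exists (fun i => match fintype.split i with inl j => a j | inr j => b j end).
exists (fun i => match fintype.split i with inl j => f j | inr j => g j end).
split=> [i|y [Wy [W1y W2y]] phi tphi].
  by case: (fintype.split i) => j y [Wy [W1y W2y]]; [apply: rf|apply: rg].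
rewrite big_split_ord /= -[LHS]/(s _ + s' _) (sE y) // (s'E y) //.
congr (_ + _); apply: eq_bigr => i _.
  by rewrite (unsplitK (inl i)).
by rewrite (unsplitK (inr i)).
Qed.

Definition fscale (f : pt X -> k) s : autC X -> V :=
  fun p => f (projT1 p) *: s p.

Lemma vsecZ U f s : regular_on U f -> vsec U s -> vsec U (fscale f s).
Proof.
move=> rf [es rs]; split=> [x Ux phi phi' r hr h|W t oW WU ct x Wx].
  by rewrite /fscale /= actkZ // (es x Ux phi phi' r).
have [W1 W1x [m [a [g [rg sE]]]]] := rs W t oW WU ct x Wx.
exists W1 => //; exists m, a, (fun i => f * g i).
split=> [i y [Wy W1y]|y WW1y phi tphi].
  by apply: regularM; [apply/rf/WU|apply: rg].
rewrite /fscale /= (sE y) // scaler_sumr; apply: eq_bigr => i _.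
by rewrite scalerA.
Qed.

Lemma vsec_sub U W s : W `<=` U -> vsec U s -> vsec W s.
Proof.
move=> WU [es rs]; split=> [x /WU Ux|W' t oW' W'W]; first exact: es.
by apply: rs => //; apply: subset_trans WU.
Qed.

Lemma vsec_zmod x : zmod_closed (@vsec_pred x).
Proof.
split=> [|s s']; rewrite ?unfold_in.
  by apply/asboolP; exists setT; [exact: nbhdT|exact: vsec0].
move=> /asboolP[U Ux hs] /asboolP[W Wx hs']; apply/asboolP.
exists (U `&` W); first exact: nbhdI.
apply: vsecD; first by apply: vsec_sub hs; exact: subIsetl.
have -> : - s' = fscale (fun=> -1) s'.
  by apply/funext => p; rewrite /fscale scaleN1r.
apply: vsecZ; last by apply: vsec_sub hs'; exact: subIsetr.
by move=> y _; exact: regular_cst.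
Qed.

Definition vnear x : Type := {s : autC X -> V | vsec_pred x s}.
HB.instance Definition _ x := SubChoice.on (vnear x).
HB.instance Definition _ x :=
  GRing.SubChoice_isSubZmodule.Build _ _ (vnear x) (@vsec_zmod x).

Definition eq_near x s s' : Prop :=
  exists2 U, nbhd x U & forall y, U y -> forall phi : fcoord y,
    s (autpt phi) = s' (autpt phi).

Definition vvanish x : {pred vnear x} := fun s : vnear x => `[< eq_near x (\val s) 0 >].

Lemma vvanish_zmod x : zmod_closed (@vvanish x).
Proof.
split=> [|s s']; rewrite ?unfold_in.
  by apply/asboolP; exists setT; [exact: nbhdT|move=> y _ phi; rewrite raddf0].
move=> /asboolP[U Ux hs] /asboolP[W Wx hs']; apply/asboolP.
exists (U `&` W); first exact: nbhdI.
move=> y [Uy Wy] phi.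
have -> : \val (s - s') (autpt phi) = \val s (autpt phi) - \val s' (autpt phi).
  by rewrite raddfB.
by rewrite hs // hs' // subrr.
Qed.

HB.instance Definition _ x :=
  GRing.isZmodClosed.Build (vnear x) (@vvanish x) (@vvanish_zmod x).

Definition vstalk x : Type := {ideal_quot (@vvanish x)}.
HB.instance Definition _ x := GRing.Zmodule.on (vstalk x).

Definition vpi x (s : vnear x) : vstalk x := \pi_({ideal_quot (@vvanish x)}) s.

Lemma vpi_eq x (s s' : vnear x) :
  vpi s = vpi s' <-> eq_near x (\val s) (\val s').
Proof.
have -> : (vpi s = vpi s') <-> (s - s' \in @vvanish x).
  by rewrite Quotient.idealrBE; split=> [H|/eqP]; [exact/eqP|].
have E y (phi : fcoord y) :
    \val (s - s') (autpt phi) = \val s (autpt phi) - \val s' (autpt phi).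
  by rewrite raddfB.
split=> [/asboolP|] [U Ux H].
  exists U => // y Uy phi; apply/eqP; rewrite -subr_eq0 -E.
  by rewrite (H y).
apply/asboolP; exists U => // y Uy phi; rewrite E (H y) // subrr.
by [].
Qed.

Lemma vpiD x (s s' : vnear x) : vpi (s + s') = vpi s + vpi s'.
Proof. exact: Quotient.pi_add. Qed.

(* the germ of s at x (of 0, if s is not a section near x) *)
Definition vgerm x s : vstalk x := vpi (insubd 0 s).

Lemma vgerm_val x (s : vnear x) : vgerm x (\val s) = vpi s.
Proof. by rewrite /vgerm valKd. Qed.

Lemma vgerm_eq x U s s' : nbhd x U -> vsec U s -> vsec U s' ->
  vgerm x s = vgerm x s' <-> eq_near x s s'.
Proof.
move=> Ux hs hs'.
have p0 s0 : vsec U s0 -> vsec_pred x s0 by move=> h; apply/asboolP; exists U.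
rewrite -[s]/(\val (Sub s (p0 _ hs) : vnear x)).
rewrite -[s']/(\val (Sub s' (p0 _ hs') : vnear x)) !vgerm_val.
exact: vpi_eq.
Qed.

Lemma vgermD x U s s' : nbhd x U -> vsec U s -> vsec U s' ->
  vgerm x (s + s') = vgerm x s + vgerm x s'.
Proof.
move=> Ux hs hs'.
have p0 s0 : vsec U s0 -> vsec_pred x s0 by move=> h; apply/asboolP; exists U.
rewrite -[s]/(\val (Sub s (p0 _ hs) : vnear x)).
rewrite -[s']/(\val (Sub s' (p0 _ hs') : vnear x)) -raddfD !vgerm_val.
exact: vpiD.
Qed.

Lemma regular_near x f : regular_at x f -> exists2 U, nbhd x U & regular_on U f.
Proof.
move=> [U [d [p [q [[oU Ux] hp hq fE]]]]]; exists U => // y Uy.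
by exists U, d, p, q.
Qed.

Lemma vnear_scale_proof x (f : reg_fun x) (s : vnear x) :
  vsec_pred x (fscale (\val f) (\val s)).
Proof.
have /asboolP/regular_near[U Ux rf] := valP f.
have /asboolP[W Wx hs] := valP s.
apply/asboolP; exists (U `&` W); first exact: nbhdI.
apply: vsecZ; last by apply: vsec_sub hs; exact: subIsetr.
by move=> y [Uy _]; exact: rf.
Qed.

Definition vnear_scale x (f : reg_fun x) (s : vnear x) : vnear x :=
  Sub _ (vnear_scale_proof f s).

Lemma vnear_scaleE x (f : reg_fun x) (s : vnear x) :
  \val (vnear_scale f s) = fscale (\val f) (\val s).
Proof. by []. Qed.

Definition vstalk_scale x (u : lring x) (e : vstalk x) : vstalk x :=
  vpi (vnear_scale (repr u) (repr e)).

Lemma vstalk_scaleE x (f : reg_fun x) (s : vnear x) :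
  vstalk_scale (rq_pi (vanish_ideal x) f) (vpi s) = vpi (vnear_scale f s).
Proof.
rewrite /vstalk_scale; apply/vpi_eq.
have [U Ux fE] : vanish_near (repr (rq_pi (vanish_ideal x) f) - f).
  by apply/(rq_piE (vanish_ideal x)); rewrite /rq_pi reprK.
have [W Wx sE] : eq_near x (\val (repr (vpi s))) (\val s).
  by apply/vpi_eq; rewrite /vpi reprK.
exists (U `&` W); first exact: nbhdI.
move=> y [Uy Wy] phi; rewrite !vnear_scaleE /fscale (sE y) //=.
congr (_ *: _); apply/eqP; rewrite -subr_eq0 -(fE y Uy).
by apply/eqP; rewrite raddfB.
Qed.

Lemma vstalk_ind x (P : vstalk x -> Prop) : (forall s : vnear x, P (vpi s)) -> forall e, P e.
Proof. by move=> H e; rewrite -[e]reprK; apply: H. Qed.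

Lemma lring_ind x (P : lring x -> Prop) :
  (forall f, P (rq_pi (vanish_ideal x) f)) -> forall u, P u.
Proof. by move=> H u; rewrite -[u]reprK; apply: H. Qed.

Lemma vpi_ext x (s s' : vnear x) : \val s = \val s' -> vpi s = vpi s'.
Proof. by move/val_inj->. Qed.

Lemma vstalk_scaleA x u v (e : vstalk x) :
  vstalk_scale u (vstalk_scale v e) = vstalk_scale (u * v) e.
Proof.
elim/lring_ind: u => f; elim/lring_ind: v => g; elim/vstalk_ind: e => s.
rewrite -rq_piM !vstalk_scaleE; apply: vpi_ext; rewrite !vnear_scaleE.
by apply/funext => p; rewrite /fscale scalerA.
Qed.
Lemma vstalk_scale1 x : left_id 1 (@vstalk_scale x).
Proof.
elim/vstalk_ind => s; rewrite -rq_pi1 vstalk_scaleE; apply: vpi_ext.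
by rewrite !vnear_scaleE rmorph1; apply/funext => p; rewrite /fscale scale1r.
Qed.
Lemma vstalk_scaleDr x : right_distributive (@vstalk_scale x) +%R.
Proof.
elim/lring_ind => f; elim/vstalk_ind => s; elim/vstalk_ind => s'.
rewrite -vpiD !vstalk_scaleE -vpiD; apply: vpi_ext; rewrite raddfD !vnear_scaleE.
by rewrite raddfD; apply/funext => p; rewrite /fscale [LHS]scalerDr.
Qed.
Lemma vstalk_scaleDl x e : {morph (@vstalk_scale x)^~ e : a b / a + b}.
Proof.
elim/lring_ind => f; elim/lring_ind => g; elim/vstalk_ind: e => s.
rewrite -rq_piD !vstalk_scaleE -vpiD; apply: vpi_ext; rewrite raddfD !vnear_scaleE.
by rewrite raddfD; apply/funext => p; rewrite /fscale [LHS]scalerDl.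
Qed.

HB.instance Definition _ x := GRing.Zmodule_isLmodule.Build (lring x) (vstalk x)
  (@vstalk_scaleA x) (@vstalk_scale1 x) (@vstalk_scaleDr x) (@vstalk_scaleDl x).

Lemma vgermZ x U f s : nbhd x U -> regular_on U f -> vsec U s ->
  vgerm x (fscale f s) = germ x f *: vgerm x s.
Proof.
move=> [oU Ux] rf hs.
have pf : reg_pred x f by apply/asboolP/rf.
have ps : vsec_pred x s by apply/asboolP; exists U.
rewrite -[f]/(\val (Sub f pf : reg_fun x)) germ_val.
rewrite -[s]/(\val (Sub s ps : vnear x)) vgerm_val.
by rewrite [RHS]vstalk_scaleE -vgerm_val.
Qed.

Definition vosec U (sigma : forall x, vstalk x) : Prop :=
  forall x, U x -> exists W s, [/\ nbhd x W, vsec W s &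
    forall y, U y -> W y -> sigma y = vgerm y s].

Lemma vosec_loc U sigma : zopen U ->
  (vosec U sigma <->
   forall x, U x -> exists2 W, nbhd x W & vosec (U `&` W) sigma).
Proof.
move=> oU; split=> [H x Ux|H x Ux].
  exists setT; first exact: nbhdT.
  move=> y [/H[W [s [Wy hs sE]]] _]; exists W, s; split=> // z [Uz _].
  exact: sE.
have [W Wx /(_ x)[|W' [s [W'x hs sE]]]] := H x Ux.
  by split=> //; case: Wx.
exists (W `&` W'), s; split; first exact: nbhdI.
  by apply: vsec_sub hs; exact: subIsetr.
by move=> y Uy [Wy W'y]; exact: sE.
Qed.

Lemma vosec_ext U sigma sigma' : (forall x, U x -> sigma x = sigma' x) ->
  vosec U sigma -> vosec U sigma'.
Proof.
move=> E H x /H[W [s [Wx hs sE]]]; exists W, s; split=> // y Uy Wy.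
by rewrite -E // sE.
Qed.

Lemma vosec_span x (e : vstalk x) :
  exists U sigma, [/\ nbhd x U, vosec U sigma & sigma x = e].
Proof.
elim/vstalk_ind: e => s; have /asboolP[U Ux hs] := valP s.
exists U, (fun y => vgerm y (\val s)); split; [by []| |exact: vgerm_val].
by move=> y Uy; exists U, (\val s); split=> //; split=> //; case: Ux.
Qed.

Lemma vosec_eq U sigma sigma' x : nbhd x U -> vosec U sigma ->
  vosec U sigma' -> sigma x = sigma' x ->
  exists2 W, nbhd x W & forall y, W y -> sigma y = sigma' y.
Proof.
move=> Ux /(_ x)[|W [s [Wx hs sE]]]; first by case: Ux.
move=> /(_ x)[|W' [s' [W'x hs' s'E]]]; first by case: Ux.
have WW'x := nbhdI Wx W'x.
have hs1 : vsec (W `&` W') s by apply: vsec_sub hs; exact: subIsetl.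
have hs'1 : vsec (W `&` W') s' by apply: vsec_sub hs'; exact: subIsetr.
rewrite sE ?s'E; try by [case: Ux|case: Wx|case: W'x].
move=> /(vgerm_eq WW'x hs1 hs'1)[W'' W''x E].
exists (U `&` (W `&` W') `&` W''); first exact/nbhdI/W''x/nbhdI/WW'x.
move=> y [[Uy [Wy W'y]] W''y]; rewrite sE ?s'E //.
apply/(@vgerm_eq y (W `&` W')) => //; first by split=> //; case: WW'x.
by exists W'' => //; split=> //; case: W''x.
Qed.

Lemma vosecD U sigma sigma' : vosec U sigma -> vosec U sigma' ->
  vosec U (fun x => sigma x + sigma' x).
Proof.
move=> H H' x Ux; have [W [s [Wx hs sE]]] := H x Ux.
have [W' [s' [W'x hs' s'E]]] := H' x Ux.
have WW'x := nbhdI Wx W'x.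
have hs1 : vsec (W `&` W') s by apply: vsec_sub hs; exact: subIsetl.
have hs'1 : vsec (W `&` W') s' by apply: vsec_sub hs'; exact: subIsetr.
exists (W `&` W'), (s + s'); split=> //; first exact: vsecD.
move=> y Uy [Wy W'y]; rewrite sE // s'E //; apply/esym.
apply: (@vgermD y (W `&` W')) => //.
  by split; [case: WW'x|].
Qed.

Lemma vosecZ U f sigma : regular_on U f -> vosec U sigma ->
  vosec U (fun x => germ x f *: sigma x).
Proof.
move=> rf H x Ux; have [W [s [Wx hs sE]]] := H x Ux.
have [W' W'x rf'] := regular_near (rf x Ux).
have WW'x := nbhdI Wx W'x.
have hs1 : vsec (W `&` W') s by apply: vsec_sub hs; exact: subIsetl.
have rf1 : regular_on (W `&` W') f by move=> y [_]; exact: rf'.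
exists (W `&` W'), (fscale f s); split=> //; first exact: vsecZ.
move=> y Uy [Wy W'y]; rewrite sE //; apply/esym.
by apply: (@vgermZ y (W `&` W')) => //; split; [case: WW'x|].
Qed.

Definition vsheaf : omodule X := @OModule k X vstalk vosec
  vosec_loc vosec_ext vosec_span vosec_eq vosecD vosecZ.

(* The section of the vertex algebra sheaf that corresponds to a (x) f in the
   trivialization given by t: if s is a formal coordinate at x and
   t - t(x) = r(s), then (x, s, Pi(r) a) ~ (x, t - t(x), a). *)
Definition triv (t : pt X -> k) (a : V) (f : pt X -> k) : autC X -> V :=
  fun p => let: existT x phi := p in
    f x *: actk Pi (expand phi (germ x t) - (t x)%:A) a.

End VertexSheaf.

Arguments vsheaf {k} X {V} Pi.
Arguments triv {k X V} Pi t a f _.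
Arguments vgerm {k X V} Pi x s.

(* Th is the family of maps of sheaves on U determined by the formula for
   Th_n(a (x) f): a and f range over sections on all open subsets W of U, which
   generate the stalks of the vertex algebra sheaf at points of U. *)
Definition defines_conn (k : closedFieldType) (X : projset k)
    (V : vertex_algebra k) (Pi : autO_rep V) (U : set (pt X))
    (t : pt X -> k) (Th : conn_maps (vsheaf X Pi)) : Prop :=
  (forall n x, U x -> forall e e', Th n x (e + e') = Th n x e + Th n x e') /\
  forall (n : nat) (W : set (pt X)) (a : V) (f : pt X -> k),
    zopen W -> W `<=` U -> regular_on W f ->
    forall x, W x ->
      Th n x (vgerm Pi x (triv Pi t a f)) =
      \sum_(j < n.+1) \sum_(i < j.+1)
        EPp (vgerm Pi x (triv Pi t (transl i a) (dpderiv t (j - i) f))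
               : stalk (vsheaf X Pi) x)
            (delta n (germ x t) ^+ j).

(* Main.v *)
Require Import Defs.
From HB Require Import structures.
From mathcomp Require Import all_boot all_algebra.
From mathcomp Require Import ring.
From mathcomp Require Import boolp classical_sets functions mpoly.
Set Implicit Arguments.
Unset Strict Implicit.
Unset Printing Implicit Defensive.
Import GRing.Theory.
Local Open Scope ring_scope.
Local Open Scope quotient_scope.
Local Open Scope classical_set_scope.

(** At a point x with coordinate t, the stalk of the sheaf is V (x) O_x, and by
    Taylor's formula d_1 f = sum_j d_0(D_j f) (delta t)^j in P^n, where D_j is
    the j-th divided-power derivation, the connection takes the form
      Theta_n(a (x) f) = sum_i T_i(a) (x) (delta t)^i d_1(f).
    Right linearity is then visible, and the cocycle condition reduces to
    T_i T_j = C(i+j, i) T_(i+j) and the binomial formula for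
    delta t |-> delta t (x) 1 + 1 (x) delta t.

    Independence of t: if r_y is the expansion of t' - t'(y) in powers of
    t - t(y), the two trivializations differ by Pi(r_y), and both sides of the
    required identity are determined by their values at the points y near x.
    There the identity is
      sum_i T_i Z_(q-i) = sum_i (r_y^i)_q Pi(r_y) T_i a,
    where Z_q is the z^q-coefficient of the operator attached to the recentred
    automorphism r_y(s + z) - r_y(z), that is,
    e^(zT) (e^(-zT) Pi(r) e^(r(z)T)) = Pi(r) e^(r(z)T).

    The algebraic geometry (coordinates stay coordinates nearby, derivatives of
    regular functions are regular, Taylor's formula in P^n) rests on one form of
    Nakayama's lemma: the affine coordinate functions x_i satisfy
    x_i = c_i + w_i (t - t(x)) near x, so the quantities to be controlled solve
    a linear system whose matrix is the identity modulo the maximal ideal. *)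

(** * Regular functions and germs *)

(** The characteristic of [k] is arbitrary, so D_j cannot be a j-fold derivative divided by j!. It
    is given point by point, as a coefficient of an expansion, and its regularity as a function of
    the point has to be proved. Identities between the D_j are handled in all orders at once: the
    full expansion is a ring homomorphism.

    The operators Z_q arise as follows. The coefficients of r_y are the D_j t' at y, so moving y by
    z turns r_y(s) into r_y(s + z) - r_y(z). Hence D_q applied to the coefficients of Pi(r_y) a, as
    functions of y, gives Z_q a. That these coefficients are finitely many regular functions is
    where Pi has to be functorial in the coefficient ring: the r_y together form one point of Aut O
    over a ring of functions.

    The stalks of the sheaf are germs of equivariant functions on the torsor of formal coordinates,
    and the bijection with V (x) O_x has to be established. Each stalk then carries one map,
    characterized in all coordinates at once, so that no separate gluing is required. *)

Lemma meval_scale (R : comNzRingType) n (p : {mpoly R[n]}) d c (v : 'I_n -> R) :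
  p \is d.-homog -> p.@[fun i => c * v i] = c ^+ d * p.@[v].
Proof.
move=> /dhomogP hp; rewrite !mevalE mulr_sumr big_seq [RHS]big_seq.
apply: eq_bigr => m /hp /= <-; rewrite mulrCA; congr (_ * _).
rewrite mdegE -prodrXr -big_split /=.
by apply: eq_bigr => i _; rewrite exprMn.
Qed.

Section LocalFunctions.
Variables (k : closedFieldType) (X : projset k).
Implicit Types (x y : pt X) (U W : set (pt X)) (f g : pt X -> k).

Definition near x (P : pt X -> Prop) : Prop :=
  exists2 U, nbhd x U & forall y, U y -> P y.

Lemma near_pt x P : near x P -> P x.
Proof. by move=> [U [_ Ux]]; apply. Qed.

Lemma nearI x P Q : near x P -> near x Q -> near x (fun y => P y /\ Q y).
Proof.
move=> [U Ux HU] [W Wx HW]; exists (U `&` W); first exact: nbhdI.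
by move=> y [/HU ? /HW].
Qed.

Lemma nearT x (P : pt X -> Prop) : (forall y, P y) -> near x P.
Proof. by move=> H; exists setT; [exact: nbhdT|move=> y _]. Qed.

Lemma nearS x (P Q : pt X -> Prop) : (forall y, P y -> Q y) -> near x P -> near x Q.
Proof. by move=> H [U Ux HU]; exists U => // y /HU /H. Qed.

Lemma near_near x P : near x P -> near x (fun y => near y P).
Proof. by move=> [U [oU Ux] HU]; exists U => // y Uy; exists U. Qed.

Lemma near_nbhd U x : zopen U -> U x -> near x U.
Proof. by move=> oU Ux; exists U. Qed.

Lemma near_all x (I : finType) (P : I -> pt X -> Prop) :
  (forall i, near x (P i)) -> near x (fun y => forall i, P i y).
Proof.
move=> H.
suff [U Ux HU] : near x (fun y => forall i, i \in enum I -> P i y).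
  by exists U => // y Uy i; apply: HU; rewrite ?mem_enum.
elim: (enum I) => [|i s IH]; first exact: nearT.
apply: nearS (nearI (H i) IH) => y [Pi Ps] j.
by rewrite inE => /orP[/eqP->|/Ps].
Qed.

Lemma near_seq x (I : eqType) (s : seq I) (P : I -> pt X -> Prop) :
  (forall i, i \in s -> near x (P i)) -> near x (fun y => forall i, i \in s -> P i y).
Proof.
elim: s => [|i s IH] H; first exact: nearT.
have Hs : forall j, j \in s -> near x (P j).
  by move=> j js; apply: H; rewrite inE js orbT.
apply: nearS (nearI (H i (mem_head _ _)) (IH Hs)) => y [Pi Ps] j.
by rewrite inE => /orP[/eqP->|/Ps].
Qed.

Lemma regular_eq x f g : near x (fun y => f y = g y) -> regular_at x f -> regular_at x g.
Proof.
move=> [W Wx E] [U [d [p [q [Ux hp hq fE]]]]].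
exists (W `&` U), d, p, q; split=> //; first exact: nbhdI.
move=> y [/E <-]; exact: fE.
Qed.

Lemma regular_nearE x f : regular_at x f -> near x (fun y => regular_at y f).
Proof. by move/regular_near => [U Ux H]; exists U. Qed.

Lemma pt_vec x : exists2 v : 'rV[k]_(pdim X).+1, v \in sval x & v != 0.
Proof.
exists (vpick (sval x)); first exact: memv_pick.
by rewrite vpick0 -dimv_eq0; case: (svalP x) => ->.
Qed.

Lemma pt_line x (v w : 'rV[k]_(pdim X).+1) : v \in sval x -> v != 0 -> w \in sval x ->
  exists c, w = c *: v.
Proof.
move=> vx v0 wx.
have E : sval x = <[v]>%VS.
  apply/eqP; rewrite eq_sym eqEdim -memvE vx /= dim_vline v0.
  by case: (svalP x) => ->.
by move: wx; rewrite E => /vlineP[c ->]; exists c.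
Qed.

Lemma regularV x f : regular_at x f -> f x != 0 -> regular_at x (fun y => (f y)^-1).
Proof.
move=> [U [d [p [q [[oU Ux] hp hq fE]]]]] f0.
exists (U `&` [set y | nonvanishing p y]), d, q, p; split=> //.
  apply: nbhdI => //; split.
    exists [set p] => [_ ->|y]; first by exists d.
    by split=> [H|[_ ->]] //; exists p.
  move=> v vx v0; have [q0 fx] := fE x Ux.
  by move: f0; rewrite (fx v) // mulf_eq0 negb_or => /andP[].
move=> y [/fE[_ fy] p0]; split=> // v vy v0; by rewrite (fy v) // invf_div.
Qed.

(** The affine coordinate x_i / x_(i0). By [chartE] it does not depend on the spanning vector
    [vpick]; where x_(i0) vanishes, division by zero gives the value 0. *)
Definition chart (i0 : 'I_(pdim X).+1) (i : 'I_(pdim X).+1) : pt X -> k :=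
  fun y => let v := vpick (sval y) in v 0 i / v 0 i0.

Definition in_chart (i0 : 'I_(pdim X).+1) x : Prop := vpick (sval x) 0 i0 != 0.

Lemma in_chart_ex x : exists i0, in_chart i0 x.
Proof.
have: vpick (sval x) != 0 by rewrite vpick0 -dimv_eq0; case: (svalP x) => ->.
by move=> /rV0Pn.
Qed.

Lemma chartE i0 i y v : v \in sval y -> v != 0 -> chart i0 i y = v 0 i / v 0 i0.
Proof.
move=> vy v0; have [c E] := pt_line vy v0 (memv_pick _).
have c0 : c != 0.
  apply/eqP => c0; move: (vpick0 (sval y)); rewrite E c0 scale0r eqxx.
  by rewrite -dimv_eq0; case: (svalP y) => ->.
by rewrite /chart E !mxE -mulf_div divff // mul1r.
Qed.

Lemma in_chartE i0 y : in_chart i0 y <-> nonvanishing 'X_i0 y.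
Proof.
split=> [H v vy v0|H]; last first.
  rewrite /in_chart; have := H _ (memv_pick _); rewrite vpick0 mevalXU; apply.
  by rewrite -dimv_eq0; case: (svalP y) => ->.
rewrite mevalXU; have [c E] := pt_line vy v0 (memv_pick _).
by move: H; rewrite /in_chart E mxE mulf_eq0 negb_or => /andP[].
Qed.

Lemma in_chart_near i0 x : in_chart i0 x -> near x (in_chart i0).
Proof.
move=> H; exists [set y | nonvanishing 'X_i0 y]; last by move=> y /in_chartE.
split; last exact/in_chartE.
exists [set 'X_i0] => [_ ->|y]; first by exists 1%N; rewrite dhomogX /= mdeg1.
by split=> [?|[_ ->]] //; exists 'X_i0.
Qed.

Lemma regular_chart i0 x i : in_chart i0 x -> regular_at x (chart i0 i).
Proof.
move=> /in_chart_near[U Ux H].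
exists U, 1%N, 'X_i, 'X_i0; split; rewrite ?dhomogX /= ?mdeg1 //.
move=> y /H /in_chartE Hy; split=> // v vy v0; by rewrite !mevalXU (chartE _ _ vy).
Qed.

(** * Regular functions as quotients of polynomials in affine coordinates *)

Section RegularInd.
Variables (i0 : 'I_(pdim X).+1) (x : pt X) (P : (pt X -> k) -> Prop).
Hypothesis xi0 : in_chart i0 x.
Hypothesis PC : forall c, P (fun=> c).
Hypothesis PD : forall f g, regular_at x f -> regular_at x g -> P f -> P g -> P (f + g).
Hypothesis PM : forall f g, regular_at x f -> regular_at x g -> P f -> P g -> P (f * g).
Hypothesis PV : forall f, regular_at x f -> f x != 0 -> P f -> P (fun y => (f y)^-1).
Hypothesis Pnear : forall f g, regular_at x f -> near x (fun y => f y = g y) -> P f -> P g.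
Hypothesis Pchart : forall i, P (chart i0 i).

(** Dehomogenization: a form of degree d divided by the d-th power of x_(i0) is a polynomial in the
    affine coordinates, and this power cancels in a quotient of two forms of the same degree. *)
Lemma regular_ind f : regular_at x f -> P f.
Proof.
pose ev (p : {mpoly k[(pdim X).+1]}) := fun y : pt X => p.@[fun i => chart i0 i y].
have evP p : regular_at x (ev p) /\ P (ev p).
  elim/mpolyind: p => [|c m p _ _ [rp Pp]].
    rewrite (_ : ev 0 = fun=> 0); first by split=> //; exact: regular_cst.
    by apply/funext => y; rewrite /ev meval0.
  pose h := (fun=> c) * (fun y => \prod_(i < (pdim X).+1) chart i0 i y ^+ m i).
  have [rh Ph] : regular_at x h /\ P h.
    have [r1 P1] : regular_at x (fun y => \prod_(i < (pdim X).+1) chart i0 i y ^+ m i) /\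
         P (fun y => \prod_(i < (pdim X).+1) chart i0 i y ^+ m i).
      elim: (index_enum _) => [|i s [rs Ps]].
        rewrite (_ : (fun _ => _) = fun=> 1); first by split=> //; exact: regular_cst.
        by apply/funext => y; rewrite big_nil.
      rewrite (_ : (fun _ => _) = (fun y => chart i0 i y ^+ m i) *
               (fun y => \prod_(j <- s) chart i0 j y ^+ m j)); last first.
        by apply/funext => y; rewrite big_cons.
      have [r2 P2] : regular_at x (fun y => chart i0 i y ^+ m i) /\
                     P (fun y => chart i0 i y ^+ m i).
        elim: (m i) => [|n [rn Pn]].
          rewrite (_ : (fun _ => _) = fun=> 1); first by split=> //; exact: regular_cst.
          by apply/funext.
        rewrite (_ : (fun _ => _) = chart i0 i * (fun y => chart i0 i y ^+ n)); last first.
          by apply/funext => y; rewrite exprS.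
        split; first by apply: regularM => //; exact: regular_chart.
        by apply: PM => //; exact: regular_chart.
      by split; [exact: regularM|exact: PM].
    split; first by apply: regularM => //; exact: regular_cst.
    by apply: PM => //; exact: regular_cst.
  rewrite (_ : ev _ = h + ev p); first by split; [exact: regularD|exact: PD].
  by apply/funext => y; rewrite /ev mevalD mevalZ mevalX.
move=> rf; have [U [d [p [q [Ux hp hq fE]]]]] := rf.
have E (r : {mpoly k[(pdim X).+1]}) y : in_chart i0 y -> r \is d.-homog ->
    ev r y = (vpick (sval y) 0 i0) ^- d * r.@[vpick (sval y) 0].
  move=> yi0 hr; rewrite -exprVn -(meval_scale _ _ hr) /ev.
  by congr (_.@[_]); apply/funext => i; rewrite /chart mulrC.
have [rp Pp] := evP p; have [rq Pq] := evP q.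
have v0 y : vpick (sval y) != 0.
  by rewrite vpick0 -dimv_eq0; case: (svalP y) => ->.
have q0 : ev q x != 0.
  rewrite E // mulf_neq0 ?invr_eq0 ?expf_neq0 //.
  by have [+ _] := fE x (proj2 Ux); apply; rewrite ?memv_pick.
have rV := regularV rq q0.
apply: (@Pnear (ev p * (fun y => (ev q y)^-1))); first exact: regularM.
  apply: nearS (nearI (in_chart_near xi0) (ex_intro2 _ _ _ Ux (fun y Uy => Uy))).
  move=> y [yi0 /fE[_ /(_ _ (memv_pick _) (v0 y)) ->]].
  transitivity (ev p y / ev q y) => //; rewrite (E p) // (E q) // -mulf_div divff ?mul1r //.
  by rewrite invr_eq0 expf_neq0.
by apply: PM => //; exact: PV.
Qed.

End RegularInd.

Lemma germ_near x f g : regular_at x f -> near x (fun y => f y = g y) ->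
  germ x f = germ x g.
Proof.
move=> rf E; have rg := regular_eq E rf.
have pf : reg_pred x f by apply/asboolP.
have pg : reg_pred x g by apply/asboolP.
rewrite -[f]/(\val (Sub f pf : reg_fun x)) -[g]/(\val (Sub g pg : reg_fun x)) !germ_val.
apply/rq_piE; case: E => U Ux E; exists U => // y /E {}E.
by rewrite rmorphB; transitivity (f y - g y) => //; rewrite E subrr.
Qed.

Lemma germ_inj x f g : regular_at x f -> regular_at x g -> germ x f = germ x g ->
  near x (fun y => f y = g y).
Proof.
move=> rf rg.
have pf : reg_pred x f by apply/asboolP.
have pg : reg_pred x g by apply/asboolP.
rewrite -[f]/(\val (Sub f pf : reg_fun x)) -[g]/(\val (Sub g pg : reg_fun x)) !germ_val.
move=> /rq_piE [U Ux E]; exists U => // y /E.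
by rewrite rmorphB => E'; apply/eqP; rewrite -subr_eq0; apply/eqP.
Qed.

Lemma germP x (u : lring x) : exists2 f, regular_at x f & u = germ x f.
Proof.
by elim/lring_ind: u => f; exists (\val f); [exact/asboolP/(valP f)|rewrite germ_val].
Qed.

Lemma germD x f g : regular_at x f -> regular_at x g ->
  germ x (f + g) = germ x f + germ x g.
Proof.
move=> rf rg; have pf : reg_pred x f by apply/asboolP.
have pg : reg_pred x g by apply/asboolP.
rewrite -[f]/(\val (Sub f pf : reg_fun x)) -[g]/(\val (Sub g pg : reg_fun x)) !germ_val.
by rewrite -rq_piD -germ_val.
Qed.

Lemma germM x f g : regular_at x f -> regular_at x g ->
  germ x (f * g) = germ x f * germ x g.
Proof.
move=> rf rg; have pf : reg_pred x f by apply/asboolP.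
have pg : reg_pred x g by apply/asboolP.
rewrite -[f]/(\val (Sub f pf : reg_fun x)) -[g]/(\val (Sub g pg : reg_fun x)) !germ_val.
by rewrite -rq_piM -germ_val.
Qed.

Lemma germC x c : germ x (fun=> c) = c%:A.
Proof. by rewrite /GRing.scale /= /lring_scale mulr1. Qed.

Lemma gval_germ x f : regular_at x f -> gval (germ x f) = f x.
Proof.
move=> rf; have pf : reg_pred x f by apply/asboolP.
rewrite -[f]/(\val (Sub f pf : reg_fun x)) germ_val /gval.
set u := rq_pi _ _; have : rq_pi (vanish_ideal x) (repr u) = u by rewrite /rq_pi reprK.
move=> /rq_piE[U [_ Ux] /(_ x Ux)]; rewrite rmorphB => E.
by apply/eqP; rewrite -subr_eq0; apply/eqP.
Qed.

Lemma gvalD x (u v : lring x) : gval (u + v) = gval u + gval v.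
Proof.
have [f rf ->] := germP u; have [g rg ->] := germP v.
by rewrite -germD // !gval_germ //; exact: regularD.
Qed.

Lemma gvalM x (u v : lring x) : gval (u * v) = gval u * gval v.
Proof.
have [f rf ->] := germP u; have [g rg ->] := germP v.
by rewrite -germM // !gval_germ //; exact: regularM.
Qed.

Lemma gvalC x c : gval (c%:A : lring x) = c.
Proof. by rewrite -germC gval_germ //; exact: regular_cst. Qed.

Lemma gval1 x : gval (1 : lring x) = 1.
Proof. by rewrite -(scale1r 1) gvalC. Qed.

Lemma gval0 x : gval (0 : lring x) = 0.
Proof. by rewrite -(scale0r 1) gvalC. Qed.

Lemma gvalN x (u : lring x) : gval (- u) = - gval u.
Proof. by apply/eqP; rewrite -addr_eq0 -gvalD addNr gval0. Qed.

Lemma germV x f : regular_at x f -> f x != 0 ->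
  germ x (fun y => (f y)^-1) * germ x f = 1.
Proof.
move=> rf f0; rewrite -germM //; last exact: regularV.
rewrite -germ_cst1; apply/esym/germ_near; first exact: regular_cst.
have [U [d [p [q [[oU Ux] hp hq fE]]]]] := rf.
have [W Wx rW] := regular_near (regularV rf f0).
have : near x (fun y => nonvanishing p y).
  exists [set y | nonvanishing p y] => //; split.
    exists [set p] => [_ ->|y]; first by exists d.
    by split=> [H|[_ ->]] //; exists p.
  move=> v vx v0; have [q0 fx] := fE x Ux.
  by move: f0; rewrite (fx v) // mulf_eq0 negb_or => /andP[].
move=> /nearI/(_ (near_nbhd oU Ux)); apply: nearS => y [p0 /fE[q0 fy]].
have [v vy v0] := pt_vec y.
by transitivity ((f y)^-1 * f y) => //; rewrite mulVf // (fy v) // mulf_neq0 ?invr_eq0 ?p0 ?q0.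
Qed.

Lemma near_neq0 x f : regular_at x f -> f x != 0 -> near x (fun y => f y != 0).
Proof.
move=> rf f0; have := germV rf f0; rewrite -germM //; last exact: regularV.
rewrite -germ_cst1 => /germ_inj[||U Ux E].
- by apply: regularM => //; exact: regularV.
- exact: regular_cst.
exists U => // y /E; rewrite -[LHS]/((f y)^-1 * f y) => H; apply/eqP => fy0.
by move: H; rewrite fy0 mulr0 => /esym /eqP; rewrite oner_eq0.
Qed.

Lemma lring_unit x (u : lring x) : gval u != 0 -> exists w, w * u = 1.
Proof.
have [f rf ->] := germP u; rewrite gval_germ // => f0.
by exists (germ x (fun y => (f y)^-1)); rewrite germV.
Qed.

Lemma regularB x f g : regular_at x f -> regular_at x g -> regular_at x (f - g).
Proof.
move=> rf rg; apply: regularD => //.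
have -> : - g = (fun=> -1) * g by apply/funext => y; rewrite [RHS]mulN1r.
exact/regularM/rg/regular_cst.
Qed.

Lemma germB x f g : regular_at x f -> regular_at x g ->
  germ x (f - g) = germ x f - germ x g.
Proof.
move=> rf rg; apply: (addIr (germ x g)); rewrite subrK -germD ?subrK //.
exact: regularB.
Qed.

End LocalFunctions.

(** Nakayama's lemma in adjugate form: wherever the determinant is a unit, e is determined by r. It
    is applied over the local rings, over [k] at each point separately, and over principal parts. *)
Lemma linear_system (R : comNzRingType) N (A : 'M[R]_N) (e r : 'I_N -> R) :
  (forall i, e i = \sum_j A i j * e j + r i) ->
  forall i, \det (1%:M - A) * e i = \sum_j (\adj (1%:M - A)) i j * r j.
Proof.
move=> H; pose ec := \col_i e i; pose rc := \col_i r i.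
have E : (1%:M - A) *m ec = rc.
  apply/colP => i; rewrite mulmxBl mul1mx !mxE {1}H.
  under [X in _ - X]eq_bigr => j _ do rewrite mxE.
  by rewrite addrAC subrr add0r.
move=> i; have /(congr1 (fun M : 'cV_N => M i 0)) : \adj (1%:M - A) *m rc = \det (1%:M - A) *: ec.
  by rewrite -E mulmxA mul_adj_mx mul_scalar_mx.
rewrite !mxE => <-.
 by apply: eq_bigr => j _; rewrite !mxE.
Qed.

Lemma ps_coefD (R : comNzRingType) (f g : pseries R) n : (f + g) n = f n + g n.
Proof. by []. Qed.
Lemma ps_coefM (R : comNzRingType) (f g : pseries R) n :
  (f * g) n = \sum_(i < n.+1) f i * g (n - i)%N.
Proof. by []. Qed.
Lemma ps_coefZ (R : comNzRingType) c (f : pseries R) n : (c *: f) n = c * f n.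
Proof. by []. Qed.
Lemma ps_coef1 (R : comNzRingType) n : (1 : pseries R) n = (n == 0%N)%:R.
Proof. by rewrite [LHS]/(ps_const 1 n) /ps_const; case: eqP. Qed.
Lemma ps_coef0 (R : comNzRingType) n : (0 : pseries R) n = 0.
Proof. by []. Qed.
Lemma ps_coefM0 (R : comNzRingType) (f g : pseries R) : (f * g) 0%N = f 0%N * g 0%N.
Proof. by rewrite ps_coefM big_ord1. Qed.
Lemma ps_coef_sum (R : comNzRingType) I (s : seq I) (P : pred I) (F : I -> pseries R) n :
  (\sum_(i <- s | P i) F i) n = \sum_(i <- s | P i) F i n.
Proof.
by elim/big_rec2: _ => [|i _ f _ <-] //; rewrite ps_coef0.
Qed.
Lemma ps_coefZmul (R : comNzRingType) c (f : pseries R) n : (c%:A * f) n = c * f n.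
Proof. by rewrite -scalerAl mul1r ps_coefZ. Qed.
Lemma ps_coefN (R : comNzRingType) (f : pseries R) n : (- f) n = - f n.
Proof. by []. Qed.
Lemma ps_coefC (R : comNzRingType) c n : (c%:A : pseries R) n = if n == 0%N then c else 0.
Proof. by rewrite ps_coefZ ps_coef1; case: eqP; rewrite ?mulr1 ?mulr0. Qed.
Lemma ps_coefMX (R : comNzRingType) (f : pseries R) n : (f * psX) n.+1 = f n.
Proof.
rewrite ps_coefM big_ord_recr big_ord_recr /= subnn subSn // subnn mulr0 addr0 mulr1.
rewrite big1 ?add0r // => i _; rewrite subSn ?(ltnW (ltn_ord i)) //.
rewrite /psX eqSS subn_eq0 leqNgt ltn_ord mulr0 //.
Qed.
Lemma ps_coefMX0 (R : comNzRingType) (f : pseries R) : (f * psX) 0%N = 0.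
Proof. by rewrite ps_coefM0 /psX mulr0. Qed.

Lemma ps_exp_low (R : comNzRingType) (r : pseries R) m i :
  r 0%N = 0 -> (i < m)%N -> (r ^+ m) i = 0.
Proof.
move=> r0; elim: m i => [//|m IH] i im; rewrite exprS ps_coefM big1 // => j _.
have [->|j0] := posnP j; first by rewrite r0 mul0r.
have i0 : (0 < i)%N by apply: leq_trans j0 _; rewrite -ltnS ltn_ord.
have ij : (i - j < m)%N by apply: (@leq_trans i) => //; rewrite ltn_subrL j0.
by rewrite (IH _ ij) mulr0.
Qed.

(** * Differences of regular functions through differences of coordinates *)

Section Gradient.
Variables (k : closedFieldType) (X : projset k).
Implicit Types (x y : pt X) (U W : set (pt X)) (f g : pt X -> k).
Notation N := (pdim X).+1.
Notation F := (pt X -> k).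

Definition dchart (i0 i : 'I_N) y : lring y :=
  germ y (chart i0 i) - (chart i0 i y)%:A.

Lemma gval_dchart i0 i y : in_chart i0 y -> gval (dchart i0 i y) = 0.
Proof.
move=> yi0; rewrite /dchart gvalD gvalN gvalC gval_germ ?subrr //.
exact: regular_chart.
Qed.

Lemma algM y f g : ((f * g) y)%:A = (f y)%:A * (g y)%:A :> lring y.
Proof. by rewrite -scalerAl mul1r scalerA. Qed.

Lemma algN y f : ((- f) y)%:A = - (f y)%:A :> lring y.
Proof. by rewrite -scaleNr. Qed.

(* f(z) - f(y) lies in the ideal generated by the x_j(z) - x_j(y); the triple
   (j, (A, B)) stands for the term A(y) B(z) (x_j(z) - x_j(y)). *)
Lemma gradient (i0 : 'I_N) x f : in_chart i0 x -> regular_at x f ->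
  exists s : seq ('I_N * (F * F)),
    (forall p, p \in s -> regular_at x p.2.1 /\ regular_at x p.2.2) /\
    near x (fun y => germ y f - (f y)%:A =
      \sum_(p <- s) (p.2.1 y)%:A * germ y p.2.2 * dchart i0 p.1 y).
Proof.
move=> xi0; move: f; apply: (regular_ind xi0) => [c|f g rf rg|f g rf rg|f rf f0|f g rf E|i].
- exists [::]; split=> //; apply: nearT => y.
  by rewrite big_nil germC subrr.
- move=> [s [rs Es]] [s' [rs' Es']]; exists (s ++ s'); split.
    by move=> p; rewrite mem_cat => /orP[/rs|/rs'].
  have R := nearI (regular_nearE rf) (regular_nearE rg).
  apply: nearS (nearI R (nearI Es Es')) => y [[rfy rgy] [E E']].
  rewrite big_cat /= -E -E' germD // addrACA; congr (_ + _).
  by rewrite -opprD -scalerDl.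
- move=> [s [rs Es]] [s' [rs' Es']].
  (* From f(z) g(z) - f(y) g(y) = (f(z) - f(y)) g(z) + f(y) (g(z) - g(y)): the factor g(z) joins B,
     and f(y) joins A. *)
  exists ([seq (p.1, (p.2.1, p.2.2 * g)) | p <- s] ++
          [seq (p.1, (f * p.2.1, p.2.2)) | p <- s']); split.
    move=> p; rewrite mem_cat => /orP[] /mapP[q].
      by move=> /rs[r1 r2] -> /=; split=> //; exact: regularM.
    by move=> /rs'[r1 r2] -> /=; split=> //; exact: regularM.
  have R := nearI (regular_nearE rf) (regular_nearE rg).
  have S : near x (fun y => forall p, p \in s -> regular_at y p.2.2).
    by apply: near_seq => p /rs[_ /regular_nearE].
  apply: nearS (nearI (nearI R S) (nearI Es Es')) => y [[[rfy rgy] rsy] [E E']].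
  have E1 : \sum_(p <- s) (p.2.1 y)%:A * germ y (p.2.2 * g) * dchart i0 p.1 y =
      (germ y f - (f y)%:A) * germ y g.
    rewrite E mulr_suml big_seq [RHS]big_seq; apply: eq_bigr => p /rsy rp.
    by rewrite germM //; ring.
  have E2 : \sum_(p <- s') ((f * p.2.1) y)%:A * germ y p.2.2 * dchart i0 p.1 y =
      (f y)%:A * (germ y g - (g y)%:A).
    rewrite E' mulr_sumr; apply: eq_bigr => p _.
    by rewrite algM !mulrA.
  rewrite big_cat !big_map E1 E2 germM // algM /=; ring.
- move=> [s [rs Es]]; pose h := fun y => (f y)^-1.
  have rh : regular_at x h by exact: regularV.
  (* From 1/f(z) - 1/f(y) = - (1/f(y)) (1/f(z)) (f(z) - f(y)). *)
  exists [seq (p.1, (- h * p.2.1, p.2.2 * h)) | p <- s]; split.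
    move=> p /mapP[q /rs[r1 r2] ->] /=; split; last exact: regularM.
    by apply: regularM => //; rewrite -sub0r; apply: regularB => //; exact: regular_cst.
  have R := nearI (nearI (near_neq0 rf f0) (regular_nearE rf)) (regular_nearE rh).
  have S : near x (fun y => forall p, p \in s -> regular_at y p.2.2).
    by apply: near_seq => p /rs[_ /regular_nearE].
  apply: nearS (nearI (nearI R S) Es) => y [[[[fy0 rfy] rhy] rsy] E].
  have E1 : \sum_(p <- s) ((- h * p.2.1) y)%:A * germ y (p.2.2 * h) * dchart i0 p.1 y =
      - (h y)%:A * germ y h * (germ y f - (f y)%:A).
    rewrite E mulr_sumr big_seq [RHS]big_seq; apply: eq_bigr => p /rsy rp.
    by rewrite germM // algM algN; ring.
  have hf : germ y h * germ y f = 1 by exact: germV.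
  have hfy : (h y)%:A * (f y)%:A = 1 :> lring y.
    by rewrite -scalerAl mul1r scalerA mulVf // scale1r.
  rewrite big_map E1; transitivity (- (h y)%:A * (germ y h * germ y f) +
     germ y h * ((h y)%:A * (f y)%:A)); last by ring.
  by rewrite hf hfy; ring.
- move=> [s [rs Es]]; exists s; split=> //.
  have R := nearI (regular_nearE rf) (near_near E).
  apply: nearS (nearI R Es) => y [[rfy fg]] <-.
  by rewrite (near_pt fg) (germ_near rfy fg).
- exists [:: (i, (fun=> 1, fun=> 1))]; split=> [p|].
    by rewrite inE => /eqP-> /=; split; exact: regular_cst.
  by apply: nearT => y; rewrite big_seq1 /= germC scale1r !mul1r.
Qed.

(** The difference D = r - l is a twisted derivation: D(fg) = r(g) D(f) + l(f) D(g) and D(1/f) = -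
    r(1/f) l(1/f) D(f). So its values stay in the ideal generated by its values on the coordinate
    functions. *)
Lemma hom_diff (i0 : 'I_N) x (R : comNzRingType) (l r : lring x -> R) :
  in_chart i0 x ->
  (forall u v, l (u + v) = l u + l v) -> (forall u v, r (u + v) = r u + r v) ->
  (forall u v, l (u * v) = l u * l v) -> (forall u v, r (u * v) = r u * r v) ->
  (forall c, l c%:A = r c%:A) -> l 1 = 1 -> r 1 = 1 ->
  forall u, exists c : 'I_N -> R,
    r u - l u = \sum_j c j * (r (germ x (chart i0 j)) - l (germ x (chart i0 j))).
Proof.
move=> xi0 lD rD lM rM lr l1 r1 u; have [f rf ->] := germP u; move: f rf {u}.
apply: (regular_ind xi0) => [c|f g rf rg|f g rf rg|f rf f0|f g rf E|i].
- exists (fun=> 0); rewrite germC lr subrr big1 // => j _.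
  by rewrite mul0r.
- move=> [c Ec] [c' Ec']; exists (fun j => c j + c' j).
  rewrite germD // lD rD.
  transitivity ((r (germ x f) - l (germ x f)) + (r (germ x g) - l (germ x g))).
    by ring.
  by rewrite Ec Ec' -big_split; apply: eq_bigr => j _; rewrite mulrDl.
- move=> [c Ec] [c' Ec'].
  exists (fun j => r (germ x g) * c j + l (germ x f) * c' j).
  rewrite germM // lM rM.
  transitivity (r (germ x g) * (r (germ x f) - l (germ x f)) +
                l (germ x f) * (r (germ x g) - l (germ x g))); first by ring.
  rewrite Ec Ec' !mulr_sumr -big_split.
  by apply: eq_bigr => j _; rewrite mulrDl !mulrA.
- move=> [c Ec]; set h := germ x (fun y => _).
  have hf : h * germ x f = 1 by exact: germV.
  exists (fun j => - (r h * l h) * c j).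
  transitivity (- (r h * l h) * (r (germ x f) - l (germ x f))).
    transitivity (r h * (l h * l (germ x f)) - l h * (r h * r (germ x f))); last by ring.
    by rewrite -lM -rM hf l1 r1 !mulr1.
  by rewrite Ec mulr_sumr; apply: eq_bigr => j _; rewrite mulrA.
- by rewrite (germ_near rf E).
- exists (fun j => (j == i)%:R).
  rewrite (bigD1 i) //= eqxx mul1r big1 ?addr0 // => j /negbTE ->.
  by rewrite mul0r.
Qed.

End Gradient.

(** * Local coordinates *)

Section RegularClosure.
Variables (k : closedFieldType) (X : projset k).
Implicit Types (x y : pt X) (U W : set (pt X)) (f g : pt X -> k).

Lemma gval_zmod x : zmod_morphism (@gval k X x).
Proof. by move=> u v; rewrite gvalD gvalN. Qed.
Lemma gval_monoid x : monoid_morphism (@gval k X x).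
Proof. by split; [exact: gval1|exact: gvalM]. Qed.
HB.instance Definition _ x := GRing.isZmodMorphism.Build _ _ (@gval k X x) (@gval_zmod x).
HB.instance Definition _ x := GRing.isMonoidMorphism.Build _ _ (@gval k X x) (@gval_monoid x).

Lemma regular_add x f g : regular_at x f -> regular_at x g ->
  regular_at x (fun y => f y + g y).
Proof. exact: regularD. Qed.

Lemma regular_mul x f g : regular_at x f -> regular_at x g ->
  regular_at x (fun y => f y * g y).
Proof. exact: regularM. Qed.

Lemma regular_sub x f g : regular_at x f -> regular_at x g ->
  regular_at x (fun y => f y - g y).
Proof. exact: regularB. Qed.

Lemma regular_sum x (I : eqType) (s : seq I) (P : pred I) (F : I -> pt X -> k) :
  (forall i, i \in s -> P i -> regular_at x (F i)) ->
  regular_at x (fun y => \sum_(i <- s | P i) F i y).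
Proof.
elim: s => [|i s IH] H.
  rewrite (_ : (fun _ => _) = fun=> 0); first exact: regular_cst.
  by apply/funext => y; rewrite big_nil.
have rs : regular_at x (fun y => \sum_(j <- s | P j) F j y).
  by apply: IH => j js; apply: H; rewrite inE js orbT.
case Pi: (P i); last first.
  rewrite (_ : (fun _ => _) = fun y => \sum_(j <- s | P j) F j y) //.
  by apply/funext => y; rewrite big_cons Pi.
rewrite (_ : (fun _ => _) = fun y => F i y + \sum_(j <- s | P j) F j y).
  by apply: regular_add => //; apply: H; rewrite ?mem_head.
by apply/funext => y; rewrite big_cons Pi.
Qed.

Lemma regular_prod x (I : eqType) (s : seq I) (F : I -> pt X -> k) :
  (forall i, i \in s -> regular_at x (F i)) ->
  regular_at x (fun y => \prod_(i <- s) F i y).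
Proof.
elim: s => [|i s IH] H.
  rewrite (_ : (fun _ => _) = fun=> 1); first exact: regular_cst.
  by apply/funext => y; rewrite big_nil.
rewrite (_ : (fun _ => _) = fun y => F i y * \prod_(j <- s) F j y).
  apply: regular_mul; first by apply: H; rewrite mem_head.
  by apply: IH => j js; apply: H; rewrite inE js orbT.
by apply/funext => y; rewrite big_cons.
Qed.

Lemma regular_det x n (M : pt X -> 'M[k]_n) :
  (forall i j, regular_at x (fun y => M y i j)) ->
  regular_at x (fun y => \det (M y)).
Proof.
move=> H; rewrite /determinant; apply: regular_sum => s _ _.
apply: regular_mul; first exact: regular_cst.
by apply: regular_prod => i _; exact: H.
Qed.

Lemma regular_adj x n (M : pt X -> 'M[k]_n) i j :
  (forall i j, regular_at x (fun y => M y i j)) ->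
  regular_at x (fun y => (\adj (M y)) i j).
Proof.
move=> H; rewrite (_ : (fun _ => _) = fun y => cofactor (M y) j i); last first.
  by apply/funext => y; rewrite mxE.
rewrite /cofactor; apply: regular_mul; first exact: regular_cst.
apply: regular_det => a b.
rewrite (_ : (fun _ => _) = fun y => M y (lift j a) (lift i b)) //.
by apply/funext => y; rewrite !mxE.
Qed.

End RegularClosure.

Lemma sum_partition (R : nzRingType) n (T : eqType) (s : seq ('I_n * T))
    (F : 'I_n * T -> R) (xi : 'I_n -> R) :
  \sum_(p <- s) F p * xi p.1 = \sum_j (\sum_(p <- s | p.1 == j) F p) * xi j.
Proof.
rewrite (partition_big (fun p => p.1) xpredT) //=.
apply: eq_bigr => j _; rewrite mulr_suml.
by apply: eq_bigr => p /eqP ->.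
Qed.

(** * A coordinate at a point is a coordinate at nearby points *)

Section ChartSystem.
Variables (k : closedFieldType) (X : projset k).
Implicit Types (x y : pt X) (U W : set (pt X)) (f g : pt X -> k).
Notation N := (pdim X).+1.
Notation F := (pt X -> k).

Definition unif x (tau : lring x) : Prop :=
  gval tau = 0 /\ forall u, gval u = 0 -> exists w, u = w * tau.

Definition local_par x t : lring x := germ x t - (t x)%:A.

Lemma gval_local_par x t : regular_at x t -> gval (local_par x t) = 0.
Proof. by move=> rt; rewrite gvalD gvalN gvalC gval_germ // subrr. Qed.

Lemma coordinate_unif U t x : coordinate U t -> U x -> unif (local_par x t).
Proof.
move=> [rt H] Ux; split; first exact/gval_local_par/rt.
by move=> u /(H x Ux).
Qed.

(** The Jacobian matrix of the functions described by [s]: on the diagonal z = y the coefficient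
    A(y) B(z) of x_j(z) - x_j(y) becomes A(y) B(y). *)
Definition gradmx (s : 'I_N -> seq ('I_N * (F * F))) y : 'M[k]_N :=
  \matrix_(i, j) \sum_(p <- s i | p.1 == j) p.2.1 y * p.2.2 y.

(* The w_i are defined by x_i - x_i(x) = w_i (t - t(x)), and s describes their
   differentials. *)
Lemma chart_system (i0 : 'I_N) x t : in_chart i0 x -> regular_at x t ->
  unif (local_par x t) ->
  exists (w : 'I_N -> F) (s : 'I_N -> seq ('I_N * (F * F))),
  [/\ forall i, regular_at x (w i),
      forall i p, p \in s i -> regular_at x p.2.1 /\ regular_at x p.2.2,
      near x (fun y => forall i, germ y (chart i0 i) - (chart i0 i x)%:A =
        germ y (w i) * (germ y t - (t x)%:A)),
      near x (fun y => forall i, germ y (w i) - (w i y)%:A =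
        \sum_(p <- s i) (p.2.1 y)%:A * germ y p.2.2 * dchart i0 p.1 y) &
      near x (fun y => \det (1%:M - (t y - t x) *: gradmx s y) != 0) /\
      forall i j, regular_at x (fun y => (1%:M - (t y - t x) *: gradmx s y) i j)].
Proof.
move=> xi0 rt [_ ut].
have /fin_all_exists[w Hw] : forall i : 'I_N, exists f, regular_at x f /\
    germ x (chart i0 i) - (chart i0 i x)%:A = germ x f * local_par x t.
  move=> i; have [u E] := ut _ (gval_dchart i xi0).
  by have [f rf fE] := germP u; exists f; split=> //; rewrite -fE -E.
have /fin_all_exists[s Hs] : forall i : 'I_N, exists s, (forall p, p \in s ->
    regular_at x p.2.1 /\ regular_at x p.2.2) /\
    near x (fun y => germ y (w i) - (w i y)%:A =
      \sum_(p <- s) (p.2.1 y)%:A * germ y p.2.2 * dchart i0 p.1 y).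
  by move=> i; apply: (gradient xi0); case: (Hw i).
have rM i j : regular_at x (fun y => (1%:M - (t y - t x) *: gradmx s y) i j).
  rewrite (_ : (fun _ => _) = fun y => (i == j)%:R -
    (t y - t x) * \sum_(p <- s i | p.1 == j) p.2.1 y * p.2.2 y).
    apply: regular_sub; first exact: regular_cst.
    apply: regular_mul; first by apply: regular_sub => //; exact: regular_cst.
    apply: regular_sum => p ps _.
    by have [r1 r2] := (Hs i).1 p ps; exact: regular_mul.
  by apply/funext => y; rewrite !mxE.
exists w, s; split=> [i|i p|||].
- by case: (Hw i).
- by case: (Hs i) => + _; apply.
- apply: near_all => i; have [rw E] := Hw i.
  have rc := regular_chart i xi0; have cst c := regular_cst x c.
  have {}E : near x (fun y => chart i0 i y - chart i0 i x = w i y * (t y - t x)).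
    apply: (@germ_inj _ _ x (chart i0 i - (fun=> chart i0 i x)) (w i * (t - (fun=> t x)))).
    - exact: regularB.
    - by apply: regularM => //; exact: regularB.
    - by rewrite germM ?germB ?germC //; exact: regularB.
  have R := nearI (regular_nearE rw) (nearI (regular_nearE rc) (regular_nearE rt)).
  apply: nearS (nearI R (near_near E)) => y [[rwy [rcy rty]] Ey].
  have cy c := regular_cst y c.
  rewrite -!germC -!germB // -germM //; last exact: regularB.
  by apply: germ_near => //; exact: regularB.
- by apply: near_all => i; case: (Hs i).
- split=> //; apply: near_neq0; first exact: regular_det.
  by rewrite subrr scale0r subr0 det1 oner_neq0.
Qed.

(** Subtracting from x_i - x_i(x) = w_i (t - t(x)) its value at y gives x_i - x_i(y) = (t(y) - t(x))
    (w_i - w_i(y)) + w_i (t - t(y)). Expanding w_i - w_i(y) in the x_j - x_j(y) makes this a linear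
    system whose right-hand side is divisible by t - t(y). At the point y its matrix is the one
    whose determinant [chart_system] keeps nonzero. *)
Lemma unif_near x t : regular_at x t -> unif (local_par x t) ->
  near x (fun y => unif (local_par y t)).
Proof.
move=> rt ut; have [i0 xi0] := in_chart_ex x.
have [w [s [rw rs E1 E2 [E3 _]]]] := chart_system xi0 rt ut.
have R1 : near x (fun y => forall i, regular_at y (w i)).
  by apply: near_all => i; exact: regular_nearE.
have R2 : near x (fun y => forall i p, p \in s i -> regular_at y p.2.2).
  apply: near_all => i; apply: near_seq => p /rs[_]; exact: regular_nearE.
have R := nearI (nearI R1 R2) (nearI (regular_nearE rt) (in_chart_near xi0)).
apply: nearS (nearI (nearI R E3) (nearI E1 E2)).
move=> y [[[[rwy rsy] [rty yi0]] D0] [Ey E'y]].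
split; first exact: gval_local_par.
pose c : lring y := (t y - t x)%:A.
pose A : 'M[lring y]_N := \matrix_(i, j) (c * \sum_(p <- s i | p.1 == j)
    (p.2.1 y)%:A * germ y p.2.2).
have S i : dchart i0 i y = \sum_j A i j * dchart i0 j y + germ y (w i) * local_par y t.
  have cE : c = (t y)%:A - (t x)%:A by rewrite /c scalerBl.
  have E0 : (chart i0 i y)%:A - (chart i0 i x)%:A = (w i y)%:A * c :> lring y.
    have := congr1 (@gval _ _ y) (Ey i).
    rewrite !(gvalC, gvalD, gvalN) gvalM !(gvalC, gvalD, gvalN) !gval_germ //; last exact: regular_chart.
    by move=> Ex; rewrite -scalerBl Ex /c -scalerAl mul1r scalerA.
  transitivity (c * (germ y (w i) - (w i y)%:A) + germ y (w i) * local_par y t).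
    rewrite mulrBr [c * (w i y)%:A]mulrC -E0 /dchart /local_par.
    transitivity ((germ y (chart i0 i) - (chart i0 i x)%:A) -
       ((chart i0 i y)%:A - (chart i0 i x)%:A)); first by ring.
    by rewrite Ey cE; ring.
  congr (_ + _); rewrite E'y.
  rewrite (sum_partition (s i) (fun p => (p.2.1 y)%:A * germ y p.2.2) (fun j => dchart i0 j y)).
  rewrite mulr_sumr.
  by apply: eq_bigr => j _; rewrite mxE mulrA.
have G : gval (\det (1%:M - A)) != 0.
  rewrite -det_map_mx; move: D0; congr (\det _ != 0).
  apply/matrixP => i j; rewrite !mxE rmorphB rmorphMn rmorph1 rmorphM /= gvalC.
  congr (_ - _ * _); rewrite rmorph_sum big_seq_cond [RHS]big_seq_cond.
  apply: eq_bigr => p /andP[ps _]; rewrite rmorphM /= gvalC gval_germ //.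
  exact: (rsy i).
have [v vE] := lring_unit G.
have dE i : exists b, dchart i0 i y = b * local_par y t.
  exists (v * \sum_j (\adj (1%:M - A)) i j * germ y (w j)).
  have := linear_system S i => /(congr1 (fun u => v * u)); rewrite mulrA vE mul1r => ->.
  rewrite -mulrA; congr (v * _); rewrite big_distrl.
  by apply: eq_bigr => j _; exact: mulrA.
have {dE} /fin_all_exists[b dE] := dE.
move=> u; have [f rf ->] := germP u; rewrite gval_germ // => f0.
have [s' [_ /near_pt]] := gradient yi0 rf.
rewrite f0 scale0r subr0 => ->.
exists (\sum_(p <- s') (p.2.1 y)%:A * germ y p.2.2 * b p.1).
by rewrite mulr_suml; apply: eq_bigr => p _; rewrite dE mulrA.
Qed.

End ChartSystem.

(** * Expansion of germs along a formal coordinate *)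

Section FormalCoordinates.
Variables (k : closedFieldType) (X : projset k).
Implicit Types (x y : pt X) (U W : set (pt X)) (f g : pt X -> k).

Lemma expandD x (phi : fcoord x) u v : expand phi (u + v) = expand phi u + expand phi v.
Proof. exact: raddfD. Qed.
Lemma expandB x (phi : fcoord x) u v : expand phi (u - v) = expand phi u - expand phi v.
Proof. exact: raddfB. Qed.
Lemma expandM x (phi : fcoord x) u v : expand phi (u * v) = expand phi u * expand phi v.
Proof. exact: rmorphM. Qed.
Lemma expandX x (phi : fcoord x) u n : expand phi (u ^+ n) = expand phi u ^+ n.
Proof. exact: rmorphXn. Qed.
Lemma expandZ x (phi : fcoord x) c u : expand phi (c *: u) = c *: expand phi u.
Proof. exact: linearZ. Qed.
Lemma expand1 x (phi : fcoord x) : expand phi 1 = 1.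
Proof. exact: rmorph1. Qed.
Lemma expandC x (phi : fcoord x) c : expand phi c%:A = c%:A.
Proof. by rewrite expandZ expand1. Qed.

Lemma expand_sum x (phi : fcoord x) I (s : seq I) (P : pred I) (F : I -> lring x) :
  expand phi (\sum_(i <- s | P i) F i) = \sum_(i <- s | P i) expand phi (F i).
Proof. exact: raddf_sum. Qed.

Lemma gvalZ x c (u : lring x) : gval (c *: u) = c * gval u.
Proof. by rewrite -[u in LHS]mul1r scalerAl gvalM gvalC. Qed.

(** If the constant term c differed from u(x), then u - c would be a unit whose expansion has
    constant term 0. *)
Lemma expand_coef0 x (phi : fcoord x) u : expand phi u 0%N = gval u.
Proof.
apply/eqP; rewrite -subr_eq0; apply/eqP; set c := expand phi u 0%N.
have [//|/eqP c0] := eqVneq (c - gval u) 0.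
have [w E] : exists w, w * (u - c%:A) = 1.
  by apply: lring_unit; rewrite gvalD gvalN gvalC subr_eq0 eq_sym -subr_eq0; apply/eqP.
have := congr1 (fun f : pseries k => f 0%N) (expand1 phi).
rewrite -E expandM ps_coefM0 expandB expandC ps_coefD ps_coefN ps_coefC /= subrr mulr0 ps_coef1.
by move=> /esym /eqP; rewrite oner_eq0.
Qed.

Lemma expand_par x t (phi : fcoord x) : fc_of t phi -> expand phi (local_par x t) = psX.
Proof. by move=> E; rewrite expandB E expandC addrC addKr. Qed.

(** Subtracting the value and dividing by t - t(x) shifts the coefficients. Iterating this computes
    the whole expansion along t, which is therefore unique. *)
Lemma expand_step x t (phi : fcoord x) u w n : fc_of t phi ->
  u = (gval u)%:A + w * local_par x t -> expand phi u n.+1 = expand phi w n.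
Proof.
move=> /expand_par E ->; rewrite expandD expandC expandM E ps_coefD ps_coefMX ps_coefC.
by rewrite add0r.
Qed.

Lemma unif_step x (tau u : lring x) : unif tau -> exists w, u = (gval u)%:A + w * tau.
Proof.
move=> [_ /(_ (u - (gval u)%:A))[|w E]].
  by rewrite gvalD gvalN gvalC subrr.
by exists w; rewrite -E addrC subrK.
Qed.

Lemma fc_of_unique x t (phi phi' : fcoord x) u : unif (local_par x t) ->
  fc_of t phi -> fc_of t phi' -> expand phi u = expand phi' u.
Proof.
move=> ut h h'; apply/funext => n; elim: n u => [|n IH] u.
  by rewrite !expand_coef0.
have [w E] := unif_step u ut.
by rewrite (expand_step n h E) (expand_step n h' E).
Qed.

Lemma dpderivE x t (phi : fcoord x) f j : unif (local_par x t) ->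
  fc_of t phi -> dpderiv t j f x = expand phi (germ x f) j.
Proof.
move=> ut h; rewrite /dpderiv.
have : [set c | exists2 phi : fcoord x, fc_of t phi & c = expand phi (germ x f) j]
    (xget 0 [set c | exists2 phi : fcoord x, fc_of t phi & c = expand phi (germ x f) j]).
  by apply: (@xgetPex k 0); exists (expand phi (germ x f) j), phi.
by move=> [phi' h' ->]; rewrite (fc_of_unique _ ut h' h).
Qed.

(** By iterated division, u is a polynomial in t - t(x) plus a multiple of its N-th power. Since r
    has no constant term, that multiple does not affect coefficients below N; N = n + 1 settles the
    coefficient n. *)
Lemma expand_comp x t (phi phit : fcoord x) u : unif (local_par x t) ->
  fc_of t phit -> expand phi u = ps_comp (expand phit u) (expand phi (local_par x t)).
Proof.
move=> ut h; set r := expand phi (local_par x t); apply/funext => n.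
have r0 : r 0%N = 0 by rewrite /r expand_coef0 (proj1 ut).
have rm m i := @ps_exp_low _ r m i r0.
suff H N v : expand phi v = \sum_(m < N) expand phit v m *: r ^+ m +
    r ^+ N * expand phi (iter N (fun v => sval (cid (unif_step v ut))) v).
  rewrite (H n.+1) ps_coefD (_ : (r ^+ n.+1 * _) n = 0) ?addr0; last first.
    by rewrite ps_coefM big1 // => i _; rewrite rm ?mul0r // ltn_ord.
  by rewrite ps_coef_sum; apply: eq_bigr => m _; rewrite ps_coefZ.
elim: N v => [|N IH] v; first by rewrite big_ord0 add0r mul1r.
rewrite iterSr big_ord_recl /=; case: (cid _) => w /= E.
rewrite {1}E expandD expandC expandM -/r expr0 expand_coef0 -addrA.
congr (_ + _); rewrite IH mulrDl mulr_suml [in RHS]exprSr; congr (_ + _).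
  apply: eq_bigr => m _; rewrite (expand_step _ h E) -scalerAl -exprSr //.
by rewrite mulrAC.
Qed.

End FormalCoordinates.

(** * Coordinates and regularity of derivatives on a smooth curve *)

Section CurveCoordinates.
Variables (k : closedFieldType) (C : curve k).
Implicit Types (x y : pt C) (U W : set (pt C)) (f g t : pt C -> k).

(** A uniformizer is nonzero: otherwise all nonunits would vanish, among them the parameter of the
    discrete valuation ring. *)
Lemma unif_cancel x (tau u v : lring x) : unif tau -> u * tau = v * tau -> u = v.
Proof.
move=> [_ H] E; have [dom [p [p0 pu _]]] := curve_smooth x.
have : (u - v) * tau = 0 by rewrite mulrBl E subrr.
move=> /dom[/eqP|t0]; first by rewrite subr_eq0 => /eqP.
case: p0; have [/lring_unit[w wp]|/negPn/eqP /H[w ->]] := boolP (gval p != 0).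
  by case: pu; exists w.
by rewrite t0 mulr0.
Qed.

(** The expansion is built from the difference quotient q(u) = (u - u(x)) / (t - t(x)), unique by
    cancellation: the n-th coefficient is the value at x of the n-th iterate of q. Multiplicativity
    comes from q(uv) = u(x) q(v) + q(u) v. *)
Lemma fc_of_ex x t : unif (local_par x t) -> exists phi : fcoord x, fc_of t phi.
Proof.
move=> ut; pose q u := sval (cid (unif_step u ut)).
have qE u : u = (gval u)%:A + q u * local_par x t by rewrite /q; case: cid.
have qU u w : u = (gval u)%:A + w * local_par x t -> q u = w.
  by move=> E; apply: (unif_cancel ut); apply: (addrI (gval u)%:A); rewrite -E -qE.
have qD u v : q (u + v) = q u + q v.
  by apply: qU; rewrite gvalD scalerDl mulrDl addrACA -!qE.
have qZ c u : q (c *: u) = c *: q u.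
  apply: qU; rewrite gvalZ; apply: (etrans (congr1 (fun v => c *: v) (qE u))).
  by rewrite scalerDr scalerA scalerAl.
have qM u v : q (u * v) = gval u *: q v + q u * v.
  apply: qU; rewrite gvalM.
  have -> : (gval u * gval v)%:A = (gval u)%:A * (gval v)%:A :> lring x.
    by rewrite -scalerAl mul1r scalerA.
  have -> : gval u *: q v = (gval u)%:A * q v by rewrite -scalerAl mul1r.
  transitivity ((gval u)%:A * v + q u * local_par x t * v).
    by rewrite -mulrDl -qE.
  transitivity ((gval u)%:A * ((gval v)%:A + q v * local_par x t) +
      q u * local_par x t * v); last by ring.
  by rewrite -qE.
pose a u n := gval (iter n q u).
have aS u n : a u n.+1 = a (q u) n by rewrite /a iterSr.
have aD n u v : a (u + v) n = a u n + a v n.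
  by elim: n u v => [|n IH] u v; [exact: gvalD|rewrite !aS qD IH].
have aZ n c u : a (c *: u) n = c * a u n.
  by elim: n c u => [|n IH] c u; [exact: gvalZ|rewrite !aS qZ IH].
have aM n u v : a (u * v) n = \sum_(i < n.+1) a u i * a v (n - i)%N.
  elim: n u v => [|n IH] u v; first by rewrite big_ord1 [LHS]gvalM.
  rewrite aS qM aD aZ IH [RHS]big_ord_recl; congr (_ + _); first by rewrite -aS.
  by apply: eq_bigr => i _; rewrite aS /= subSS.
have a1 n : a 1 n = (n == 0)%:R.
  case: n => [|n]; first exact: gval1.
  rewrite aS (_ : q 1 = 0).
    by elim: n => [|n IH]; [exact: gval0|rewrite aS -(scale0r 0) qZ !scale0r].
  by apply: qU; rewrite gval1 mul0r addr0 scale1r.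
have H1 : zmod_morphism (a : lring x -> pseries k).
  move=> u v; apply/funext => n; rewrite [RHS]ps_coefD ps_coefN -scaleN1r aD aZ.
  by rewrite mulN1r.
have H2 : monoid_morphism (a : lring x -> pseries k).
  split=> [|u v]; apply/funext => n; last by rewrite aM.
  by rewrite a1 ps_coef1.
have H3 : scalable (a : lring x -> pseries k).
  by move=> c u; apply/funext => n; rewrite aZ ps_coefZ.
pose A := GRing.isZmodMorphism.Build _ _ (a : lring x -> pseries k) H1.
pose B := GRing.isMonoidMorphism.Build _ _ (a : lring x -> pseries k) H2.
pose D := GRing.isScalable.Build _ _ _ _ (a : lring x -> pseries k) H3.
pose g : {lrmorphism lring x -> pseries k} := HB.pack (a : lring x -> pseries k) A B D.
have qt : q (local_par x t) = 1.
  by apply: qU; rewrite mul1r {1}(proj1 ut) scale0r add0r.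
have gt : g (local_par x t) = psX.
  apply/funext => -[|n]; first exact: (proj1 ut).
  by transitivity (a (local_par x t) n.+1) => //; rewrite aS qt a1 /psX eqSS.
have ex : exists u, g u 0%N = 0 /\ g u 1%N <> 0.
  exists (local_par x t); rewrite gt /psX /=; split=> //.
  by apply/eqP; rewrite oner_eq0.
exists (exist _ g ex).
have gC : g (t x)%:A = (t x)%:A by rewrite linearZ rmorph1.
have tE : germ x t = (t x)%:A + local_par x t by rewrite addrC subrK.
rewrite /fc_of {1}tE -gt -gC; exact: raddfD.
Qed.

Lemma coordinate_ex x : exists U t, nbhd x U /\ coordinate U t.
Proof.
have [dom [p [p0 pu pE]]] := curve_smooth x.
have gp : gval p = 0.
  by apply/eqP/negPn/negP => /lring_unit[w wp]; case: pu; exists w.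
have [t rt tE] := germP p.
have t0 : t x = 0 by rewrite -(gval_germ rt) -tE.
have lp : local_par x t = p by rewrite /local_par t0 scale0r subr0.
have ut : unif (local_par x t).
  rewrite lp; split=> // u u0; have [->|/eqP/pE[n [v [[w wv] uE]]]] := eqVneq u 0.
    by exists 0; rewrite mul0r.
  (* For n = 0 the germ u would be a unit, against u(x) = 0. *)
  case: n uE => [|n] uE; last by exists (v * p ^+ n); rewrite uE exprSr mulrA.
  exfalso; have := congr1 (@gval _ _ x) wv; rewrite gvalM gval1.
  rewrite (_ : v = u); first by rewrite u0 mulr0 => /esym /eqP; rewrite oner_eq0.
  by rewrite uE mulr1.
have [U Ux H] := nearI (regular_nearE rt) (unif_near rt ut).
exists U, t; split=> //; split=> [y /H[]//|y /H[_ [_ uy]] u /uy //].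
Qed.

Lemma dpderiv0 x t f : regular_at x f -> unif (local_par x t) -> dpderiv t 0 f x = f x.
Proof.
move=> rf ut; have [phi h] := fc_of_ex ut.
by rewrite (dpderivE _ _ ut h) expand_coef0 gval_germ.
Qed.

(* By induction on n: the n-th derivatives e_i of the x_i solve
   e = (t - t(x)) (dw/dx) e + r, where r only involves lower derivatives. *)
Lemma dpderiv_regular x t n f : regular_at x t -> unif (local_par x t) ->
  regular_at x f -> regular_at x (dpderiv t n f).
Proof.
move=> rt ut; have [i0 xi0] := in_chart_ex x.
have [w [s [rw rs E1 E2 [E3 rM]]]] := chart_system xi0 rt ut.
have UN := unif_near rt ut.
elim/ltn_ind: n f => -[|n] IH f rf.
  apply: (regular_eq _ rf); apply: nearS (nearI UN (regular_nearE rf)) => y [uy ry].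
  by rewrite dpderiv0.
(* The terms of D_(n+1) of the sum of the A(y) B (x_j - x_j(y)) in which both derivatives have order
   between 1 and n. What remains is A(y) B(y) D_(n+1) x_j, because x_j - x_j(y) has no constant
   term. *)
pose L (s : seq ('I_(pdim C).+1 * ((pt C -> k) * (pt C -> k)))) y :=
  \sum_(p <- s) p.2.1 y * \sum_(m < n) dpderiv t m.+1 (chart i0 p.1) y *
    dpderiv t (n - m) p.2.2 y.
have rL s0 : (forall p, p \in s0 -> regular_at x p.2.1 /\ regular_at x p.2.2) ->
    regular_at x (L s0).
  move=> rs0; apply: regular_sum => p /rs0[r1 r2] _; apply: regular_mul => //.
  apply: regular_sum => m _ _; apply: regular_mul; apply: IH => //.
  - by rewrite ltnS ltn_ord.
  - exact: regular_chart.
  - by rewrite ltnS leq_subr.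
pose e i y := dpderiv t n.+1 (chart i0 i) y.
have dE g s0 : regular_at x g ->
    (forall p, p \in s0 -> regular_at x p.2.1 /\ regular_at x p.2.2) ->
    near x (fun y => germ y g - (g y)%:A =
      \sum_(p <- s0) (p.2.1 y)%:A * germ y p.2.2 * dchart i0 p.1 y) ->
    near x (fun y => dpderiv t n.+1 g y =
      \sum_j (\sum_(p <- s0 | p.1 == j) p.2.1 y * p.2.2 y) * e j y + L s0 y).
  move=> rg rs0 Eg.
  have R2 : near x (fun y => forall p, p \in s0 -> regular_at y p.2.2).
    by apply: near_seq => p /rs0[_]; exact: regular_nearE.
  apply: nearS (nearI (nearI UN (in_chart_near xi0)) (nearI Eg R2)).
  move=> y [[uy yi0] [{}Eg ry]]; have [phi h] := fc_of_ex uy.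
  have cE j : expand phi (dchart i0 j y) 0%N = 0 by rewrite expand_coef0 gval_dchart.
  have cS j m : expand phi (dchart i0 j y) m.+1 = dpderiv t m.+1 (chart i0 j) y.
    by rewrite (dpderivE _ _ uy h) expandB expandC ps_coefD ps_coefN ps_coefC subr0.
  rewrite (dpderivE _ _ uy h) -[germ y g](subrK (g y)%:A) Eg expandD expandC ps_coefD.
  rewrite ps_coefC addr0 expand_sum ps_coef_sum.
  rewrite -(sum_partition s0 (fun p => p.2.1 y * p.2.2 y) (e^~ y)) -big_split.
  rewrite big_seq [RHS]big_seq; apply: eq_bigr => p /ry rp.
  have K : expand phi (germ y p.2.2 * dchart i0 p.1 y) n.+1 = p.2.2 y * e p.1 y +
      \sum_(m < n) dpderiv t m.+1 (chart i0 p.1) y * dpderiv t (n - m) p.2.2 y.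
    rewrite expandM mulrC ps_coefM big_ord_recl cE mul0r add0r big_ord_recr.
    rewrite [X in _ + X]/= subnn expand_coef0 gval_germ // addrC mulrC cS.
    congr (_ + _); apply: eq_bigr => m _.
    by rewrite -cS (dpderivE _ _ uy h) /= /bump add1n subSS.
  by rewrite -mulrA expandM expandC ps_coefZmul K mulrDr mulrA.
pose D y := 1%:M - (t y - t x) *: gradmx s y.
(* From x_i - x_i(x) = w_i ((t - t(y)) + (t(y) - t(x))) one gets D_(n+1) x_i = D_n w_i + (t(y) -
   t(x)) D_(n+1) w_i at y. The last derivative is rewritten by [dE]; its part in the [e] goes into
   the matrix and the rest into [r]. *)
pose r i y := dpderiv t n (w i) y + (t y - t x) * L (s i) y.
have rr i : regular_at x (r i).
  apply: regular_add; first exact: IH.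
  apply: regular_mul; last by apply: rL => p; exact: rs.
  by apply: regular_sub => //; exact: regular_cst.
have re i : regular_at x (e i).
  have rD : regular_at x (fun y => (\det (D y))^-1 * \sum_j (\adj (D y)) i j * r j y).
    apply: regular_mul.
      apply: regularV; first exact: regular_det.
      by rewrite (near_pt E3).
    apply: regular_sum => j _ _; apply: regular_mul => //; exact: regular_adj.
  apply: regular_eq rD.
  have S : near x (fun y => forall i, dpderiv t n.+1 (w i) y =
      \sum_j (\sum_(p <- s i | p.1 == j) p.2.1 y * p.2.2 y) * e j y + L (s i) y).
    apply: near_all => j; apply: dE => //; first exact: rs.
    by apply: nearS E2 => y; apply.
  apply: nearS (nearI (nearI E3 UN) (nearI S E1)) => y [[D0 uy] [{}S Ey]].
  have [phi h] := fc_of_ex uy.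
  apply: (canLR (mulKf D0)); apply: esym.
  apply: (@linear_system _ _ ((t y - t x) *: gradmx s y) (e^~ y) (r^~ y)).
  move=> j; rewrite /e (dpderivE _ _ uy h) -[germ y _](subrK (chart i0 j x)%:A) Ey.
  rewrite expandD expandC ps_coefD ps_coefC addr0 expandM.
  rewrite (_ : expand phi (germ y t - (t x)%:A) = psX + (t y - t x)%:A); last first.
    rewrite scalerBl addrA -(expand_par h) !expandB !expandC addrNK //.
  rewrite mulrDr ps_coefD ps_coefMX [_ * _%:A]mulrC ps_coefZmul.
  rewrite -!(dpderivE _ _ uy h) S /r mulrDr addrCA mulr_sumr; congr (_ + _).
  by apply: eq_bigr => j' _; rewrite !mxE mulrA.
have [s0 [rs0 Es0]] := gradient xi0 rf.
have R : regular_at x (fun y =>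
    \sum_j (\sum_(p <- s0 | p.1 == j) p.2.1 y * p.2.2 y) * e j y + L s0 y).
  apply: regular_add; last exact: rL.
  apply: regular_sum => j _ _; apply: regular_mul => //.
  by apply: regular_sum => p /rs0[r1 r2] _; exact: regular_mul.
by apply: regular_eq R; apply: nearS (dE f s0 rf rs0 Es0) => y ->.
Qed.

End CurveCoordinates.

(** * Principal parts and Taylor's formula *)

Lemma ps_coef_binom (R : comNzRingType) (c : R) m j :
  ((c%:A + psX : pseries R) ^+ m) j = (c ^+ (m - j)) *+ 'C(m, j).
Proof.
have X0 (f : pseries R) : (f * psX) 0%N = 0 by exact: ps_coefMX0.
elim: m j => [|m IH] j.
  by rewrite expr0 ps_coef1 bin0n; case: j.
rewrite exprSr mulrDr ps_coefD mulrC ps_coefZmul IH; case: j => [|j].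
  by rewrite X0 addr0 !bin0 subn0 -exprS.
rewrite ps_coefMX IH subSS binS mulrnDr; congr (_ + _).
have [lt|le] := ltnP j m; first by rewrite mulrnAr -exprS subnS prednK ?subn_gt0.
by rewrite bin_small ?ltnS // !mulr0n mulr0.
Qed.

Lemma ps_coefMXn (R : comNzRingType) (f : pseries R) m n :
  (f * psX ^+ m) n = if (m <= n)%N then f (n - m)%N else 0.
Proof.
elim: m n => [|m IH] n; first by rewrite expr0 mulr1 subn0.
rewrite exprSr mulrA; case: n => [|n]; first exact: ps_coefMX0.
by rewrite ps_coefMX IH ltnS subSS.
Qed.

(** At a nilpotent z only a truncation of the series matters, so multiplicativity is that of
    polynomial evaluation. It makes [taylor] multiplicative. *)
Lemma ps_eval_mul (R S : comNzRingType) (h : {rmorphism R -> S}) (z : S) N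
    (f g : pseries R) : z ^+ N = 0 ->
  \sum_(j < N) h ((f * g) j) * z ^+ j =
  (\sum_(j < N) h (f j) * z ^+ j) * (\sum_(j < N) h (g j) * z ^+ j).
Proof.
move=> zN; have ev (p : {poly R}) : (map_poly h p).[z] = \sum_(j < N) h p`_j * z ^+ j.
  rewrite (@horner_coef_wide _ (N + size p)); last first.
    by rewrite (leq_trans (size_poly _ _)) // leq_addl.
  rewrite big_split_ord /= [X in _ + X]big1 ?addr0.
    by apply: eq_bigr => i _; rewrite coef_map.
  by move=> i _; rewrite exprD zN mul0r mulr0.
have evt (f0 : pseries R) : \sum_(j < N) h (f0 j) * z ^+ j = (map_poly h (ps_trunc N f0)).[z].
  by rewrite ev; apply: eq_bigr => j _; rewrite coef_poly ltn_ord.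
rewrite (evt f) (evt g) -hornerM -rmorphM ev; apply: eq_bigr => j _.
by rewrite -ps_mul_tr.
Qed.

Lemma nilp_unit (R : comNzRingType) (j : R) m : j ^+ m = 0 -> exists v, v * (1 + j) = 1.
Proof.
move=> jm; exists (\sum_(i < m) (- j) ^+ i).
have := subrX1 (- j) m; rewrite exprNn jm mulr0 sub0r => E.
apply: oppr_inj; rewrite E; ring.
Qed.

Section PrincipalPartsTheory.
Variables (k : comNzRingType) (A : comAlgType k).

Lemma rq_pi_zmod (R : comPzRingType) (I : ideal_of R) : zmod_morphism (rq_pi I).
Proof.
move=> x y; apply: (addIr (rq_pi I y)).
by rewrite subrK -rq_piD subrK.
Qed.
Lemma rq_pi_monoid (R : comPzRingType) (I : ideal_of R) : monoid_morphism (rq_pi I).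
Proof. by split=> [|x y]; [|exact: rq_piM]. Qed.
HB.instance Definition _ (R : comPzRingType) (I : ideal_of R) :=
  GRing.isZmodMorphism.Build _ _ (rq_pi I) (@rq_pi_zmod R I).
HB.instance Definition _ (R : comPzRingType) (I : ideal_of R) :=
  GRing.isMonoidMorphism.Build _ _ (rq_pi I) (@rq_pi_monoid R I).

Definition AAl (a : A) : AA A := AAp a 1.
Definition AAr (a : A) : AA A := AAp 1 a.

Lemma AAl_zmod : zmod_morphism AAl.
Proof.
move=> a b; apply: (addIr (AAl b)); rewrite subrK.
by have [D _ _] := AA_bal A; rewrite -[LHS](D (a - b) b 1) subrK.
Qed.
Lemma AAl_monoid : monoid_morphism AAl.
Proof. by split=> [|a b] //; rewrite [RHS]AA_mulE mulr1. Qed.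
Lemma AAr_zmod : zmod_morphism AAr.
Proof.
move=> a b; apply: (addIr (AAr b)); rewrite subrK.
by have [_ D _] := AA_bal A; rewrite -[LHS](D 1 (a - b) b) subrK.
Qed.
Lemma AAr_monoid : monoid_morphism AAr.
Proof. by split=> [|a b] //; rewrite [RHS]AA_mulE mulr1. Qed.
HB.instance Definition _ := GRing.isZmodMorphism.Build _ _ AAl AAl_zmod.
HB.instance Definition _ := GRing.isMonoidMorphism.Build _ _ AAl AAl_monoid.
HB.instance Definition _ := GRing.isZmodMorphism.Build _ _ AAr AAr_zmod.
HB.instance Definition _ := GRing.isMonoidMorphism.Build _ _ AAr AAr_monoid.

Lemma AApE a b : AAp a b = AAl a * AAr b.
Proof. by rewrite [RHS]AA_mulE mulr1 mul1r. Qed.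

Lemma AAl_alg c : AAl c%:A = AAr c%:A.
Proof. by have [_ _ D] := AA_bal A; rewrite [LHS]D. Qed.

Lemma AA_mult_zmod : zmod_morphism (@AA_mult k A).
Proof.
move=> u v; apply: (addIr (AA_mult v)).
by rewrite subrK -AA_multD subrK.
Qed.
Lemma AA_mult_monoid : monoid_morphism (@AA_mult k A).
Proof. by split=> [|a b]; [rewrite [LHS]AA_multE mulr1|exact: AA_multM]. Qed.
HB.instance Definition _ := GRing.isZmodMorphism.Build _ _ (@AA_mult k A) AA_mult_zmod.
HB.instance Definition _ := GRing.isMonoidMorphism.Build _ _ (@AA_mult k A) AA_mult_monoid.

Lemma AA_span (z : AA A) : exists s : seq (A * A), z = \sum_(p <- s) AAl p.1 * AAr p.2.
Proof.
exists (repr z); rewrite [LHS]tens_sum; apply: eq_bigr => p _; exact: AApE.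
Qed.

Section Order.
Variable n : nat.

Lemma d0_zmod : zmod_morphism (@d0 k A n).
Proof. by move=> a b; rewrite /d0 -!/(AAl _) !rmorphB. Qed.
Lemma d0_monoid : monoid_morphism (@d0 k A n).
Proof. by split=> [|a b] //; rewrite /d0 -!/(AAl _) !rmorphM. Qed.
Lemma d1_zmod : zmod_morphism (@d1 k A n).
Proof. by move=> a b; rewrite /d1 -!/(AAr _) !rmorphB. Qed.
Lemma d1_monoid : monoid_morphism (@d1 k A n).
Proof. by split=> [|a b] //; rewrite /d1 -!/(AAr _) !rmorphM. Qed.
HB.instance Definition _ := GRing.isZmodMorphism.Build _ _ (@d0 k A n) d0_zmod.
HB.instance Definition _ := GRing.isMonoidMorphism.Build _ _ (@d0 k A n) d0_monoid.
HB.instance Definition _ := GRing.isZmodMorphism.Build _ _ (@d1 k A n) d1_zmod.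
HB.instance Definition _ := GRing.isMonoidMorphism.Build _ _ (@d1 k A n) d1_monoid.

Lemma d0D a b : d0 n (a + b) = d0 n a + d0 n b :> pparts A n.
Proof. exact: rmorphD. Qed.
Lemma d0B a b : d0 n (a - b) = d0 n a - d0 n b :> pparts A n.
Proof. exact: rmorphB. Qed.
Lemma d0M a b : d0 n (a * b) = d0 n a * d0 n b :> pparts A n.
Proof. exact: rmorphM. Qed.
Lemma d01 : d0 n (1 : A) = 1.
Proof. by []. Qed.
Lemma d00 : d0 n (0 : A) = 0.
Proof. exact: rmorph0. Qed.
Lemma d1D a b : d1 n (a + b) = d1 n a + d1 n b :> pparts A n.
Proof. exact: rmorphD. Qed.
Lemma d1B a b : d1 n (a - b) = d1 n a - d1 n b :> pparts A n.
Proof. exact: rmorphB. Qed.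
Lemma d1M a b : d1 n (a * b) = d1 n a * d1 n b :> pparts A n.
Proof. exact: rmorphM. Qed.
Lemma d11 : d1 n (1 : A) = 1.
Proof. by []. Qed.

Lemma d0X a m : d0 n (a ^+ m) = d0 n a ^+ m :> pparts A n.
Proof. exact: rmorphXn. Qed.
Lemma d1X a m : d1 n (a ^+ m) = d1 n a ^+ m :> pparts A n.
Proof. exact: rmorphXn. Qed.
Lemma d0N a : d0 n (- a) = - d0 n a :> pparts A n.
Proof. exact: rmorphN. Qed.
Lemma d0Mn a m : d0 n (a *+ m) = d0 n a *+ m :> pparts A n.
Proof. exact: rmorphMn. Qed.
Lemma d0_sum I (s : seq I) (P : pred I) (F : I -> A) :
  d0 n (\sum_(i <- s | P i) F i) = \sum_(i <- s | P i) d0 n (F i).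
Proof. exact: rmorph_sum. Qed.

Lemma d0_alg c : d0 n (c%:A : A) = d1 n c%:A.
Proof. by rewrite /d0 /d1 -/(AAl _) AAl_alg. Qed.

(** Restriction to the diagonal. Its kernel is nilpotent, so that units of P^n are detected in
    [A]. *)
Definition pp_mult (z : pparts A n) : A := AA_mult (repr z).

Lemma diag_pow_sub m (z : AA A) : ideal_pow (@diag_ideal k A) m.+1 z -> AA_mult z = 0.
Proof.
move=> [s Js ->]; rewrite rmorph_sum big_seq big1 // => p /Js[Jp _].
by rewrite rmorphM /= Jp mul0r.
Qed.

Lemma pp_multE z : pp_mult (rq_pi (diag_pow A n) z) = AA_mult z.
Proof.
have := rq_repr (diag_pow A n) z => /diag_pow_sub /eqP.
by rewrite rmorphB subr_eq0 => /eqP.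
Qed.

Lemma pp_mult_zmod : zmod_morphism pp_mult.
Proof.
by elim/rq_ind => u; elim/rq_ind => v; rewrite -rmorphB !pp_multE rmorphB.
Qed.
Lemma pp_mult_monoid : monoid_morphism pp_mult.
Proof.
split; first by rewrite -(rmorph1 (rq_pi (diag_pow A n))) pp_multE rmorph1.
by elim/rq_ind => u; elim/rq_ind => v; rewrite -rmorphM !pp_multE rmorphM.
Qed.
HB.instance Definition _ := GRing.isZmodMorphism.Build _ _ pp_mult pp_mult_zmod.
HB.instance Definition _ := GRing.isMonoidMorphism.Build _ _ pp_mult pp_mult_monoid.

Lemma pp_mult0 a : pp_mult (d0 n a) = a.
Proof. by rewrite pp_multE AA_multE mulr1. Qed.
Lemma pp_mult1 a : pp_mult (d1 n a) = a.
Proof. by rewrite pp_multE AA_multE mul1r. Qed.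

Lemma diag_powX (z : AA A) m : AA_mult z = 0 -> ideal_pow (@diag_ideal k A) m (z ^+ m).
Proof.
move=> z0; elim: m => [//|m IH]; exists [:: (z, z ^+ m)]; last by rewrite big_seq1 exprS.
by move=> p; rewrite inE => /eqP->.
Qed.

Lemma pp_nilp (z : pparts A n) m : pp_mult z = 0 -> (n < m)%N -> z ^+ m = 0.
Proof.
elim/rq_ind: z => z; rewrite pp_multE => z0 nm; rewrite -(subnKC nm) exprD.
have -> : rq_pi (diag_pow A n) z ^+ n.+1 = 0; last by rewrite mul0r.
rewrite -rmorphXn; apply/rq_piE; rewrite subr0; exact: (@diag_powX z n.+1 z0).
Qed.

Lemma pp_unit (z : pparts A n) : (exists w, w * pp_mult z = 1) -> exists v, v * z = 1.
Proof.
move=> [w wz]; set j := d0 n w * z - 1.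
have j0 : pp_mult j = 0 by rewrite rmorphB rmorphM /= pp_mult0 wz rmorph1 subrr.
have [v E] := nilp_unit (pp_nilp j0 (ltnSn n)).
by exists (v * d0 n w); rewrite -mulrA -[RHS]E; congr (_ * _); rewrite addrC subrK.
Qed.

Lemma delta_mult a : pp_mult (delta n a) = 0.
Proof. by rewrite rmorphB /= pp_mult0 pp_mult1 subrr. Qed.

Lemma delta_nilp a m : (n < m)%N -> delta n a ^+ m = 0 :> pparts A n.
Proof. by apply: pp_nilp; exact: delta_mult. Qed.

End Order.
End PrincipalPartsTheory.

Lemma ps_coefMn (R : comNzRingType) (f : pseries R) m n : (f *+ m) n = f n *+ m.
Proof. by elim: m => [|m IH]; rewrite ?mulr0n // !mulrS ps_coefD IH. Qed.

Lemma expandMn (k : closedFieldType) (X : projset k) (x : pt X) (phi : fcoord x) u m :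
  expand phi (u *+ m) = expand phi u *+ m.
Proof. exact: raddfMn. Qed.

(** * Divided-power derivations on germs *)

Section Derivations.
Variables (k : closedFieldType) (C : curve k).
Implicit Types (x y : pt C) (U W : set (pt C)) (f g t : pt C -> k).

Definition coord_at x t : Prop := regular_at x t /\ unif (local_par x t).

Lemma coord_at_near x t : coord_at x t -> near x (fun y => coord_at y t).
Proof. by move=> [rt ut]; exact: nearI (regular_nearE rt) (unif_near rt ut). Qed.

Lemma coordinate_at U t x : coordinate U t -> U x -> coord_at x t.
Proof. by move=> ct Ux; split; [apply: (proj1 ct)|exact: coordinate_unif ct Ux]. Qed.

Lemma dpderiv_reg x t n f : coord_at x t -> regular_at x f -> regular_at x (dpderiv t n f).
Proof. by move=> [rt ut]; exact: dpderiv_regular. Qed.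

(* packaged as the Taylor expansion O_x -> O_x[[s]] *)
Definition Der t x (u : lring x) : pseries (lring x) :=
  fun n => germ x (dpderiv t n (\val (repr u))).

(** A derivative at y depends only on the germ at y, so representatives that agree near x have
    derivatives that agree near x. *)
Lemma Der_germ t x f n : coord_at x t -> regular_at x f ->
  Der t (germ x f) n = germ x (dpderiv t n f).
Proof.
move=> ct rf; rewrite /Der; set f0 := \val _.
have rf0 : regular_at x f0 by apply/asboolP/(valP (repr (germ x f))).
have E : germ x f0 = germ x f by rewrite /f0 germ_val /rq_pi reprK.
apply: germ_near; first exact: dpderiv_reg.
have := near_near (germ_inj rf0 rf E); move=> /nearI/(_ (regular_nearE rf0)).
by apply: nearS => y [E' r0]; rewrite /dpderiv (germ_near r0 E').
Qed.

Lemma germ_dpderiv x t f n (phi : fcoord x) : coord_at x t -> fc_of t phi ->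
  dpderiv t n f x = expand phi (germ x f) n.
Proof. by move=> [_ ut] h; rewrite (dpderivE _ _ ut h). Qed.

(** Germs are compared through their values at all y near x, where every D_n is a coefficient of the
    ring homomorphism [expand phi]. The rules for products, constants and the parameter follow in
    the same way. *)
Lemma Der_add t x (u v : lring x) : coord_at x t -> Der t (u + v) = Der t u + Der t v.
Proof.
move=> ct; apply/funext => n; have [f rf ->] := germP u; have [g rg ->] := germP v.
rewrite ps_coefD -germD // !Der_germ //; last exact: regularD.
rewrite -germD; [|exact: dpderiv_reg..].
apply: germ_near; first by apply: dpderiv_reg => //; exact: regularD.
have R := nearI (regular_nearE rf) (regular_nearE rg).
apply: nearS (nearI R (coord_at_near ct)) => y [[rfy rgy] cy].
have [phi h] := fc_of_ex (proj2 cy).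
rewrite [RHS](_ : _ = dpderiv t n f y + dpderiv t n g y) //.
by rewrite !(germ_dpderiv _ _ cy h) germD // expandD ps_coefD.
Qed.

Lemma Der_mul t x (u v : lring x) : coord_at x t -> Der t (u * v) = Der t u * Der t v.
Proof.
move=> ct; apply/funext => n; have [f rf ->] := germP u; have [g rg ->] := germP v.
rewrite ps_coefM -germM // Der_germ //; last exact: regularM.
have rd m h : regular_at x h -> regular_at x (dpderiv t m h) by exact: dpderiv_reg.
transitivity (germ x (fun y => \sum_(i < n.+1) dpderiv t i f y * dpderiv t (n - i) g y)).
  apply: germ_near; first by apply: dpderiv_reg => //; exact: regularM.
  have R := nearI (regular_nearE rf) (regular_nearE rg).
  apply: nearS (nearI R (coord_at_near ct)) => y [[rfy rgy] cy].
  have [phi h] := fc_of_ex (proj2 cy).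
  rewrite (germ_dpderiv _ _ cy h) germM // expandM ps_coefM.
  by apply: eq_bigr => i _; rewrite !(germ_dpderiv _ _ cy h).
elim: (index_enum _) => [|i s IH].
  rewrite big_nil -(scale0r 1) -germC; congr (germ x _).
  by apply/funext => y; rewrite big_nil.
rewrite big_cons -IH !Der_germ // -germM; [|exact: rd..].
rewrite -germD; last first.
- by apply: regular_sum => j _ _; apply: regular_mul; exact: rd.
- by apply: regularM; exact: rd.
by congr (germ x _); apply/funext => y; rewrite big_cons.
Qed.

Lemma Der_alg t x c : coord_at x t -> Der t (c%:A : lring x) = c%:A%:A.
Proof.
move=> ct; apply/funext => n; rewrite -germC Der_germ //; last exact: regular_cst.
rewrite ps_coefC; apply: (@etrans _ _ (germ x (fun y => if n == 0%N then c else 0))).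
  apply: germ_near; first by apply: dpderiv_reg => //; exact: regular_cst.
  apply: nearS (coord_at_near ct) => y cy; have [phi h] := fc_of_ex (proj2 cy).
  by rewrite (germ_dpderiv _ _ cy h) germC expandC ps_coefC.
by case: eqP => // _; rewrite germC scale0r.
Qed.

Lemma Der_one t x : coord_at x t -> Der t (1 : lring x) = 1.
Proof. by move=> ct; rewrite -[1 in LHS]scale1r Der_alg // !scale1r. Qed.

Lemma Der_par t x : coord_at x t -> Der t (local_par x t) = (local_par x t)%:A + psX.
Proof.
move=> ct; have [rt _] := ct; apply/funext => n.
have rc := regular_cst x (t x).
rewrite /local_par -germC -germB // Der_germ //; last exact: regularB.
rewrite ps_coefD ps_coefC.
transitivity (germ x (fun y => (if n == 0%N then t y - t x else 0) + psX n)).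
  apply: germ_near; first by apply: dpderiv_reg => //; exact: regularB.
  apply: nearS (nearI (coord_at_near ct) (regular_nearE rt)) => y [cy ry].
  have [phi h] := fc_of_ex (proj2 cy).
  rewrite (germ_dpderiv _ _ cy h) germB //; last exact: regular_cst.
  rewrite germC expandB expandC h ps_coefD ps_coefD ps_coefN !ps_coefC.
  by case: eqP => _; rewrite ?subr0 // addrAC.
rewrite (_ : germ x _ = germ x ((fun y => if n == 0%N then t y - t x else 0) + (fun=> psX n))) //.
have r1 : regular_at x (fun y => if n == 0%N then t y - t x else 0).
  by case: eqP => _; [exact: regularB|exact: regular_cst].
rewrite germD //; last exact: regular_cst.
congr (_ + _); first by case: eqP => // _; rewrite germC scale0r.
by rewrite germC /psX; case: eqP => _; rewrite ?scale1r ?scale0r.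
Qed.

Lemma Der_coef0 t x (u : lring x) : coord_at x t -> Der t u 0%N = u.
Proof.
move=> ct; have [f rf ->] := germP u; rewrite Der_germ //; apply: germ_near.
  exact: dpderiv_reg.
apply: nearS (nearI (coord_at_near ct) (regular_nearE rf)) => y [cy ry].
by rewrite dpderiv0 //; case: cy.
Qed.

Lemma Der_exp t x (u : lring x) n : coord_at x t -> Der t (u ^+ n) = Der t u ^+ n.
Proof.
move=> ct; elim: n => [|n IH]; first exact: Der_one.
by rewrite !exprS Der_mul // IH.
Qed.

Lemma par_expansion t x (phi : fcoord x) (u : lring x) M : coord_at x t -> fc_of t phi ->
  exists w, u = \sum_(m < M) (expand phi u m)%:A * local_par x t ^+ m +
    w * local_par x t ^+ M.
Proof.
move=> ct h; elim: M u => [|M IH] u; first by exists u; rewrite big_ord0 add0r mulr1.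
have [v E] := unif_step u (proj2 ct); have [w Ew] := IH v.
exists w; rewrite {1}E {1}Ew big_ord_recl expr0 mulr1 expand_coef0 -addrA.
congr (_ + _); rewrite mulrDl exprSr mulrA mulr_suml; congr (_ + _).
by apply: eq_bigr => m _; rewrite -mulrA -exprSr (expand_step _ h E).
Qed.

Lemma Der_sum t x I (s : seq I) (F : I -> lring x) : coord_at x t ->
  Der t (\sum_(i <- s) F i) = \sum_(i <- s) Der t (F i).
Proof.
move=> ct; elim: s => [|i s IH]; last by rewrite !big_cons Der_add // IH.
by rewrite !big_nil -(scale0r 1) Der_alg // !scale0r.
Qed.

(** At x this reads D_i D_j = C(i+j, j) D_(i+j). It is checked on powers of the parameter p = t -
    t(x), where [Der] gives (p + s)^m. A multiple of p^(i+j+1) keeps a factor p^(i+1) after D_j,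
    hence does not contribute to the coefficient i. The right-hand side is the coefficient pattern
    of [ps_recenter]. *)
Lemma expand_Der t x (phi : fcoord x) (u : lring x) i j : coord_at x t -> fc_of t phi ->
  expand phi (Der t u j) i = expand phi u (i + j)%N *+ 'C(i + j, j).
Proof.
move=> ct h; have pE := expand_par h; have [w E] := par_expansion u (i + j).+1 ct h.
have bin M (v : lring x) l : expand phi (v * Der t (local_par x t ^+ M) l) =
    expand phi v * psX ^+ (M - l) *+ 'C(M, l).
  by rewrite Der_exp // Der_par // ps_coef_binom mulrnAr expandMn expandM expandX pE.
have Z : (Der t (w * local_par x t ^+ (i + j).+1)) j = 
   \sum_(l < j.+1) Der t w l * Der t (local_par x t ^+ (i + j).+1) (j - l)%N.
  by rewrite Der_mul // ps_coefM.
rewrite {1}E Der_add // Der_sum // ps_coefD ps_coef_sum Z expandD ps_coefD !expand_sum !ps_coef_sum.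
rewrite [X in _ + X]big1 ?addr0; last first.
  move=> l _; rewrite bin ps_coefMn ps_coefMXn ifF ?mul0rn //.
  apply/negbTE; rewrite -ltnNge ltn_subRL.
  by rewrite addnC ltnS leq_add2l leq_subr.
rewrite big_ord_recr /= big1 ?add0r => [|m _].
  rewrite Der_mul // Der_alg // ps_coefZmul bin ps_coefMn expandC ps_coefMXn.
  by rewrite addnK leqnn subnn ps_coefC.
rewrite Der_mul // Der_alg // ps_coefZmul bin ps_coefMn expandC ps_coefMXn.
have [mj|jm] := ltnP m j; first by rewrite bin_small // mulr0n.
have mij : (m < j + i)%N by rewrite (addnC j i) ltn_ord.
rewrite ifT; last by rewrite leq_subLR ltnW.
rewrite ps_coefC ifF ?mul0rn //; apply/negbTE; rewrite subn_eq0 -ltnNge.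
by rewrite ltn_subLR.
Qed.

Section Taylor.
Variables (x : pt C) (t : pt C -> k) (n : nat).
Hypothesis ct : coord_at x t.

Let dl : pparts (lring x) n := delta n (germ x t).

Definition taylor (u : lring x) : pparts (lring x) n :=
  \sum_(j < n.+1) d0 n (Der t u j) * dl ^+ j.

Lemma taylor_mul u v : taylor (u * v) = taylor u * taylor v.
Proof.
by rewrite /taylor Der_mul // (ps_eval_mul (@d0 _ _ n)) // delta_nilp.
Qed.

Lemma taylor_add u v : taylor (u + v) = taylor u + taylor v.
Proof.
rewrite /taylor Der_add // -big_split; apply: eq_bigr => j _.
by rewrite ps_coefD d0D mulrDl.
Qed.

Lemma taylor_alg c : taylor c%:A = d1 n c%:A.
Proof.
rewrite /taylor Der_alg // big_ord_recl ps_coefC mulr1 d0_alg big1 ?addr0 // => j _.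
by rewrite ps_coefC d00 mul0r.
Qed.

Lemma taylor_par : taylor (local_par x t) = d1 n (local_par x t).
Proof.
have E : d1 n (local_par x t) = d0 n (local_par x t) + dl.
  rewrite /local_par d1B d0B d0_alg /dl /delta.
  by rewrite [RHS]addrC addrA subrK.
rewrite E /taylor Der_par // big_ord_recl ps_coefD ps_coefC /= /psX addr0 mulr1.
(* For n = 0 the sum has no linear term, but [dl] is then 0. *)
congr (_ + _); have [n0|] := posnP n.
  rewrite (_ : dl = 0); last by rewrite -[dl]expr1 delta_nilp // n0.
  by apply: big1 => -[j lj] _; exfalso; rewrite n0 in lj.
move=> n0; rewrite (bigD1 (Ordinal n0)) //= ps_coefD ps_coefC add0r d01 mul1r expr1.
rewrite big1 ?addr0 // => -[j lj] /eqP jn; rewrite ps_coefD ps_coefC add0r /psX /=.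
case: j lj jn => [|j] lj jn; last by rewrite d00 mul0r.
by case: jn; apply: val_inj.
Qed.

(* D = d_1 - taylor is a difference of ring homomorphisms, so the ideal I
   generated by the D(x_i) contains all D(w); as D kills t - t(x), one has
   D(x_i) = d_1(t - t(x)) D(w_i) and I vanishes by Nakayama. *)
Lemma taylor_formula u : d1 n u = taylor u.
Proof.
have [i0 xi0] := in_chart_ex x.
have T1 : taylor 1 = 1 by rewrite -[1 in LHS]scale1r taylor_alg scale1r d11.
have D := hom_diff xi0 taylor_add (@d1D _ (lring x) n) taylor_mul
  (@d1M _ (lring x) n) taylor_alg T1 (@d11 _ (lring x) n).
pose e j := d1 n (germ x (chart i0 j)) - taylor (germ x (chart i0 j)).
have [w [_ [_ _ /near_pt E _ _]]] := chart_system xi0 (proj1 ct) (proj2 ct).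
have /fin_all_exists[c cE] := fun i => D (germ x (w i)).
pose p := d1 n (local_par x t).
pose A := \matrix_(i, j) (p * c i j).
have S i : e i = \sum_j A i j * e j + 0.
  have -> : e i = p * (d1 n (germ x (w i)) - taylor (germ x (w i))).
    have Ei : germ x (chart i0 i) = (chart i0 i x)%:A + germ x (w i) * local_par x t.
      by rewrite -E addrC subrK.
    rewrite /e Ei taylor_add taylor_mul taylor_alg taylor_par d1D (d1M _ (germ x (w i))).
    by rewrite -/p [RHS]mulrC mulrBl opprD addrACA subrr add0r.
  rewrite cE mulr_sumr addr0; apply: eq_bigr => j _.
  by rewrite mxE mulrA.
(* Units of P^n are detected on the diagonal, and there at the point x, where the matrix [A]
   vanishes because t - t(x) does. *)
have dU : exists v, v * \det (1%:M - A) = 1.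
  apply: pp_unit; apply: lring_unit; rewrite -!det_map_mx.
  rewrite (_ : map_mx _ _ = 1%:M) ?det1 ?oner_neq0 //.
  apply/matrixP => i j; rewrite !mxE !rmorphB !rmorphMn !rmorph1 !rmorphM /= pp_mult1.
  by rewrite (proj1 (proj2 ct)) mul0r subr0.
have e0 j : e j = 0.
  have [v vE] := dU; rewrite -[LHS]mul1r -vE -mulrA (linear_system S).
  by rewrite big1 ?mulr0 // => i _; rewrite mulr0.
apply/eqP; rewrite -subr_eq0; have [c' ->] := D u; apply/eqP.
by rewrite big1 // => j _; rewrite -/(e j) e0 mulr0.
Qed.

End Taylor.
End Derivations.

(** * The vertex algebra sheaf *)

Section TensorMaps.
Variables (k : comNzRingType) (V : lmodType k).

(** One representation of [u] over [R] as a sum of pure tensors serves every base change of [u].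
    This is what yields the same finite list of coefficient functions at all points. *)
Lemma tlift_ext_map (R S : comAlgType k) (f : {lrmorphism R -> S}) (W : zmodType)
    (b : V -> S -> W) (u : ext V R) :
  balanced (@scal_ra k V) (@scal_la k S) b ->
  tlift b (ext_map f u) = \sum_(p <- repr u) b p.1 (f p.2).
Proof.
move=> bb; have [pD pD' pZ] := pure_balanced (@scal_ra k V) (@scal_la k S).
have pb : balanced (@scal_ra k V) (@scal_la k R)
    (fun m n => pure (@scal_ra k V) (@scal_la k S) m (f n)).
  split=> [m m' n|m n n'|m c n]; first exact: pD.
    by rewrite rmorphD pD'.
  by rewrite /scal_la linearZ -pZ.
rewrite {1}[u]tens_sum /ext_map /tmap.
have D1 := tliftD pb; have D2 := tliftD bb.
rewrite (big_morph _ D1 (tlift_zero pb)).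
rewrite (big_morph _ D2 (tlift_zero bb)); apply: eq_bigr => p _.
by rewrite (tlift_pure _ _ pb) tlift_pure.
Qed.

Lemma ext_map_extp (R S : comAlgType k) (f : {lrmorphism R -> S}) (a : V) :
  ext_map f (extp a 1) = extp a 1 :> ext V S.
Proof.
rewrite /ext_map /tmap [LHS]tlift_pure ?rmorph1 //.
have [pD pD' pZ] := pure_balanced (@scal_ra k V) (@scal_la k S).
split=> [m m' n|m n n'|m c n]; first exact: pD.
  by rewrite rmorphD pD'.
by rewrite /scal_la linearZ -pZ.
Qed.

End TensorMaps.

Section PointwiseAction.
Variables (k : closedFieldType) (V : lmodType k) (Pi : autO_rep V).

(** The composition law holds on V (x) k and is carried to V by [ev], the inverse of a |-> a (x)
    1. *)
Lemma actk_comp (r s : pseries k) a : is_aut r -> is_aut s ->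
  actk Pi (ps_comp s r) a = actk Pi r (actk Pi s a).
Proof.
move=> hr hs; rewrite /actk; set ev := tlift _.
have evE (u : ext V k^o) : u = extp (ev u) 1.
  have bb := @actk_bal k V; have D := tliftD bb.
  apply: (@tens_morph_eq _ _ _ (@scal_ra k V) (@scal_la k k^o) _ id
     (fun u => extp (ev u) 1 : ext V k^o)) => //.
    by move=> x y; rewrite /ev D extpD.
  move=> m n; rewrite /ev tlift_pure //.
  have [pD pD' pZ] := pure_balanced (@scal_ra k V) (@scal_la k k^o).
  by rewrite [RHS]pZ /scal_la [_ *: _]mulr1.
have -> : act Pi (ps_comp s r : pseries k^o) (extp a 1) =
   act Pi (r : pseries k^o) (act Pi (s : pseries k^o) (extp a 1)).
  exact: (@actM _ _ Pi k^o r s (extp a 1) hr hs).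
by rewrite -(evE (act Pi (s : pseries k^o) (extp a 1))).
Qed.

Lemma actk_psX a : actk Pi psX a = a.
Proof.
rewrite /actk; have -> : act Pi (psX : pseries k^o) (extp a 1) = extp a 1 by exact: act1.
by rewrite tlift_pure ?scale1r //; exact: actk_bal.
Qed.

Lemma actk_sum r I (s : seq I) (F : I -> V) : is_aut r ->
  actk Pi r (\sum_(i <- s) F i) = \sum_(i <- s) actk Pi r (F i).
Proof.
move=> hr; have a0 : actk Pi r 0 = 0 by rewrite -(scale0r 0) actkZ // !scale0r.
by rewrite (big_morph _ (fun u v => actkD Pi u v hr) a0).
Qed.

Lemma actz_bal n : balanced (@scal_ra k V) (@scal_la k (pseries k))
  (fun (v : V) (f : pseries k) => f n *: v).
Proof.
split=> [m m' f|m f f'|m c f]; first exact: scalerDr.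
  by rewrite ps_coefD scalerDl.
by rewrite /scal_ra /scal_la ps_coefZ scalerA mulrC.
Qed.

End PointwiseAction.

(** * Functions regular on an open set as a coefficient ring *)

Section SectionRing.
Variables (k : closedFieldType) (X : projset k).

Definition sect_pred (W : set (pt X)) : {pred pt X -> k} := fun f => `[< regular_on W f >].

Lemma sect_subring W : subring_closed (sect_pred W).
Proof.
split=> [|f g|f g]; rewrite ?unfold_in.
- by apply/asboolP => y _; exact: (regular_cst y 1).
- by move=> /asboolP rf /asboolP rg; apply/asboolP => y Wy; apply: regularB; [exact: rf|exact: rg].
- by move=> /asboolP rf /asboolP rg; apply/asboolP => y Wy; apply: regularM; [exact: rf|exact: rg].
Qed.

(* The point x0 only serves to make the ring nonzero. *)
Definition sect (W : set (pt X)) (x0 : pt X) : Type := {f : pt X -> k | sect_pred W f}.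
HB.instance Definition _ W x0 := SubChoice.on (sect W x0).
HB.instance Definition _ W x0 :=
  GRing.SubChoice_isSubComPzRing.Build _ _ (sect W x0) (sect_subring W).

Lemma sect1_neq0 W x0 : (1 : sect W x0) != 0.
Proof.
apply/eqP => /(congr1 (fun f : sect W x0 => \val f x0)) /eqP.
rewrite rmorph1 rmorph0 => /eqP E.
by have /eqP := oner_neq0 k; apply; exact: E.
Qed.
HB.instance Definition _ W x0 := GRing.PzSemiRing_isNonZero.Build (sect W x0) (sect1_neq0 W x0).

Lemma sect_cst_proof W c : sect_pred W (fun=> c).
Proof. by apply/asboolP => y _; exact: regular_cst. Qed.

Definition sect_scale W x0 (c : k) (f : sect W x0) : sect W x0 :=
  (Sub _ (sect_cst_proof W c) : sect W x0) * f.

Lemma sect_scaleE W x0 c (f : sect W x0) y : \val (sect_scale c f) y = c * \val f y.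
Proof. by rewrite rmorphM. Qed.

Lemma sectP W x0 (f g : sect W x0) : \val f =1 \val g -> f = g.
Proof. by move=> H; apply/val_inj/funext. Qed.

Lemma sect_D W x0 (f g : sect W x0) y : \val (f + g) y = \val f y + \val g y.
Proof. by rewrite rmorphD. Qed.
Lemma sect_M W x0 (f g : sect W x0) y : \val (f * g) y = \val f y * \val g y.
Proof. by rewrite rmorphM. Qed.

Lemma sect_scaleA W x0 a b (f : sect W x0) :
  sect_scale a (sect_scale b f) = sect_scale (a * b) f.
Proof. by apply: sectP => y; rewrite !sect_scaleE mulrA. Qed.
Lemma sect_scale1 W x0 : left_id 1 (@sect_scale W x0).
Proof. by move=> f; apply: sectP => y; rewrite sect_scaleE mul1r. Qed.
Lemma sect_scaleDr W x0 : right_distributive (@sect_scale W x0) +%R.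
Proof. by move=> a f g; apply: sectP => y; rewrite sect_D !sect_scaleE sect_D mulrDr. Qed.
Lemma sect_scaleDl W x0 (f : sect W x0) : {morph (@sect_scale W x0)^~ f : a b / a + b}.
Proof. by move=> a b; apply: sectP => y; rewrite sect_D !sect_scaleE mulrDl. Qed.

HB.instance Definition _ W x0 := GRing.Zmodule_isLmodule.Build k (sect W x0)
  (@sect_scaleA W x0) (@sect_scale1 W x0) (@sect_scaleDr W x0) (@sect_scaleDl W x0).

Lemma sect_scaleAl W x0 (a : k) (f g : sect W x0) : a *: (f * g) = (a *: f) * g.
Proof. exact: mulrA. Qed.

HB.instance Definition _ W x0 := GRing.Lmodule_isLalgebra.Build k (sect W x0)
  (@sect_scaleAl W x0).
HB.instance Definition _ W x0 := GRing.Lalgebra_isComAlgebra.Build k (sect W x0).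

Definition sect_ev W x0 (y : pt X) (f : sect W x0) : k^o := \val f y.

Lemma sect_ev_zmod W x0 y : zmod_morphism (@sect_ev W x0 y).
Proof. by move=> f g; rewrite /sect_ev rmorphB. Qed.
Lemma sect_ev_monoid W x0 y : monoid_morphism (@sect_ev W x0 y).
Proof. by split=> [|f g]; rewrite /sect_ev ?rmorph1 // sect_M. Qed.
Lemma sect_ev_scale W x0 y : scalable (@sect_ev W x0 y).
Proof. by move=> c f; rewrite /sect_ev [LHS]sect_scaleE. Qed.
HB.instance Definition _ W x0 y :=
  GRing.isZmodMorphism.Build _ _ (@sect_ev W x0 y) (@sect_ev_zmod W x0 y).
HB.instance Definition _ W x0 y :=
  GRing.isMonoidMorphism.Build _ _ (@sect_ev W x0 y) (@sect_ev_monoid W x0 y).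
HB.instance Definition _ W x0 y :=
  GRing.isScalable.Build _ _ _ _ (@sect_ev W x0 y) (@sect_ev_scale W x0 y).

Lemma sect_reg W x0 (f : sect W x0) y : W y -> regular_at y (\val f).
Proof. by move=> Wy; have /asboolP := valP f; apply. Qed.

Lemma sect_germ_lr W x0 y : W y ->
  exists g : {lrmorphism sect W x0 -> lring y}, forall f, g f = germ y (\val f).
Proof.
move=> Wy; have R f := @sect_reg W x0 f y Wy.
pose g (f : sect W x0) := germ y (\val f).
have H1 : zmod_morphism g by move=> u v; rewrite /g rmorphB; exact: (germB (R u) (R v)).
have H2 : monoid_morphism g.
  by split=> [|u v]; rewrite /g ?rmorph1 ?rmorphM; [exact: germ_cst1|exact: (germM (R u) (R v))].
have H3 : scalable g.
  move=> c u; have rc := regular_cst y c.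
  rewrite /g (_ : \val (c *: u) = (fun=> c) * \val u); first by rewrite (germM rc (R u)).
  by apply/funext => z; rewrite [LHS]sect_scaleE.
pose A := GRing.isZmodMorphism.Build _ _ g H1.
pose B := GRing.isMonoidMorphism.Build _ _ g H2.
pose D := GRing.isScalable.Build _ _ _ _ g H3.
pose h : {lrmorphism sect W x0 -> lring y} := HB.pack g A B D.
by exists h.
Qed.

End SectionRing.

(** * Families of coordinate changes *)

Section CoordinateChange.
Variables (k : closedFieldType) (C : curve k) (V : lmodType k) (Pi : autO_rep V).
Implicit Types (x y : pt C) (U W : set (pt C)) (f g t : pt C -> k).

(** A formal coordinate comes with a germ u whose expansion has order one. As u is a multiple of t -
    t(y), the linear coefficient of the expansion of t - t(y) cannot vanish. *)
Lemma par_aut y t (phi : fcoord y) : unif (local_par y t) ->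
  is_aut (expand phi (local_par y t)).
Proof.
move=> ut; set r := expand _ _.
have r0 : r 0%N = 0 by rewrite /r expand_coef0; exact: (proj1 ut).
split=> //; have [u [u0 u1]] := svalP phi.
have [w E] : exists w, u = w * local_par y t.
  by apply: (proj2 ut); rewrite -(expand_coef0 phi).
have u1E : expand phi u 1%N = expand phi w 0%N * r 1%N.
  by rewrite E expandM ps_coefM !big_ord_recr big_ord0 /= add0r subn0 subnn -/r r0 mulr0 addr0.
exists (r 1%N)^-1; rewrite mulfV //; apply/eqP => r10.
by apply: u1; rewrite [LHS]u1E r10 mulr0.
Qed.

(* The family of automorphisms r_y expanding t' - t'(y) in powers of t - t(y)
   has regular coefficients, hence is a point of Aut O over the functions
   regular on W; functoriality of Pi then controls all Pi(r_y) at once. *)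
Lemma act_family W t t' (a : V) : zopen W ->
  (forall y, W y -> coord_at y t /\ coord_at y t') ->
  exists s : seq (V * (pt C -> k)), (forall p, p \in s -> regular_on W p.2) /\
  forall y (phi : fcoord y), W y -> fc_of t phi ->
    actk Pi (expand phi (local_par y t')) a = \sum_(p <- s) p.2 y *: p.1 /\
    forall q, actz Pi (ps_recenter (expand phi (local_par y t'))) q a =
      \sum_(p <- s) expand phi (germ y p.2) q *: p.1.
Proof.
move=> oW ctt'.
have [x0|no] := pselect (exists x0 : pt C, True); last first.
  by exists [::]; split=> // y; case: no; exists y.
have {x0} [x0 _] := x0.
(* Elements of [sect W x0] are functions on the whole curve and are equal only if they agree off W
   as well. Off W the series is therefore set to [psX], which keeps its linear coefficient
   invertible. *)
pose rf j y := if j == 0%N then 0 else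
  if `[< W y >] then dpderiv t j t' y else (j == 1%N)%:R.
have rfE j y : W y -> j != 0%N -> near y (fun z => dpderiv t j t' z = rf j z).
  move=> Wy /negbTE j0; apply: nearS (near_nbhd oW Wy) => z /asboolP Wz.
  by rewrite /rf j0 Wz.
have rfR j : sect_pred W (rf j).
  apply/asboolP => y Wy; have [ct ct'] := ctt' y Wy.
  have [->|j0] := eqVneq j 0%N.
    by rewrite (_ : rf _ = fun=> 0) //; exact: regular_cst.
  by apply: regular_eq (rfE _ _ Wy j0) _; apply: dpderiv_reg => //; case: ct'.
pose rho : pseries (sect W x0) := fun j => Sub _ (rfR j).
have pE y (phi : fcoord y) j : W y -> fc_of t phi ->
    expand phi (local_par y t') j = rf j y.
  move=> Wy h; have [ct ct'] := ctt' y Wy.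
  case: j => [|j]; first by rewrite expand_coef0 gval_local_par //; case: ct'.
  rewrite -(near_pt (@rfE j.+1 y Wy isT)) (germ_dpderiv _ _ ct h).
  by rewrite expandB expandC ps_coefD ps_coefN ps_coefC subr0.
have rf1 y : rf 1%N y != 0.
  rewrite /rf /=; case: asboolP => [Wy|_]; last exact: oner_neq0.
  have [ct ct'] := ctt' y Wy; have [phi h] := fc_of_ex (proj2 ct).
  have [_ [z zE]] := par_aut phi (proj2 ct').
  have := pE y phi 1%N Wy h; rewrite /rf /= (asboolT Wy) => <-.
  apply/eqP => E; move: zE; rewrite E mul0r => /esym /eqP.
  by rewrite oner_eq0.
have hrho : is_aut rho.
  split; first by apply: sectP => y; rewrite rmorph0.
  have R : sect_pred W (fun y => (rf 1%N y)^-1).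
    by apply/asboolP => y Wy; apply: regularV => //; have /asboolP := rfR 1%N; apply.
  exists (Sub _ R); apply: sectP => y; rewrite sect_M rmorph1.
  exact: (mulfV (rf1 y)).
set u := act Pi rho (extp a 1).
exists [seq (p.1, \val p.2) | p <- repr u]; split.
  by move=> _ /mapP[p _ ->] y; exact: sect_reg.
move=> y phi Wy h; have [ct ct'] := ctt' y Wy; split.
  rewrite big_map -[RHS](tlift_ext_map (@sect_ev _ _ W x0 y) u (@actk_bal k V)).
  rewrite /u act_nat // ext_map_extp /actk.
  by congr (tlift _ (act Pi _ _)); apply/funext => j; rewrite pE.
move=> q; have [g gE] := @sect_germ_lr _ _ W x0 y Wy.
(* Base change along germs at y followed by expansion along t. For j > 0 it sends the coefficient
   D_j t' of the family to the series with coefficients C(i+j, j) D_(i+j) t' at y, the j-th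
   coefficient of the recentred r_y. *)
pose e : {lrmorphism sect W x0 -> pseries k} := sval phi \o g.
rewrite big_map; under [RHS]eq_bigr => p _ do rewrite -gE.
rewrite -[RHS](tlift_ext_map e u (@actz_bal k V q)) /u act_nat // ext_map_extp /actz.
congr (tlift _ (act Pi _ _)); apply/funext => j; apply/funext => i.
rewrite [RHS](_ : _ = expand phi (g (rho j)) i) // gE.
rewrite /ps_recenter; have [->|j0] := eqVneq j 0%N.
  rewrite (_ : \val (rho 0%N) = fun=> 0) //.
  by rewrite germC scale0r (_ : expand phi 0 = 0) //; exact: raddf0.
rewrite (_ : germ y _ = germ y (dpderiv t j t')); last first.
  apply/esym/germ_near; first by apply: dpderiv_reg => //; case: ct'.
  exact: rfE.
rewrite -Der_germ //; last by case: ct'.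
rewrite expand_Der //; congr (_ *+ _).
rewrite expandB expandC ps_coefD ps_coefN ps_coefC ifF ?subr0 //.
by rewrite addn_eq0 (negbTE j0) andbF.
Qed.

End CoordinateChange.

(** * Germs of the sheaf in a trivialization *)

Section Trivialization.
Variables (k : closedFieldType) (C : curve k) (V : lmodType k) (Pi : autO_rep V).
Implicit Types (x y : pt C) (U W : set (pt C)) (f g t : pt C -> k).

Notation vst := (vstalk Pi).

Lemma coord_at_coordinate x t : coord_at x t -> exists U, nbhd x U /\ coordinate U t.
Proof.
move=> /coord_at_near[U Ux H]; exists U; split=> //.
by split=> [y /H[]|y /H[_ [_ uy]] u /uy].
Qed.

Lemma coordinate_sub U W t : W `<=` U -> coordinate U t -> coordinate W t.
Proof. by move=> WU [rt ut]; split=> [y /WU|y /WU]; [exact: rt|exact: ut]. Qed.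

Lemma trivE t a f y (phi : fcoord y) :
  triv Pi t a f (autpt phi) = f y *: actk Pi (expand phi (local_par y t)) a.
Proof. by rewrite expandB expandC. Qed.

Lemma triv_self t a f y (phi : fcoord y) : fc_of t phi ->
  triv Pi t a f (autpt phi) = f y *: a.
Proof. by move=> h; rewrite trivE expand_par // actk_psX. Qed.

(** Equivariance is the composition law of [Pi]. In a second coordinate t', the vectors Pi(r_y) a
    form a finite sum with regular coefficients by [act_family], where r_y now expands t along
    t'. *)
Lemma triv_vsec U t a f : coordinate U t -> regular_on U f ->
  vsec Pi U (triv Pi t a f).
Proof.
move=> ct rf; split=> [y Uy phi phi' r hr h|W t' oW WU ct' x Wx].
  have uy := coordinate_unif ct Uy.
  by rewrite !trivE actkZ // -actk_comp ?h //; exact: par_aut.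
exists setT; first exact: nbhdT.
have [|s [rs sE]] := @act_family _ C V Pi W t' t a oW.
  by move=> y Wy; split; [exact: coordinate_at ct' Wy|exact: coordinate_at ct (WU y Wy)].
exists (size s), (fun i => (tnth (in_tuple s) i).1), (fun i y => f y * (tnth (in_tuple s) i).2 y).
split=> [i y [Wy _]|y [Wy _] phi h].
  apply: regular_mul; first exact/rf/WU.
  by apply: (rs (tnth (in_tuple s) i)) => //; exact: mem_tnth.
rewrite trivE (proj1 (sE y phi Wy h)) big_tnth scaler_sumr.
by apply: eq_bigr => i _; rewrite scalerA.
Qed.

(* By equivariance, sections are determined by their values at the formal
   coordinate t - t(y). *)
Lemma vgerm_eq_triv x t U s s' : coord_at x t -> nbhd x U -> vsec Pi U s -> vsec Pi U s' ->
  near x (fun y => forall phi : fcoord y, fc_of t phi -> s (autpt phi) = s' (autpt phi)) ->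
  vgerm Pi x s = vgerm Pi x s'.
Proof.
move=> ct Ux hs hs' E; apply/(vgerm_eq Ux hs hs').
have [W Wx H] := nearI (near_nbhd (proj1 Ux) (proj2 Ux)) (nearI E (coord_at_near ct)).
exists W => // y /H[Uy [Ey cy]] phi; have uy := proj2 cy.
have [phit h] := fc_of_ex uy.
have A : fc_act phi (expand phi (local_par y t)) phit by move=> u; exact: expand_comp.
have hr := par_aut phi uy.
by rewrite -(proj1 hs y Uy _ _ _ hr A) -(proj1 hs' y Uy _ _ _ hr A) Ey.
Qed.

Definition tgerm t x (a : V) : vst x := vgerm Pi x (triv Pi t a (fun=> 1)).

Lemma vgerm_triv x t a f : coord_at x t -> regular_at x f ->
  vgerm Pi x (triv Pi t a f) = germ x f *: tgerm t x a.
Proof.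
move=> ct rf; have [U [Ux cU]] := coord_at_coordinate ct.
have [W Wx rW] := regular_near rf.
have cUW : coordinate (U `&` W) t by apply: coordinate_sub cU; exact: subIsetl.
rewrite /tgerm -(@vgermZ _ _ _ Pi x (U `&` W)).
- congr (vgerm Pi x _); apply/funext => -[y phi].
  by rewrite /fscale [LHS]trivE [in RHS]trivE scale1r.
- exact: nbhdI.
- by move=> y [_]; exact: rW.
by apply: triv_vsec => // y _; exact: regular_cst.
Qed.

Lemma vsec_tgerm x t U a : coordinate U t -> vsec Pi U (triv Pi t a (fun=> 1)).
Proof. by move=> ct; apply: triv_vsec => // y _; exact: regular_cst. Qed.

Lemma tgerm_lin x t c a b : coord_at x t -> tgerm t x (c *: a + b) = c%:A *: tgerm t x a + tgerm t x b.
Proof.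
move=> ct; have [U [Ux cU]] := coord_at_coordinate ct.
have rc (c0 : k) : regular_on U (fun=> c0) by move=> y _; exact: regular_cst.
rewrite -germC -(vgerm_triv a ct (regular_cst x c)).
rewrite /tgerm -(@vgermD _ _ _ Pi x U) //; [|exact: triv_vsec..].
apply: (@vgerm_eq_triv x t U) => //; [exact: triv_vsec| |].
  by apply: vsecD; exact: triv_vsec.
apply: nearT => y phi h.
rewrite [RHS](_ : _ = triv Pi t a (fun=> c) (autpt phi) +
   triv Pi t b (fun=> 1) (autpt phi)) //.
by rewrite !triv_self // !scale1r.
Qed.

(** Lifts a combination of germs to a single section, so that identities between germs can be tested
    on values at nearby points. *)
Lemma vgerm_comb x t U (s : seq (V * (pt C -> k))) : nbhd x U -> coordinate U t ->
  (forall p, p \in s -> regular_on U p.2) ->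
  exists2 S, vsec Pi U S & [/\ vgerm Pi x S = \sum_(p <- s) germ x p.2 *: tgerm t x p.1,
    forall y (phi : fcoord y), S (autpt phi) =
      \sum_(p <- s) p.2 y *: actk Pi (expand phi (local_par y t)) p.1 &
    forall y (phi : fcoord y), fc_of t phi -> S (autpt phi) = \sum_(p <- s) p.2 y *: p.1].
Proof.
move=> Ux cU; have ct := coordinate_at cU (proj2 Ux).
elim: s => [|p s IH] rs.
  exists 0; first exact: vsec0.
  split; [|by move=> y phi; rewrite big_nil|by move=> y phi _; rewrite big_nil].
  have /esym := vgermD Ux (vsec0 Pi U) (vsec0 Pi U).
  by rewrite addr0 -[RHS]addr0 big_nil => /addrI.
have [|S hS [SE SE' SE'']] := IH.
  by move=> q qs; apply: rs; rewrite inE qs orbT.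
have rp : regular_on U p.2 by apply: rs; rewrite mem_head.
have hp := @triv_vsec U t p.1 p.2 cU rp.
exists (triv Pi t p.1 p.2 + S); first exact: vsecD.
split.
- rewrite (vgermD Ux) // SE big_cons vgerm_triv //; exact: rp (proj2 Ux).
- by move=> y phi; rewrite big_cons -(SE' y phi) -trivE.
- by move=> y phi h; rewrite big_cons -(SE'' y phi h) -(triv_self _ _ h).
Qed.

Lemma regular_common x (s : seq (V * (pt C -> k))) U : nbhd x U ->
  (forall p, p \in s -> regular_at x p.2) ->
  exists W, [/\ nbhd x W, W `<=` U & forall p, p \in s -> regular_on W p.2].
Proof.
move=> Ux rs; have : near x (fun y => U y /\ forall p, p \in s -> regular_at y p.2).
  apply: nearI; first by exists U.
  by apply: near_seq => p /rs; exact: regular_nearE.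
move=> [W Wx H]; exists W; split=> // [y /H[]|p ps y /H[_]] //; exact.
Qed.

Lemma tgerm_span x t (e : vst x) : coord_at x t ->
  exists s : seq (V * (pt C -> k)), (forall p, p \in s -> regular_at x p.2) /\
    e = \sum_(p <- s) germ x p.2 *: tgerm t x p.1.
Proof.
move=> ct; have [U [Ux cU]] := coord_at_coordinate ct.
elim/vstalk_ind: e => sg; have /asboolP[W Wx hs] := valP sg.
have WUx := nbhdI Wx Ux.
have [|W' W'x [m [a [f [rf sE]]]]] := proj2 hs (W `&` U) t (proj1 WUx) (@subIsetl _ _ _) _ x (proj2 WUx).
  by apply: coordinate_sub cU; exact: subIsetr.
pose s := [seq (a i, f i) | i <- enum 'I_m].
have W3x := nbhdI WUx W'x.
have cW3 : coordinate (W `&` U `&` W') t.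
  by apply: coordinate_sub cU => y [[_]].
have rs p : p \in s -> regular_on (W `&` U `&` W') p.2 by move=> /mapP[i _ ->]; exact: rf.
exists s; split; first by move=> p /rs; apply; case: W3x.
have [S hS [<- _ SE]] := vgerm_comb W3x cW3 rs.
rewrite -vgerm_val; apply: (vgerm_eq_triv ct W3x) => //.
  by apply: vsec_sub hs => y [[]].
apply: nearS (near_nbhd (proj1 W3x) (proj2 W3x)) => y Wy phi h.
by rewrite sE // SE // big_map big_enum.
Qed.

(** The zero germ is that of the empty combination [S0], so the two sections have equal values near
    x, which are read off at the formal coordinate t - t(y). *)
Lemma tgerm_indep x t (s : seq (V * (pt C -> k))) : coord_at x t ->
  (forall p, p \in s -> regular_at x p.2) ->
  \sum_(p <- s) germ x p.2 *: tgerm t x p.1 = 0 ->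
  near x (fun y => \sum_(p <- s) p.2 y *: p.1 = 0).
Proof.
move=> ct rs E; have [U [Ux cU]] := coord_at_coordinate ct.
have [W [Wx WU rW]] := regular_common Ux rs.
have cW := coordinate_sub WU cU.
have [S hS [SE _ SE']] := vgerm_comb Wx cW rW.
have [//|S0 hS0 [S0E _ S0E']] := @vgerm_comb x t W [::] Wx cW.
have : vgerm Pi x S = vgerm Pi x S0 by rewrite SE E S0E big_nil.
move=> /(vgerm_eq Wx hS hS0) [W' W'x H].
have : near x W' by exists W'.
move=> /nearI/(_ (coord_at_near ct)); apply: nearS => y [W'y [_ uy]].
have [phi h] := fc_of_ex uy.
by rewrite -(SE' y phi h) H // S0E' // big_nil.
Qed.

Definition kbalanced (A : lmodType k) (Z : zmodType) (b : V -> A -> Z) : Prop :=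
  [/\ forall a a' u, b (a + a') u = b a u + b a' u,
      forall a u u', b a (u + u') = b a u + b a u' &
      forall c a u, b (c *: a) u = b a (c *: u)].

(* V (x) O_x -> E_x is bijective: a relation sum f_i a_i = 0 either has all
   f_i = 0, or one a_i can be eliminated using a linear relation. *)
Lemma tgerm_lift x t (Z : zmodType) (b : V -> lring x -> Z) : coord_at x t ->
  kbalanced b ->
  exists L : vst x -> Z, (forall e e', L (e + e') = L e + L e') /\
    forall a u, L (u *: tgerm t x a) = b a u.
Proof.
move=> ct [bD bD' bZ].
have b0 a : b a 0 = 0 by apply: (addrI (b a 0)); rewrite -bD' !addr0.
have key n (a : 'I_n -> V) (f : 'I_n -> pt C -> k) : (forall i, regular_at x (f i)) ->
    near x (fun y => \sum_i f i y *: a i = 0) -> \sum_i b (a i) (germ x (f i)) = 0.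
  elim: n a f => [|n IH] a f rf E; first by rewrite big_ord0.
  have [[c [i ci] cE]|ind] := pselect (exists2 c : 'I_n.+1 -> k, exists i, c i != 0 &
      \sum_i c i *: a i = 0); last first.
    rewrite big1 // => i _; rewrite (_ : germ x (f i) = 0) //.
    rewrite -(scale0r 1) -germC; apply: germ_near => //.
    apply: nearS E => y E; apply/eqP/negPn/negP => fi.
    by case: ind; exists (fun i => f i y) => //; exists i.
  pose d j := - (c i)^-1 * c (lift i j).
  have aE : a i = \sum_j d j *: a (lift i j).
    have := cE; rewrite (bigD1_ord i) //= => /eqP; rewrite addr_eq0 => /eqP /(congr1 (fun v => (c i)^-1 *: v)).
    rewrite scalerA mulVf // scale1r => ->; rewrite scalerN -scaleNr scaler_sumr.
    by apply: eq_bigr => j _; rewrite scalerA.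
  have rg j : regular_at x (fun y => f (lift i j) y + d j * f i y).
    by apply: regular_add => //; apply: regular_mul => //; exact: regular_cst.
  have E1 : near x (fun y => \sum_j (f (lift i j) y + d j * f i y) *: a (lift i j) = 0).
    apply: nearS E => y; rewrite (bigD1_ord i) //= aE scaler_sumr -big_split /= => E.
    rewrite -[RHS]E; apply: eq_bigr => j _.
    by rewrite scalerDl scalerA mulrC addrC.
  rewrite (bigD1_ord i) //= -[RHS](IH _ _ rg E1).
  have bs (F : 'I_n -> V) u : b (\sum_j F j) u = \sum_j b (F j) u.
    have bl0 : b 0 u = 0 by apply: (addrI (b 0 u)); rewrite -bD !addr0.
    by rewrite (big_morph (b^~ u) (fun a a' => bD a a' u) bl0).
  rewrite aE bs -big_split; apply: eq_bigr => j _ /=.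
  rewrite bZ -bD' addrC; congr (b _ _).
  have rc := regular_cst x (d j); rewrite -[fun y => _]/(f (lift i j) + (fun=> d j) * f i).
  by rewrite (germD (rf _) (regularM rc (rf i))) (germM rc (rf i)) germC -scalerAl mul1r.
(* The value is computed on a chosen representation of the germ; [key2] shows that the choice does
   not matter. *)
exists (fun e => let s := sval (cid (tgerm_span e ct)) in \sum_(p <- s) b p.1 (germ x p.2)).
have keys (s : seq (V * (pt C -> k))) : (forall p, p \in s -> regular_at x p.2) ->
    \sum_(p <- s) germ x p.2 *: tgerm t x p.1 = 0 -> \sum_(p <- s) b p.1 (germ x p.2) = 0.
  move=> rs /(tgerm_indep ct rs) E; rewrite big_tnth.
  apply: (key _ (fun i => (tnth (in_tuple s) i).1) (fun i => (tnth (in_tuple s) i).2)).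
    by move=> i; apply: rs; exact: mem_tnth.
  by apply: nearS E => y; rewrite big_tnth.
have regN f : regular_at x f -> regular_at x (fun y => - f y).
  move=> rf; rewrite (_ : (fun _ => _) = fun y => -1 * f y).
    by apply: regular_mul => //; exact: regular_cst.
  by apply/funext => y; rewrite mulN1r.
have germN f : regular_at x f -> germ x (fun y => - f y) = - germ x f.
  move=> rf; apply/eqP; rewrite -addr_eq0 -germD //; last exact: regN.
  apply/eqP; rewrite -(scale0r 1) -germC; congr (germ x _).
  by apply/funext => y; rewrite [LHS]addNr.
have key2 (s s' : seq (V * (pt C -> k))) : (forall p, p \in s -> regular_at x p.2) ->
    (forall p, p \in s' -> regular_at x p.2) ->
    \sum_(p <- s) germ x p.2 *: tgerm t x p.1 = \sum_(p <- s') germ x p.2 *: tgerm t x p.1 ->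
    \sum_(p <- s) b p.1 (germ x p.2) = \sum_(p <- s') b p.1 (germ x p.2).
  move=> rs rs' E; pose s1 := [seq (p.1, (fun y => - p.2 y)) | p <- s'].
  have N1 : \sum_(p <- s1) germ x p.2 *: tgerm t x p.1 = - \sum_(p <- s') germ x p.2 *: tgerm t x p.1.
    rewrite big_map -sumrN big_seq [RHS]big_seq.
    by apply: eq_bigr => p /rs' rp; rewrite germN // scaleNr.
  have N2 : \sum_(p <- s1) b p.1 (germ x p.2) = - \sum_(p <- s') b p.1 (germ x p.2).
    rewrite big_map -sumrN big_seq [RHS]big_seq.
    apply: eq_bigr => p /rs' rp; rewrite germN //; apply/eqP.
    by rewrite -addr_eq0 -bD' addNr b0.
  have := @keys (s ++ s1); rewrite !big_cat /= N1 N2 E subrr => K.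
  apply/eqP; rewrite -subr_eq0; apply/eqP/K => // p.
  by rewrite mem_cat => /orP[/rs//|/mapP[q /rs' rq ->]]; exact: regN.
split=> [e e'|a u] /=.
  case: cid => s [rs sE]; case: cid => s1 [rs1 s1E]; case: cid => s2 [rs2 s2E] /=.
  rewrite -big_cat; apply: key2 => //; last by rewrite big_cat -sE /= -s1E -s2E.
  by move=> p; rewrite mem_cat => /orP[/rs1|/rs2].
case: cid => s [rs sE] /=; have [f rf uE] := germP u.
rewrite (key2 s [:: (a, f)]) ?big_seq1 ?uE // -?sE ?uE //.
by move=> p; rewrite inE => /eqP->.
Qed.

End Trivialization.

(** * The connection on stalks *)

Lemma sum_ord_trunc (M : nmodType) m n (F : nat -> M) : (m <= n)%N ->
  (forall i, (m <= i)%N -> F i = 0) -> \sum_(i < n) F i = \sum_(i < m) F i.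
Proof.
move=> mn F0; rewrite (big_ord_widen n F mn) [RHS]big_mkcond.
by apply: eq_bigr => i _; case: ltnP => // /F0.
Qed.

(** Both sides run over the pairs (i, l) with i + l <= q, once by rows and once by antidiagonals. *)
Lemma tri_sum (M : nmodType) q (g : nat -> nat -> M) :
  \sum_(i < q.+1) \sum_(l < (q - i).+1) g i l = \sum_(m < q.+1) \sum_(l < m.+1) g (m - l)%N l.
Proof.
elim: q => [|q IH]; first by rewrite !big_ord1.
rewrite [RHS]big_ord_recr -IH big_ord_recr /= subnn big_ord1.
rewrite [X in _ + X = _](_ : _ = g q.+1 0%N) //.
have -> : \sum_(l < q.+2) g (q.+1 - l)%N l = \sum_(i < q.+2) g i (q.+1 - i)%N.
  rewrite (reindex_inj rev_ord_inj) /=; apply: eq_bigr => i _.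
  by rewrite subSS subKn // -ltnS ltn_ord.
rewrite [X in _ = _ + X]big_ord_recr /= subnn addrA; congr (_ + _).
rewrite -big_split; apply: eq_bigr => i _ /=.
by rewrite subSn -1?ltnS // big_ord_recr.
Qed.

(** * Divided powers of the translation operator *)

Section Translation.
Variables (k : comNzRingType) (V : vertex_algebra k).

Lemma transl_lin i c (a b : V) : transl i (c *: a + b) = c *: transl i a + transl i b.
Proof. exact: nprod_linl. Qed.
Lemma translD i (a b : V) : transl i (a + b) = transl i a + transl i b.
Proof. by rewrite -[a]scale1r transl_lin !scale1r. Qed.
Lemma transl_zero i : transl i (0 : V) = 0.
Proof. by apply: (addrI (transl i 0)); rewrite -translD !addr0. Qed.
Lemma translZ i c (a : V) : transl i (c *: a) = c *: transl i a.
Proof. by rewrite -[c *: a]addr0 transl_lin transl_zero addr0. Qed.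
Lemma transl_sum i I (s : seq I) (F : I -> V) :
  transl i (\sum_(j <- s) F j) = \sum_(j <- s) transl i (F j).
Proof. by rewrite (big_morph _ (translD i) (transl_zero i)). Qed.

Lemma transl0 (a : V) : transl 0 a = a.
Proof. exact: nprod_vacr. Qed.

Lemma nprod_zeror (a : V) n : nprod a n 0 = 0.
Proof.
have := nprod_linr n a 1 0 0; rewrite scaler0 addr0 scale1r => E.
by apply: (addrI (nprod a n 0)); rewrite -E addr0.
Qed.

(** Associativity with b = c = 1, r = -1-l and s = -1-i. The terms containing a_(j) 1 with j >= 0
    vanish, and 1_(s+j) 1 is nonzero only for j = i. The remaining coefficient is (-1)^i times the
    binomial of -1-l over i, that is C(i+l, i). *)
Lemma transl_comp i l (a : V) : transl i (transl l a) = transl (i + l) a *+ 'C(i + l, i).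
Proof.
have [N] := nprod_assoc a (vac V) (vac V) (Negz l) (Negz i).
move=> /(_ (N + i.+1)%N (leq_addr _ _)); rewrite -[RHS]/(transl i (transl l a)) => <-.
have lt : (i < N + i.+1)%N by rewrite addnS ltnS leq_addl.
rewrite (bigD1 (Ordinal lt)) //= [X in _ + X]big1 ?addr0 => [|j ji].
  rewrite nprod_vacr0 nprod_zeror mul0rz subr0 nprod_vacl.
  rewrite (_ : (Negz i + i%:Z == -1) = true); last first.
    by rewrite NegzE -addn1 PoszD opprD addrAC addNr add0r.
  rewrite (_ : Negz l - i%:Z = Negz (i + l)); last first.
    by rewrite !NegzE -opprD -PoszD addSn addnC.
  by rewrite mulrA -exprD addnn -mul2n exprM sqrrN expr1n mul1r addnC.
rewrite nprod_vacr0 nprod_zeror mul0rz subr0 nprod_vacl.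
rewrite (_ : (Negz i + j%:Z == -1) = false) ?nprod_zeror ?mul0rz //.
apply/negP => /eqP E; case/eqP: ji; apply: val_inj => /=.
apply/eqP; rewrite -eqz_nat; apply/eqP.
rewrite -[LHS](addKr (Negz i)) E NegzE -addn1 PoszD; ring.
Qed.

(** The identity e^(zT) e^(-zT) = 1 on generating series: by [transl_comp] the total coefficient of
    T_m is (1 - 1)^m. *)
Lemma transl_exp_inverse (Z B : nat -> V) :
  (forall n, Z n = \sum_(i < n.+1) (-1) ^+ i *: transl i (B (n - i)%N)) ->
  forall q, \sum_(i < q.+1) transl i (Z (q - i)%N) = B q.
Proof.
move=> ZE q; pose g i l := (-1) ^+ l *: transl i (transl l (B (q - i - l)%N)).
transitivity (\sum_(i < q.+1) \sum_(l < (q - i).+1) g i l).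
  apply: eq_bigr => i _; rewrite ZE transl_sum; apply: eq_bigr => l _.
  by rewrite translZ.
rewrite tri_sum big_ord_recl big_ord1 /g !transl0 expr0 scale1r !subn0 big1 ?addr0 //.
move=> m _; set m1 := lift _ _.
transitivity ((\sum_(l < m1.+1) (1 ^+ (m1 - l) * (-1) ^+ l) *+ 'C(m1, l)) *:
   transl m1 (B (q - m1)%N)).
  rewrite scaler_suml; apply: eq_bigr => l _.
  have lm : (l <= m1)%N by rewrite -ltnS ltn_ord.
  rewrite transl_comp subnK // expr1n mul1r -scalerMnr -scalerMnl -subnDA subnK //.
  by rewrite -[in RHS]bin_sub.
by rewrite -exprDn subrr expr0n /= scale0r.
Qed.

End Translation.

Lemma alg_exp (R : comNzRingType) (A : comAlgType R) (c : R) m :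
  (c%:A : A) ^+ m = (c ^+ m)%:A.
Proof. by elim: m => [|m IH]; rewrite ?scale1r // !exprS IH -scalerAl mul1r scalerA. Qed.

Section GermSums.
Variables (k : closedFieldType) (X : projset k).
Implicit Types (x y : pt X) (f g : pt X -> k).

Lemma regular_exp x f m : regular_at x f -> regular_at x (fun y => f y ^+ m).
Proof.
move=> rf; elim: m => [|m IH]; first exact: regular_cst.
by apply: (regular_eq _ (regular_mul rf IH)); apply: nearT => y; rewrite exprS.
Qed.

Lemma germ_exp x f m : regular_at x f -> germ x (fun y => f y ^+ m) = germ x f ^+ m.
Proof.
move=> rf; elim: m => [|m IH]; first exact: germ_cst1.
rewrite exprS -IH -germM //; last exact: regular_exp.
by congr (germ x _); apply/funext => y; rewrite exprS.
Qed.

Lemma germ_sum x (I : eqType) (s : seq I) (F : I -> pt X -> k) :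
  (forall i, i \in s -> regular_at x (F i)) ->
  germ x (fun y => \sum_(i <- s) F i y) = \sum_(i <- s) germ x (F i).
Proof.
elim: s => [|i s IH] H.
  rewrite big_nil -(scale0r 1) -germC; congr (germ x _).
  by apply/funext => y; rewrite big_nil.
have Hs j : j \in s -> regular_at x (F j) by move=> js; apply: H; rewrite inE js orbT.
rewrite big_cons -IH // -germD; last by apply: regular_sum => j /Hs.
  by congr (germ x _); apply/funext => y; rewrite big_cons.
by apply: H; rewrite mem_head.
Qed.

Lemma regular_muln x f m : regular_at x f -> regular_at x (fun y => f y *+ m).
Proof.
move=> rf; apply: (regular_eq _ (regular_mul rf (regular_cst x m%:R))).
by apply: nearT => y; rewrite mulr_natr.
Qed.

Lemma germ_muln x f m : regular_at x f -> germ x (fun y => f y *+ m) = germ x f *+ m.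
Proof.
move=> rf; have rc := regular_cst x (m%:R : k).
rewrite -mulr_natr -[m%:R in RHS]scaler_nat.
transitivity (germ x (f * (fun=> m%:R))).
  congr (germ x _); apply/funext => y; exact: (esym (mulr_natr (f y) m)).
by rewrite germM // germC.
Qed.

End GermSums.

(** * The connection in one coordinate and its independence of the coordinate *)

Section Theta.
Variables (k : closedFieldType) (C : curve k) (V : vertex_algebra k) (G : grading V)
  (Pi : autO_action G).
Implicit Types (x y : pt C) (U W : set (pt C)) (f g t : pt C -> k).

Notation vst := (vstalk Pi).

Lemma EPpDl x n (e e' : vst x) (p : pparts (lring x) n) :
  EPp (e + e') p = EPp e p + EPp e' p.
Proof. by have [D _ _] := pure_balanced (@mod_ra _ _ (vst x)) (@pp_la _ (lring x) n); exact: D. Qed.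
Lemma EPpDr x n (e : vst x) (p p' : pparts (lring x) n) :
  EPp e (p + p') = EPp e p + EPp e p'.
Proof. by have [_ D _] := pure_balanced (@mod_ra _ _ (vst x)) (@pp_la _ (lring x) n); exact: D. Qed.
Lemma EPpZ x n u (e : vst x) (p : pparts (lring x) n) :
  EPp (u *: e) p = EPp e (d0 n u * p).
Proof. by have [_ _ D] := pure_balanced (@mod_ra _ _ (vst x)) (@pp_la _ (lring x) n); exact: D. Qed.
Lemma EPp0r x n (e : vst x) : EPp e (0 : pparts (lring x) n) = 0.
Proof. by apply: (addrI (EPp e 0)); rewrite -EPpDr !addr0. Qed.
Lemma EPp0l x n (p : pparts (lring x) n) : EPp (0 : vst x) p = 0.
Proof. by apply: (addrI (EPp 0 p)); rewrite -EPpDl !addr0. Qed.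
Lemma EPp_sumr x n (e : vst x) I (s : seq I) (P : pred I) (F : I -> pparts (lring x) n) :
  EPp e (\sum_(i <- s | P i) F i) = \sum_(i <- s | P i) EPp e (F i).
Proof. by rewrite (big_morph _ (EPpDr e) (EPp0r _ e)). Qed.
Lemma EPp_suml x n (p : pparts (lring x) n) I (s : seq I) (P : pred I) (F : I -> vst x) :
  EPp (\sum_(i <- s | P i) F i) p = \sum_(i <- s | P i) EPp (F i) p.
Proof. by rewrite (big_morph _ (fun e e' => EPpDl e e' p) (EPp0l p)). Qed.

Lemma EP_ra_bal x n (a : lring x) : balanced (@mod_ra _ _ (vst x)) (@pp_la _ (lring x) n)
  (fun e p => EPp e (p * d1 n a)).
Proof.
split=> [e e' p|e p p'|e u p]; first exact: EPpDl.
  by rewrite mulrDl EPpDr.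
by rewrite [LHS]EPpZ mulrA.
Qed.

Lemma EP_raE x n (e : vst x) (p : pparts (lring x) n) a :
  EP_ra (EPp e p) a = EPp e (p * d1 n a).
Proof. exact: (tlift_pure _ _ (EP_ra_bal n a)). Qed.

Lemma EP_raD x n (a : lring x) : {morph (fun u : EP (vst x) n => EP_ra u a) : u v / u + v}.
Proof. exact: (tliftD (EP_ra_bal n a)). Qed.

Definition theta t x n (a : V) (u : lring x) : EP (vst x) n :=
  \sum_(i < n.+1) EPp (tgerm Pi t x (transl i a)) (delta n (germ x t) ^+ i * d1 n u).

Definition is_theta t x n (L : vst x -> EP (vst x) n) : Prop :=
  (forall e e', L (e + e') = L e + L e') /\
  forall a u, L (u *: tgerm Pi t x a) = theta t n a u.

Lemma tgermD x t a b : coord_at x t -> tgerm Pi t x (a + b) = tgerm Pi t x a + tgerm Pi t x b.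
Proof. by move=> ct; rewrite -[a in LHS]scale1r tgerm_lin // !scale1r. Qed.
Lemma tgerm0 x t : coord_at x t -> tgerm Pi t x 0 = 0.
Proof. by move=> ct; apply: (addrI (tgerm Pi t x 0)); rewrite -tgermD // !addr0. Qed.
Lemma tgermZ x t c a : coord_at x t -> tgerm Pi t x (c *: a) = c%:A *: tgerm Pi t x a.
Proof. by move=> ct; rewrite -[c *: a]addr0 tgerm_lin // tgerm0 // addr0. Qed.

(** The formula is balanced over [k] because d_0 and d_1 agree on constants; [tgerm_lift] then
    extends it to the stalk. *)
Lemma theta_ex x t n : coord_at x t -> exists L, @is_theta t x n L.
Proof.
move=> ct; apply: (@tgerm_lift _ _ _ Pi x t _ (theta t n) ct); split=> [a a' u|a u u'|c a u]; rewrite /theta.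
- rewrite -big_split; apply: eq_bigr => i _.
  by rewrite translD tgermD // EPpDl.
- by rewrite -big_split; apply: eq_bigr => i _; rewrite d1D mulrDr EPpDr.
apply: eq_bigr => i _; rewrite translZ tgermZ // EPpZ.
have -> : c *: u = c%:A * u by rewrite -scalerAl mul1r.
by rewrite d1M d0_alg mulrCA.
Qed.

Lemma theta_lin x t n L : coord_at x t -> @is_theta t x n L ->
  forall u e, L (u *: e) = EP_ra (L e) u.
Proof.
move=> ct [LD LE] u e.
have L0 : L 0 = 0 by apply: (addrI (L 0)); rewrite -LD !addr0.
have R0 : EP_ra (0 : EP (vst x) n) u = 0.
  by apply: (addrI (EP_ra 0 u)); rewrite -EP_raD !addr0.
have [s [_ ->]] := tgerm_span e ct.
rewrite scaler_sumr !(big_morph _ LD L0) (big_morph _ (@EP_raD x n u) R0).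
apply: eq_bigr => p _; rewrite scalerA !LE /theta (big_morph _ (@EP_raD x n u) R0).
by apply: eq_bigr => i _; rewrite EP_raE d1M -mulrA [d1 n u * _]mulrC.
Qed.

(** The coefficient (r_y^i)_q as a function of y. The binomial expansion of (t' - t'(y))^i separates
    the function t' from its value at y, which makes regularity in y evident. *)
Definition transition_coef t t' i q y : k :=
  \sum_(m < i.+1) (dpderiv t q (fun z => t' z ^+ (i - m)) y * (- t' y) ^+ m) *+ 'C(i, m).

Lemma transition_coefE t t' i q y (phi : fcoord y) : coord_at y t -> regular_at y t' -> fc_of t phi ->
  transition_coef t t' i q y = (expand phi (local_par y t') ^+ i) q.
Proof.
move=> ct rt' h; rewrite expandB expandC -scaleNr exprDn ps_coef_sum.
apply: eq_bigr => m _; rewrite ps_coefMn mulrC alg_exp mulrC [in RHS]mulrC ps_coefZmul.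
by rewrite (germ_dpderiv _ _ ct h) germ_exp // expandX mulrC.
Qed.

Lemma transition_coef_regular x t t' i q : coord_at x t -> regular_at x t' -> regular_at x (transition_coef t t' i q).
Proof.
move=> ct rt'; apply: regular_sum => m _ _; apply: regular_muln; apply: regular_mul.
  by apply: dpderiv_reg => //; exact: regular_exp.
apply: regular_exp; apply: (regular_eq _ (regular_mul (regular_cst x (-1)) rt')).
by apply: nearT => y; rewrite mulN1r.
Qed.

(** The power of d_1 t' - d_0 t' is expanded by the binomial formula, and Taylor's formula along t
    is applied to each power of d_1 t'. *)
Lemma delta_exp x t t' n i : coord_at x t -> regular_at x t' ->
  delta n (germ x t') ^+ i =
  \sum_(q < n.+1) d0 n (germ x (transition_coef t t' i q)) * delta n (germ x t) ^+ q.
Proof.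
move=> ct rt'; rewrite /delta exprDn.
have rN : regular_at x (fun y => - t' y).
  apply: (regular_eq _ (regular_mul (regular_cst x (-1)) rt')).
  by apply: nearT => y; rewrite mulN1r.
have gN : germ x (fun y => - t' y) = - germ x t'.
  rewrite -mulN1r -[X in X * _]scaleN1r -germC -germM //; last exact: regular_cst.
  by congr (germ x _); apply/funext => y; rewrite [RHS]mulN1r.
have rd m q : regular_at x (dpderiv t q (fun z => t' z ^+ m)).
  by apply: dpderiv_reg => //; exact: regular_exp.
have cE q : germ x (transition_coef t t' i q) = \sum_(m < i.+1)
    (Der t (germ x t' ^+ (i - m)) q * (- germ x t') ^+ m) *+ 'C(i, m).
  rewrite germ_sum => [|m _]; last first.
    apply: regular_muln; apply: regular_mul; first exact: rd.
    exact: regular_exp.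
  apply: eq_bigr => m _; rewrite germ_muln; last first.
    by apply: regular_mul; [exact: rd|exact: regular_exp].
  rewrite -gN -!germ_exp // Der_germ //; last exact: regular_exp.
  by rewrite -germM //; exact: regular_exp.
transitivity (\sum_(m < i.+1) \sum_(q < n.+1) d0 n ((Der t (germ x t' ^+ (i - m)) q *
    (- germ x t') ^+ m) *+ 'C(i, m)) * delta n (germ x t) ^+ q).
  apply: eq_bigr => m _; rewrite -d1X -d0N -d0X (taylor_formula n ct) /taylor mulr_suml -sumrMnl.
  apply: eq_bigr => q _; by rewrite mulrAC -d0M d0Mn mulrnAl.
rewrite exchange_big; apply: eq_bigr => q _; rewrite cE -mulr_suml; congr (_ * _).
by rewrite d0_sum.
Qed.

(** Right linearity reduces the claim to u = 1. The generator of t' is rewritten in the generators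
    of t, and both sides are sorted by powers of delta t. *)
Lemma theta_change x t t' n L : coord_at x t -> coord_at x t' ->
  @is_theta t x n L -> is_theta t' L.
Proof.
move=> ct ct' HL; have [LD LE] := HL; split; first exact: LD.
move=> a u; rewrite (theta_lin ct HL).
suff -> : L (tgerm Pi t' x a) = theta t' n a 1.
  have R0 : EP_ra (0 : EP (vst x) n) u = 0.
    by apply: (addrI (EP_ra 0 u)); rewrite -EP_raD !addr0.
  rewrite /theta (big_morph _ (@EP_raD x n u) R0); apply: eq_bigr => i _.
  by rewrite EP_raE -mulrA d11 mul1r.
have [U [Ux cU]] := coord_at_coordinate ct.
have [U' [U'x cU']] := coord_at_coordinate ct'.
have UU'x := nbhdI Ux U'x.
have cUU : coordinate (U `&` U') t by apply: coordinate_sub cU; exact: subIsetl.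
have cUU' : coordinate (U `&` U') t' by apply: coordinate_sub cU'; exact: subIsetr.
have cc y : (U `&` U') y -> coord_at y t /\ coord_at y t'.
  by move=> Uy; split; [exact: coordinate_at cUU Uy|exact: coordinate_at cUU' Uy].
have [s [rs sE]] := act_family Pi a (proj1 UU'x) cc.
have [S hS [SE _ SE']] := vgerm_comb Pi UU'x cUU rs.
have ioE : tgerm Pi t' x a = \sum_(p <- s) germ x p.2 *: tgerm Pi t x p.1.
  rewrite -SE; apply: (vgerm_eq_triv ct UU'x) => //; first exact: vsec_tgerm.
  apply: nearS (near_nbhd (proj1 UU'x) (proj2 UU'x)) => y Uy phi h.
  by rewrite trivE scale1r SE' // (proj1 (sE y phi Uy h)).
set dl := delta n (germ x t).
(* The coefficients of (delta t)^q on the two sides. They are lifted to sections, [S1] in the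
   generators of t and [S2] in those of t', and evaluated at the formal coordinate t - t(y). There
   [sE] identifies the derivatives of the coefficient functions with [Z], to which the recentring
   formula applies. *)
have key q : \sum_(i < q.+1) \sum_(p <- s) Der t (germ x p.2) (q - i)%N *: tgerm Pi t x (transl i p.1) =
    \sum_(i < q.+1) germ x (transition_coef t t' i q) *: tgerm Pi t' x (transl i a).
  have rs0 p : p \in s -> regular_at x p.2 by move=> /rs; apply; case: UU'x.
  pose sL := [seq (transl i p.1, dpderiv t (q - i) p.2) | i <- index_iota 0 q.+1, p <- s].
  pose sR := [seq (transl i a, transition_coef t t' i q) | i <- index_iota 0 q.+1].
  have [|S1 hS1 [S1E _ S1v]] := @vgerm_comb _ _ _ Pi x t _ sL UU'x cUU.
    move=> _ /allpairsP[[i p] [_ /rs ps ->]] y Uy; apply: dpderiv_reg; first by case: (cc y Uy).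
    exact: ps.
  have [|S2 hS2 [S2E S2v _]] := @vgerm_comb _ _ _ Pi x t' _ sR UU'x cUU'.
    move=> _ /mapP[i _ ->] y Uy; apply: transition_coef_regular; first by case: (cc y Uy).
    by case: (cc y Uy) => _ [].
  transitivity (vgerm Pi x S1).
    rewrite S1E big_allpairs_dep big_mkord; apply: eq_bigr => i _.
    rewrite big_seq [RHS]big_seq; apply: eq_bigr => p /rs0 rp.
    by rewrite Der_germ.
  transitivity (vgerm Pi x S2); last by rewrite S2E big_map big_mkord.
  apply: (vgerm_eq_triv ct UU'x) => //.
  apply: nearS (near_nbhd (proj1 UU'x) (proj2 UU'x)) => y Uy phi h.
  have [cy cy'] := cc y Uy; have hr := par_aut phi (proj2 cy').
  rewrite S1v // S2v big_allpairs_dep big_map !big_mkord.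
  set r := expand phi (local_par y t') in hr *.
  pose Z n0 := actz Pi (ps_recenter r) n0 a.
  pose B n0 := \sum_(i < n0.+1) (r ^+ i) n0 *: actk Pi r (transl i a).
  have ZB n0 : Z n0 = \sum_(i < n0.+1) (-1) ^+ i *: transl i (B (n0 - i)%N).
    rewrite /Z aa_recenter //; apply: eq_bigr => i _; rewrite actk_sum //.
    by congr (_ *: transl _ _); apply: eq_bigr => m _; rewrite actkZ.
  transitivity (B q); last first.
    by apply: eq_bigr => i _; rewrite /= (transition_coefE _ _ cy (proj1 cy') h).
  rewrite -(transl_exp_inverse ZB q); apply: eq_bigr => i _.
  rewrite /Z (proj2 (sE y phi Uy h)) transl_sum; apply: eq_bigr => p _.
  by rewrite translZ /= (germ_dpderiv _ _ cy h).
(* The series r_y has no constant term, so its i-th power starts in degree i. This lets i run up to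
   n below, after which the two sums can be exchanged. *)
have cfun0 i q : (q < i)%N -> germ x (transition_coef t t' i q) = 0.
  move=> qi; rewrite -(scale0r 1) -germC; apply: germ_near.
    by apply: transition_coef_regular => //; case: ct'.
  apply: nearS (near_nbhd (proj1 UU'x) (proj2 UU'x)) => y Uy.
  have [cy cy'] := cc y Uy; have [phi h] := fc_of_ex (proj2 cy).
  rewrite (transition_coefE _ _ cy (proj1 cy') h) ps_exp_low //.
  by rewrite expand_coef0 gval_local_par //; case: cy'.
have L0 : L 0 = 0 by apply: (addrI (L 0)); rewrite -LD !addr0.
pose g j i := \sum_(p <- s) EPp (Der t (germ x p.2) j *: tgerm Pi t x (transl i p.1)) (dl ^+ (j + i)).
transitivity (\sum_(j < n.+1) \sum_(i < (n - j).+1) g j i).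
  rewrite ioE (big_morph _ LD L0).
  transitivity (\sum_(p <- s) \sum_(j < n.+1) \sum_(i < n.+1)
     EPp (Der t (germ x p.2) j *: tgerm Pi t x (transl i p.1)) (dl ^+ (j + i))).
    apply: eq_bigr => p _; rewrite LE /theta exchange_big; apply: eq_bigr => i _.
    rewrite (taylor_formula n ct) /taylor mulr_sumr EPp_sumr; apply: eq_bigr => j _.
    by rewrite EPpZ exprD [dl ^+ j * _]mulrC mulrCA.
  rewrite exchange_big; apply: eq_bigr => j _; rewrite exchange_big /=.
  apply: (@sum_ord_trunc _ _ _ (g j)) => [|i ji]; first by rewrite ltnS leq_subr.
  rewrite /g big1 // => p _; rewrite /dl delta_nilp ?EPp0r //.
  by rewrite -ltn_subLR // -ltnS ltn_ord.
rewrite tri_sum.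
transitivity (\sum_(q < n.+1) EPp (\sum_(i < q.+1) germ x (transition_coef t t' i q) *:
    tgerm Pi t' x (transl i a)) (dl ^+ q)).
  apply: eq_bigr => q _; rewrite -key EPp_suml; apply: eq_bigr => i _.
  by rewrite EPp_suml; apply: eq_bigr => p _; rewrite subnK // -ltnS ltn_ord.
transitivity (\sum_(q < n.+1) \sum_(i < n.+1) EPp (germ x (transition_coef t t' i q) *:
    tgerm Pi t' x (transl i a)) (dl ^+ q)).
  apply: eq_bigr => q _; rewrite EPp_suml; apply/esym.
  apply: (@sum_ord_trunc _ _ _ (fun i => EPp (germ x (transition_coef t t' i q) *:
    tgerm Pi t' x (transl i a)) (dl ^+ q))) => [|i qi]; first exact: ltn_ord.
  by rewrite cfun0 // scale0r EPp0l.
rewrite exchange_big; apply: eq_bigr => i _.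
rewrite d11 mulr1 (delta_exp n i ct (proj1 ct')) EPp_sumr; apply: eq_bigr => q _.
by rewrite EPpZ.
Qed.

End Theta.

(** * Comultiplication of principal parts *)

Section Comultiplication.
Variables (k : comNzRingType) (A : comAlgType k).

Lemma diag_pow_le m n (z : AA A) : (m <= n)%N ->
  ideal_pow (@diag_ideal k A) n z -> ideal_pow (@diag_ideal k A) m z.
Proof.
elim: n m z => [|n IH] [|m] z //= mn [s Js ->]; exists s => // p /Js[J1 J2].
by split=> //; exact: IH mn J2.
Qed.

Lemma pp_projE m n z : (m <= n)%N ->
  @pp_proj k A n m (rq_pi (diag_pow A n) z) = rq_pi (diag_pow A m) z.
Proof.
move=> mn; apply/rq_piE; apply: (@diag_pow_le m.+1 n.+1) => //.
exact: (rq_repr (diag_pow A n) z).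
Qed.

Lemma pp_projD m n (p q : pparts A n) : (m <= n)%N ->
  pp_proj m (p + q) = pp_proj m p + pp_proj m q.
Proof.
move=> mn; elim/rq_ind: p => p; elim/rq_ind: q => q.
by rewrite -rmorphD !pp_projE // rmorphD.
Qed.

Lemma pp_projM m n (p q : pparts A n) : (m <= n)%N ->
  pp_proj m (p * q) = pp_proj m p * pp_proj m q.
Proof.
move=> mn; elim/rq_ind: p => p; elim/rq_ind: q => q.
by rewrite -rmorphM !pp_projE // rmorphM.
Qed.

Lemma pp_proj_d0 m n a : (m <= n)%N -> pp_proj m (d0 n a) = d0 m a :> pparts A m.
Proof. by move=> mn; rewrite pp_projE. Qed.
Lemma pp_proj_d1 m n a : (m <= n)%N -> pp_proj m (d1 n a) = d1 m a :> pparts A m.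
Proof. by move=> mn; rewrite pp_projE. Qed.

Lemma pp_proj_delta m n a i : (m <= n)%N ->
  pp_proj m (delta n a ^+ i) = delta m a ^+ i :> pparts A m.
Proof.
move=> mn; elim: i => [|i IH]; first by rewrite [LHS]pp_projE.
rewrite !exprS pp_projM // IH; congr (_ * _).
have dE j : delta j a = rq_pi (diag_pow A j) (AAr a - AAl a) by rewrite rmorphB.
by rewrite !dE pp_projE.
Qed.

Variables m n : nat.
Local Notation PP := (tens (@pp_ra k A m) (@pp_la k A n)).
Local Notation PPp := (pure (@pp_ra k A m) (@pp_la k A n)).

Lemma PP_bal : balanced (@pp_ra k A m) (@pp_la k A n) PPp.
Proof. exact: pure_balanced. Qed.

Lemma PPp0l r : PPp 0 r = 0.
Proof. by have [D _ _] := PP_bal; apply: (addrI (PPp 0 r)); rewrite -D !addr0. Qed.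
Lemma PPp0r q : PPp q 0 = 0.
Proof. by have [_ D _] := PP_bal; apply: (addrI (PPp q 0)); rewrite -D !addr0. Qed.

Lemma PPmul_bal q0 r0 : balanced (@pp_ra k A m) (@pp_la k A n)
  (fun q r => PPp (q0 * q) (r0 * r)).
Proof.
have [D D' Z] := PP_bal; split=> [q q' r|q r r'|q a r].
- by rewrite mulrDr D.
- by rewrite mulrDr D'.
by rewrite /pp_ra /pp_la mulrA (mulrCA r0) [LHS]Z.
Qed.

Definition PPmul q0 r0 (w : PP) : PP := tlift (fun q r => PPp (q0 * q) (r0 * r)) w.

Lemma PPmulE q0 r0 q r : PPmul q0 r0 (PPp q r) = PPp (q0 * q) (r0 * r).
Proof. exact: (tlift_pure _ _ (PPmul_bal q0 r0)). Qed.
Lemma PPmulD q0 r0 : {morph PPmul q0 r0 : u v / u + v}.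
Proof. exact: (tliftD (PPmul_bal q0 r0)). Qed.
Lemma PPmul0 q0 r0 : PPmul q0 r0 0 = 0.
Proof. by apply: (addrI (PPmul q0 r0 0)); rewrite -PPmulD !addr0. Qed.

Lemma PP_ext (f g : PP -> PP) : {morph f : u v / u + v} -> {morph g : u v / u + v} ->
  (forall q r, f (PPp q r) = g (PPp q r)) -> f =1 g.
Proof. exact: tens_morph_eq. Qed.

Lemma PPmulDl q q' r w : PPmul (q + q') r w = PPmul q r w + PPmul q' r w.
Proof.
move: w; apply: (PP_ext (f := PPmul (q + q') r) (g := fun w => PPmul q r w + PPmul q' r w)).
- exact: PPmulD.
- by move=> u v; rewrite !PPmulD addrACA.
by move=> a b; rewrite !PPmulE mulrDl; have [D _ _] := PP_bal; exact: D.
Qed.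
Lemma PPmulDr q r r' w : PPmul q (r + r') w = PPmul q r w + PPmul q r' w.
Proof.
move: w; apply: (PP_ext (f := PPmul q (r + r')) (g := fun w => PPmul q r w + PPmul q r' w)).
- exact: PPmulD.
- by move=> u v; rewrite !PPmulD addrACA.
by move=> a b; rewrite !PPmulE mulrDl; have [_ D _] := PP_bal; exact: D.
Qed.
Lemma PPmulM q q' r r' w : PPmul (q * q') (r * r') w = PPmul q r (PPmul q' r' w).
Proof.
move: w; apply: (PP_ext (f := PPmul (q * q') (r * r')) (g := fun w => PPmul q r (PPmul q' r' w))).
- exact: PPmulD.
- by move=> u v; rewrite !PPmulD.
by move=> a b; rewrite !PPmulE !mulrA.
Qed.
Lemma PPmulS q r a w : PPmul (d1 m a * q) r w = PPmul q (d0 n a * r) w.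
Proof.
move: w; apply: (PP_ext (f := PPmul (d1 m a * q) r) (g := PPmul q (d0 n a * r))).
- exact: PPmulD.
- exact: PPmulD.
move=> u v; rewrite !PPmulE; have [_ _ Z] := PP_bal.
by rewrite -mulrA mulrC -[d0 n a * r * v]mulrA; exact: Z.
Qed.

(* P^m (x)_A P^n as a module over A (x)_k A *)
Definition PPact (z : AA A) (w : PP) : PP := tlift (fun a b => PPmul (d0 m a) (d1 n b) w) z.

Lemma PPact_bal w : balanced (@AA_ra k A) (@AA_la k A)
  (fun a b => PPmul (d0 m a) (d1 n b) w).
Proof.
split=> [a a' b|a b b'|a c b]; first by rewrite d0D PPmulDl.
  by rewrite d1D PPmulDr.
have E u : c *: u = c%:A * u :> A by rewrite -scalerAl mul1r.
by rewrite /AA_ra /AA_la (E a) (E b) d0M d1M d0_alg PPmulS d0_alg.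
Qed.

Lemma PPactD w : {morph PPact^~ w : z z' / z + z'}.
Proof. exact: (tliftD (PPact_bal w)). Qed.
Lemma PPactE w a b : PPact (AAp a b) w = PPmul (d0 m a) (d1 n b) w.
Proof. exact: (tlift_pure _ _ (PPact_bal w)). Qed.
Lemma PPact0 w : PPact 0 w = 0.
Proof. by apply: (addrI (PPact 0 w)); rewrite -PPactD !addr0. Qed.

Lemma PPactDr z : {morph PPact z : w w' / w + w'}.
Proof.
move=> w w'; move: z; apply: (@tens_morph_eq _ _ _ (@AA_ra k A) (@AA_la k A) PP
  (fun z : AA A => PPact z (w + w')) (fun z : AA A => PPact z w + PPact z w')).
- by move=> u v; exact: PPactD.
- by move=> u v; rewrite !PPactD addrACA.
by move=> a b; rewrite -/(AAp a b) !PPactE PPmulD.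
Qed.

Lemma PPactM z z' w : PPact (z * z') w = PPact z (PPact z' w).
Proof.
move: z; apply: (@tens_morph_eq _ _ _ (@AA_ra k A) (@AA_la k A) PP
  (fun z : AA A => PPact (z * z') w) (fun z : AA A => PPact z (PPact z' w))).
- by move=> u v; rewrite mulrDl PPactD.
- by move=> u v; exact: PPactD.
move=> a b; rewrite -/(AAp a b); move: z'.
apply: (@tens_morph_eq _ _ _ (@AA_ra k A) (@AA_la k A) PP
  (fun z' : AA A => PPact (AAp a b * z') w) (fun z' : AA A => PPact (AAp a b) (PPact z' w))).
- by move=> u v; rewrite mulrDr PPactD.
- by move=> u v; rewrite PPactD PPactDr.
move=> c d; rewrite -/(AAp c d) [AAp a b * _]AA_mulE !PPactE d0M d1M.
exact: PPmulM.
Qed.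

(** In P^m (x) P^n multiplication by d_1(a) (x) 1 equals that by 1 (x) d_0(a). Inserting this middle
    term splits 1 (x) d_1(a) - d_0(a) (x) 1 into two differences. *)
Lemma PPact_delta a w : PPact (AAr a - AAl a) w =
  PPmul 1 (delta n a) w + PPmul (delta m a) 1 w.
Proof.
have H : PPact (AAl a) w + (PPmul 1 (delta n a) w + PPmul (delta m a) 1 w) = PPact (AAr a) w.
  rewrite /AAl /AAr !PPactE !d01 !d11 addrCA -PPmulDl [d0 m a + _]addrC subrK.
  by rewrite -[d1 m a]mulr1 PPmulS mulr1 -PPmulDr subrK.
by apply: (addrI (PPact (AAl a) w)); rewrite H -PPactD addrC subrK.
Qed.

(* The filtration by the J^a (x) J^b with a + b = N. It vanishes for
   N > m + n and J raises it by one, so that comultiplication is well defined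
   on P^(m+n). *)
Inductive PPfil : nat -> PP -> Prop :=
| PPfil_zero N : PPfil N 0
| PPfil_add N u v : PPfil N u -> PPfil N v -> PPfil N (u + v)
| PPfil_pure a b z z' : ideal_pow (@diag_ideal k A) a z -> ideal_pow (@diag_ideal k A) b z' ->
    PPfil (a + b) (PPp (rq_pi (diag_pow A m) z) (rq_pi (diag_pow A n) z')).

Lemma PPfil_vanish N w : PPfil N w -> (m + n < N)%N -> w = 0.
Proof.
elim=> [//|{}N u v _ IHu _ IHv lt|a b z z' Jz Jz' lt]; first by rewrite IHu // IHv // addr0.
have [am|ma] := ltnP m a.
  rewrite (_ : rq_pi _ z = 0) ?PPp0l //; apply/rq_piE; rewrite subr0.
  exact: diag_pow_le am Jz.
have nb : (n < b)%N by rewrite -(ltn_add2l m) (leq_trans lt) // leq_add2r.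
rewrite (_ : rq_pi _ z' = 0) ?PPp0r //; apply/rq_piE; rewrite subr0.
exact: diag_pow_le nb Jz'.
Qed.

Lemma PPfil_mul N q r w : PPfil N w -> PPfil N (PPmul q r w).
Proof.
elim=> [{}N|{}N u v _ IHu _ IHv|a b z z' Jz Jz'].
- by rewrite PPmul0; exact: PPfil_zero.
- by rewrite PPmulD; exact: PPfil_add.
elim/rq_ind: q => q; elim/rq_ind: r => r.
by rewrite PPmulE -!rmorphM; apply: PPfil_pure; apply: diag_powM.
Qed.

Lemma diag_delta (a : A) : diag_ideal (AAr a - AAl a).
Proof. by rewrite /diag_ideal rmorphB /= !AA_multE mul1r mulr1 subrr. Qed.

Lemma deltaE j a : delta j a = rq_pi (diag_pow A j) (AAr a - AAl a).
Proof. by rewrite rmorphB. Qed.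

Lemma PPfil_delta N a w : PPfil N w -> PPfil N.+1 (PPact (AAr a - AAl a) w).
Proof.
have JS b z : ideal_pow (@diag_ideal k A) b z ->
    ideal_pow (@diag_ideal k A) b.+1 ((AAr a - AAl a) * z).
  move=> Jz; exists [:: (AAr a - AAl a, z)]; last by rewrite big_seq1.
  by move=> p; rewrite inE => /eqP->; split=> //; exact: diag_delta.
elim=> [{}N|{}N u v _ IHu _ IHv|b c z z' Jz Jz'].
- rewrite (_ : PPact _ 0 = 0); first exact: PPfil_zero.
  by apply: (addrI (PPact (AAr a - AAl a) 0)); rewrite -PPactDr !addr0.
- by rewrite PPactDr; exact: PPfil_add.
rewrite PPact_delta !PPmulE !mul1r !deltaE -!rmorphM; apply: PPfil_add.
  by rewrite -addnS; apply: PPfil_pure => //; exact: JS.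
by rewrite -addSn; apply: PPfil_pure => //; exact: JS.
Qed.

(** If the sum of the products ab is 0, then so is the sum of the ab (x) 1, and subtracting it turns
    each a (x) b into (a (x) 1) (1 (x) b - b (x) 1). *)
Lemma diag_gen (z : AA A) : diag_ideal z ->
  exists s : seq (A * A), z = \sum_(p <- s) AAl p.1 * (AAr p.2 - AAl p.2).
Proof.
have [s ->] := AA_span z; rewrite /diag_ideal rmorph_sum /= => E; exists s.
under [RHS]eq_bigr => p _ do rewrite mulrBr -[AAl p.1 * AAl _]rmorphM.
rewrite sumrB -(rmorph_sum (@AAl k A)) /=.
rewrite (_ : \sum_(p <- s) p.1 * p.2 = 0) ?rmorph0 ?subr0 //.
rewrite -[RHS]E; apply: eq_bigr => p _.
by rewrite rmorphM /= !AA_multE mul1r mulr1.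
Qed.

Lemma PPfil_ideal N z : ideal_pow (@diag_ideal k A) N z ->
  forall M w, PPfil M w -> PPfil (N + M) (PPact z w).
Proof.
have gen M z0 w : diag_ideal z0 -> PPfil M w -> PPfil M.+1 (PPact z0 w).
  move=> /diag_gen[s ->] Fw; elim: s => [|p s IH].
    by rewrite big_nil PPact0; exact: PPfil_zero.
  rewrite big_cons PPactD; apply: PPfil_add IH.
  by rewrite PPactM PPactE; apply: PPfil_mul; exact: PPfil_delta.
elim: N z => [|N IH] z /=.
  have [s ->] := AA_span z => _ M w Fw; elim: s => [|p s IH].
    by rewrite big_nil PPact0; exact: PPfil_zero.
  rewrite big_cons PPactD; apply: PPfil_add IH.
  by rewrite -AApE PPactE; exact: PPfil_mul.
move=> [s Js ->] M w Fw; elim: s Js => [|p s IHs] Js.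
  by rewrite big_nil PPact0; exact: PPfil_zero.
rewrite big_cons PPactD; apply: PPfil_add; last first.
  by apply: IHs => q qs; apply: Js; rewrite inE qs orbT.
have [J1 J2] := Js p (mem_head _ _).
by rewrite PPactM addSn; apply: gen => //; exact: IH.
Qed.

(** Independence of the representative used in [pp_comult]: J^(m+n+1) sends 1 (x) 1 to filtration
    degree m + n + 1, where everything vanishes. *)
Lemma pp_comultE z : pp_comult (rq_pi (diag_pow A (m + n)) z : pparts A (m + n)) =
  PPact z (PPp 1 1).
Proof.
have E z0 : tlift (fun x y => PPp (d0 m x) (d1 n y)) z0 = PPact z0 (PPp 1 1).
  rewrite /PPact; congr (tlift _ _); apply/funext => x; apply/funext => y.
  by rewrite PPmulE !mulr1.
rewrite /pp_comult E; set z1 := repr _.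
have J : ideal_pow (@diag_ideal k A) (m + n).+1 (z1 - z).
  exact: (rq_repr (diag_pow A (m + n)) z).
have F0 : PPfil 0 (PPp 1 1) by exact: (@PPfil_pure 0 0 1 1).
have := PPfil_vanish (PPfil_ideal J F0); rewrite addn0 => /(_ (ltnSn _)) H.
by rewrite -[z1](subrK z) PPactD H add0r.
Qed.

(** By [PPact_delta], 1 (x) a - a (x) 1 acts on a product of powers of the two deltas by raising one
    exponent or the other. Iteration produces the binomial coefficients by Pascal's rule. *)
Lemma pp_comult_delta q a u : pp_comult (delta (m + n) a ^+ q * d1 (m + n) u) =
  \sum_(l < q.+1) PPp (delta m a ^+ l) (delta n a ^+ (q - l) * d1 n u) *+ 'C(q, l).
Proof.
rewrite deltaE -[d1 _ u]/(rq_pi (diag_pow A (m + n)) (AAr u)) -rmorphXn -rmorphM pp_comultE.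
rewrite PPactM PPactE PPmulE d01 !mul1r mulr1.
pose f l j := PPp (delta m a ^+ l) (delta n a ^+ j * d1 n u).
have D l j : PPact (AAr a - AAl a) (f l j) = f l j.+1 + f l.+1 j.
  by rewrite PPact_delta !PPmulE !mul1r /f !exprS !mulrA.
have DMn c l j : PPact (AAr a - AAl a) (f l j *+ c) = f l j.+1 *+ c + f l.+1 j *+ c.
  elim: c => [|c IH]; last by rewrite !mulrS PPactDr IH D addrACA.
  by rewrite !mulr0n addr0; apply: (addrI (PPact (AAr a - AAl a) 0)); rewrite -PPactDr !addr0.
have P0 : PPact (AAr a - AAl a) 0 = 0.
  by apply: (addrI (PPact (AAr a - AAl a) 0)); rewrite -PPactDr !addr0.
have -> : PPp 1 (d1 n u) = f 0%N 0%N by rewrite /f !expr0 mul1r.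
elim: q => [|q IH].
  by rewrite expr0 (_ : 1 = AAp 1 1) // PPactE d01 d11 PPmulE !mul1r big_ord1 bin0.
rewrite exprS PPactM IH (big_morph _ (PPactDr (AAr a - AAl a)) P0).
rewrite (eq_bigr (fun l : 'I_q.+1 => f l (q - l).+1 *+ 'C(q, l) + f l.+1 (q - l)%N *+ 'C(q, l))).
  rewrite big_split /= [RHS]big_ord_recl /= subn0 bin0.
  rewrite [X in _ = _ + X](eq_bigr (fun l : 'I_q.+1 => f l.+1 (q - l)%N *+ 'C(q, l.+1) +
     f l.+1 (q - l)%N *+ 'C(q, l))) => [|l _]; last by rewrite /bump add1n subSS binS mulrnDr.
  rewrite big_split /= addrA; congr (_ + _).
  rewrite big_ord_recl /= subn0 bin0; congr (_ + _).
  rewrite [RHS]big_ord_recr /= bin_small // mulr0n addr0; apply: eq_bigr => l _.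
  by rewrite /bump add1n subnSK.
by move=> l _; exact: DMn.
Qed.

Lemma pp_comultD p p' : pp_comult (p + p' : pparts A (m + n)) = pp_comult p + pp_comult p' :> PP.
Proof.
elim/rq_ind: p => p; elim/rq_ind: p' => p'.
by rewrite -rmorphD !pp_comultE PPactD.
Qed.

Lemma pp_comult_la a p : pp_comult (pp_la a p : pparts A (m + n)) = PPmul (d0 m a) 1 (pp_comult p) :> PP.
Proof.
elim/rq_ind: p => p; rewrite /pp_la -[d0 _ a]/(rq_pi _ (AAl a)) -rmorphM !pp_comultE.
by rewrite PPactM [PPact (AAl a) _]PPactE d11.
Qed.

End Comultiplication.

(** * Gluing *)

Section Connection.
Variables (k : closedFieldType) (C : curve k) (V : vertex_algebra k) (G : grading V)
  (Pi : autO_action G).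
Implicit Types (x y : pt C) (U W : set (pt C)) (f g t : pt C -> k).

Notation vst := (vstalk Pi).

Lemma coord_ex x : exists t, coord_at x t.
Proof.
have [U [t [[_ Ux] ct]]] := coordinate_ex x.
by exists t; exact: coordinate_at ct Ux.
Qed.

Lemma conn_ex n x : exists L : vst x -> EP (vst x) n, forall t, coord_at x t -> is_theta t L.
Proof.
have [t ct] := coord_ex x; have [L HL] := theta_ex Pi n ct.
by exists L => t' ct'; exact: theta_change HL.
Qed.

(** The choice is harmless: [is_theta] in a single coordinate already determines the map, as the
    generators span the stalk. *)
Definition conn : conn_maps (vsheaf C Pi) := fun n x => sval (cid (conn_ex n x)).
Arguments conn : clear implicits.

Lemma connP n x t : coord_at x t -> is_theta t (conn n x : vst x -> EP (vst x) n).
Proof. by move=> ct; rewrite /conn; case: cid => L /= H; exact: H. Qed.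

Lemma connD n x (e e' : vst x) : conn n x (e + e') = conn n x e + conn n x e'.
Proof. by have [t /(connP n)[D _]] := coord_ex x; exact: D. Qed.

Lemma conn0 n x : conn n x 0 = 0.
Proof. by apply: (addrI (conn n x 0)); rewrite -connD !addr0. Qed.

Lemma conn_sum n x I (s : seq I) (P : pred I) (F : I -> vst x) :
  conn n x (\sum_(i <- s | P i) F i) = \sum_(i <- s | P i) conn n x (F i).
Proof. by rewrite (big_morph _ (@connD n x) (conn0 n x)). Qed.

Lemma connZ n x u (e : vst x) : conn n x (u *: e) = EP_ra (conn n x e) u.
Proof. by have [t ct] := coord_ex x; exact: theta_lin ct (connP n ct) u e. Qed.

Lemma conn_tgerm n x t a u : coord_at x t -> conn n x (u *: tgerm Pi t x a) = theta Pi t n a u.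
Proof. by move=> ct; have [_ E] := connP n ct; exact: E. Qed.

Lemma conn_ind x (W : zmodType) (F H : vst x -> W) :
  (forall e e', F (e + e') = F e + F e') -> (forall e e', H (e + e') = H e + H e') ->
  (forall t a u, coord_at x t -> F (u *: tgerm Pi t x a) = H (u *: tgerm Pi t x a)) ->
  F =1 H.
Proof.
move=> FD HD E e; have [t ct] := coord_ex x; have [s [_ ->]] := tgerm_span e ct.
have F0 : F 0 = 0 by apply: (addrI (F 0)); rewrite -FD !addr0.
have H0 : H 0 = 0 by apply: (addrI (H 0)); rewrite -HD !addr0.
by rewrite (big_morph _ FD F0) (big_morph _ HD H0); apply: eq_bigr => p _; exact: E.
Qed.

Lemma conn_id x (e : vst x) : conn 0 x e = EPp e 1.
Proof.
move: e; apply: conn_ind => [e e'|e e'|t a u ct]; first exact: connD.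
  exact: EPpDl.
rewrite conn_tgerm // /theta big_ord1 expr0 mul1r transl0 EPpZ mulr1.
by rewrite (taylor_formula 0 ct) /taylor big_ord1 expr0 mulr1 Der_coef0.
Qed.

Lemma EP_proj_bal m n x : (m <= n)%N -> balanced (@mod_ra _ _ (vst x)) (@pp_la _ (lring x) n)
  (fun e p => EPp e (pp_proj m p)).
Proof.
move=> mn; split=> [e e' p|e p p'|e u p]; first exact: EPpDl.
  by rewrite pp_projD // EPpDr.
by rewrite [LHS]EPpZ /pp_la pp_projM // pp_proj_d0.
Qed.

Lemma conn_proj m n x (e : vst x) : (m <= n)%N -> EP_proj m (conn n x e) = conn m x e.
Proof.
move=> mn; have bal := EP_proj_bal x mn.
have PD : {morph (fun w : EP (vst x) n => EP_proj m w) : u v / u + v}.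
  exact: (tliftD bal).
have P0 : EP_proj m (0 : EP (vst x) n) = 0.
  by apply: (addrI (EP_proj m (0 : EP (vst x) n))); rewrite -PD !addr0.
have PE e0 p : EP_proj m (EPp e0 p : EP (vst x) n) = EPp e0 (pp_proj m p).
  exact: (tlift_pure _ _ bal).
move: e; apply: conn_ind => [e e'|e e'|t a u ct].
- by rewrite connD PD.
- exact: connD.
rewrite !conn_tgerm // /theta (big_morph _ PD P0).
transitivity (\sum_(i < n.+1) EPp (tgerm Pi t x (transl i a))
    (delta m (germ x t) ^+ i * d1 m u)).
  by apply: eq_bigr => i _; rewrite PE pp_projM // pp_proj_delta // pp_proj_d1.
apply: (@sum_ord_trunc _ _ _ (fun i => EPp (tgerm Pi t x (transl i a))
    (delta m (germ x t) ^+ i * d1 m u))) => [|i mi]; first by rewrite ltnS.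
by rewrite delta_nilp // mul0r EPp0r.
Qed.

(** * The cocycle condition *)

Section Cocycle.
Variables (m n : nat) (x : pt C).

Local Notation EPPp := (pure (@EP_ra _ _ (vst x) m) (@pp_la _ (lring x) n)).

Lemma EPP_bal : balanced (@EP_ra _ _ (vst x) m) (@pp_la _ (lring x) n) EPPp.
Proof. exact: pure_balanced. Qed.

Lemma EPPp0r w : EPPp w 0 = 0.
Proof. by have [_ D _] := EPP_bal; apply: (addrI (EPPp w 0)); rewrite -D !addr0. Qed.
Lemma EPPp0l r : EPPp 0 r = 0.
Proof. by have [D _ _] := EPP_bal; apply: (addrI (EPPp 0 r)); rewrite -D !addr0. Qed.

Lemma EP_ext_bal : balanced (@mod_ra _ _ (vst x)) (@pp_la _ (lring x) n)
  (fun e p => EPPp (conn m x e) p).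
Proof.
have [D D' Z] := EPP_bal; split=> [e e' p|e p p'|e u p].
- by rewrite connD D.
- by rewrite D'.
by rewrite /mod_ra connZ Z.
Qed.

Lemma inner_bal (e : vst x) : balanced (@pp_ra _ (lring x) m) (@pp_la _ (lring x) n)
  (fun q r => EPPp (EPp e q) r).
Proof.
have [D D' Z] := EPP_bal; split=> [q q' r|q r r'|q a r].
- by rewrite EPpDr D.
- by rewrite D'.
by rewrite /pp_ra -EP_raE Z.
Qed.

Definition inner (e : vst x) (w : tens (@pp_ra _ (lring x) m) (@pp_la _ (lring x) n)) :
  EPP (vst x) m n := tlift (fun q r => EPPp (EPp e q) r) w.

Lemma inner_comult_bal : balanced (@mod_ra _ _ (vst x)) (@pp_la _ (lring x) (m + n))
  (fun e p => inner e (pp_comult p)).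
Proof.
have [D D' Z] := EPP_bal.
have I e := tliftD (inner_bal e).
have ext (f g : tens (@pp_ra _ (lring x) m) (@pp_la _ (lring x) n) -> EPP (vst x) m n) :
    {morph f : u v / u + v} -> {morph g : u v / u + v} ->
    (forall q r, f (pure _ _ q r) = g (pure _ _ q r)) -> f =1 g by exact: tens_morph_eq.
split=> [e e' p|e p p'|e u p].
- apply: (ext (inner (e + e')) (fun w => inner e w + inner e' w)) => [||q r].
  + exact: I.
  + by move=> w w'; rewrite /inner !I addrACA.
  by rewrite /inner !(tlift_pure _ _ (inner_bal _)) EPpDl D.
- by rewrite pp_comultD /inner I.
rewrite pp_comult_la.
apply: (ext (inner (u *: e)) (fun w => inner e (PPmul (d0 m u) 1 w))) => [||q r].
- exact: I.
- by move=> w w'; rewrite PPmulD /inner I.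
by rewrite PPmulE /inner !(tlift_pure _ _ (inner_bal _)) EPpZ mul1r.
Qed.

Lemma conn_cocycle (e : vst x) : EP_ext (conn m x) (conn n x e) = EP_comult (conn (m + n) x e).
Proof.
have XD : {morph (fun w : EP (vst x) n => EP_ext (conn m x) w) : u v / u + v}.
  exact: (tliftD EP_ext_bal).
have CD : {morph (fun w : EP (vst x) (m + n) => EP_comult w) : u v / u + v}.
  exact: (tliftD inner_comult_bal).
have X0 : EP_ext (conn m x) (0 : EP (vst x) n) = 0.
  by apply: (addrI (EP_ext (conn m x) (0 : EP (vst x) n))); rewrite -XD !addr0.
have C0 : EP_comult (0 : EP (vst x) (m + n)) = 0.
  by apply: (addrI (EP_comult (0 : EP (vst x) (m + n)))); rewrite -CD !addr0.
have XE e0 p : EP_ext (conn m x) (EPp e0 p : EP (vst x) n) = EPPp (conn m x e0) p.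
  exact: (tlift_pure _ _ EP_ext_bal).
have CE e0 p : EP_comult (EPp e0 p : EP (vst x) (m + n)) = inner e0 (pp_comult p).
  exact: (tlift_pure _ _ inner_comult_bal).
have [D D' _] := EPP_bal.
move: e; apply: conn_ind => [e e'|e e'|t a u ct].
- by rewrite connD XD.
- by rewrite connD CD.
rewrite !conn_tgerm // /theta (big_morph _ XD X0) (big_morph _ CD C0).
set dm := delta m (germ x t); set dn := delta n (germ x t).
pose g i l := EPPp (EPp (tgerm Pi t x (transl (i + l) a)) (dm ^+ l)) (dn ^+ i * d1 n u) *+ 'C(i + l, l).
transitivity (\sum_(i < n.+1) \sum_(l < m.+1) g i l).
  apply: eq_bigr => i _; rewrite XE -[tgerm Pi t x _]scale1r conn_tgerm // /theta.
  rewrite (big_morph _ (fun w w' => D w w' _) (EPPp0l _)); apply: eq_bigr => l _.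
  rewrite d11 mulr1 transl_comp /g addnC.
  elim: 'C(_, _) => [|c IH]; first by rewrite !mulr0n tgerm0 // EPp0l EPPp0l.
  by rewrite !mulrS tgermD // EPpDl D IH.
(* Composition gives the rectangle i <= n, l <= m, comultiplication the triangle i + l <= m + n.
   Outside the rectangle a power of [dm] or [dn] vanishes. *)
transitivity (\sum_(i < (m + n).+1) \sum_(l < (m + n - i).+1) g i l); last first.
  rewrite tri_sum; apply: eq_bigr => q _; rewrite CE pp_comult_delta /inner.
  have I := tliftD (inner_bal (tgerm Pi t x (transl q a))).
  have I0 := tlift_zero (inner_bal (tgerm Pi t x (transl q a))).
  rewrite (big_morph _ I I0); apply: eq_bigr => l _.
  rewrite /g subnK; last by rewrite -ltnS ltn_ord.
  elim: 'C(_, _) => [|c IH]; first by rewrite !mulr0n I0.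
  by rewrite !mulrS I IH (tlift_pure _ _ (inner_bal _)).
apply/esym; transitivity (\sum_(i < n.+1) \sum_(l < (m + n - i).+1) g i l).
  apply: (@sum_ord_trunc _ _ _ (fun i => \sum_(l < (m + n - i).+1) g i l)) => [|i ni].
    by rewrite ltnS leq_addl.
  by rewrite big1 // => l _; rewrite /g /dn delta_nilp // mul0r EPPp0r mul0rn.
apply: eq_bigr => i _; apply: (@sum_ord_trunc _ _ _ (g i)) => [|l ml].
  by rewrite ltnS -addnBA ?leq_addr // -ltnS ltn_ord.
by rewrite /g /dm delta_nilp // EPp0r EPPp0l mul0rn.
Qed.

End Cocycle.

Lemma vosec_tgerm W t a : zopen W -> coordinate W t -> osec (o := vsheaf C Pi) W (fun y => tgerm Pi t y a).
Proof.
move=> oW ct x Wx; exists W, (triv Pi t a (fun=> 1)); split=> //.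
exact: vsec_tgerm.
Qed.

Definition ep_comb t n (L : seq (V * ((pt C -> k) * (pt C -> k)))) x : EP (vst x) n :=
  \sum_(p <- L) EPp (tgerm Pi t x p.1) (d0 n (germ x p.2.1) * d1 n (germ x p.2.2)).

(** The list is the same at all points of W; this uniformity is what distinguishes a section from a
    family of elements of the stalks. *)
Definition ep_rep t n W (tau : forall x, EP (vst x) n) : Prop :=
  exists L, (forall p, p \in L -> regular_on W p.2.1 /\ regular_on W p.2.2) /\
    forall x, W x -> tau x = ep_comb t n L x.

Lemma ep_rep_sum t n W I (s : seq I) (tau : I -> forall x, EP (vst x) n) :
  (forall i, ep_rep t W (tau i)) -> ep_rep t W (fun x => \sum_(i <- s) tau i x).
Proof.
move=> H; elim: s => [|i s [L [rL LE]]].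
  by exists [::]; split=> // x _; rewrite /ep_comb !big_nil.
have [L' [rL' L'E]] := H i; exists (L' ++ L); split.
  by move=> p; rewrite mem_cat => /orP[/rL'|/rL].
by move=> x Wx; rewrite big_cons /ep_comb big_cat /= LE // L'E.
Qed.

(** The binomial expansion of (d_1 t - d_0 t)^i d_1(f) consists of terms d_0(g) d_1(h), the shape
    that [ep_sec] asks for. *)
Lemma theta_rep t n W a f : (forall y, W y -> coord_at y t) -> regular_on W f ->
  ep_rep t W (fun x => theta Pi t n a (germ x f)).
Proof.
move=> ct rf; apply: ep_rep_sum => i.
pose h l := fun y => (-1) ^+ l * (t y ^+ l) *+ 'C(i, l).
pose h' l := fun y => t y ^+ (i - l) * f y.
have rt y : W y -> regular_at y t by move=> /ct[].
have rX l y : W y -> regular_at y (fun z => t z ^+ l) by move=> /rt; exact: regular_exp.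
have rm l y : W y -> regular_at y (fun z => (-1) ^+ l * t z ^+ l).
  by move=> Wy; apply: regular_mul; [exact: regular_cst|exact: rX].
exists [seq (transl i a, (h l, h' l)) | l <- index_iota 0 i.+1]; split.
  move=> _ /mapP[l _ ->] /=; split=> y Wy; first exact/regular_muln/rm.
  by apply: regular_mul; [exact: rX|exact: rf].
move=> y Wy; rewrite /ep_comb big_map big_mkord /= -EPp_sumr; congr (EPp _ _).
rewrite /delta exprDn mulr_suml; apply: eq_bigr => l _.
rewrite -d1X -d0N -d0X /h /h' germ_muln; last exact: rm.
have -> : germ y (fun z => t z ^+ (i - l) * f z) = germ y t ^+ (i - l) * germ y f.
  by rewrite -germ_exp; [apply: germM; [exact: rX|exact: rf]|exact: rt].
have -> : germ y (fun z => (-1) ^+ l * t z ^+ l) = (- germ y t) ^+ l.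
  transitivity (germ y (fun=> (-1) ^+ l) * germ y (fun z => t z ^+ l)).
    by apply: germM; [exact: regular_cst|exact: rX].
  rewrite germC germ_exp; last exact: rt.
  by rewrite [RHS]exprNn -alg_exp scaleN1r.
by rewrite d0Mn d1M !mulrnAl -mulrA mulrCA.
Qed.

Lemma conn_sec n W s : zopen W -> osec (o := vsheaf C Pi) W s ->
  ep_sec (E := vsheaf C Pi) W (fun x => conn n x (s x)).
Proof.
move=> oW hs x Wx; have [W1 [sg [W1x hsg sE]]] := hs x Wx.
have [U [t [Ux cU]]] := coordinate_ex x.
have W2x := nbhdI W1x (nbhdI (conj oW Wx) Ux).
have cW2 : coordinate (W1 `&` (W `&` U)) t by apply: coordinate_sub cU => y [_ []].
have [|W' W'x [m [a [f [rf fE]]]]] := proj2 hsg _ t (proj1 W2x) (@subIsetl _ _ _) cW2 x.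
  exact: (proj2 W2x).
have W3x := nbhdI W2x W'x; set W3 := _ `&` W' in W3x.
have cW3 : coordinate W3 t by apply: coordinate_sub cW2; exact: subIsetl.
have c3 y : W3 y -> coord_at y t by exact: coordinate_at.
have sE' y : W3 y -> s y = \sum_(i < m) germ y (f i) *: tgerm Pi t y (a i).
  move=> W3y; have [[W1y [Wy Uy]] W'y] := W3y; rewrite sE //.
  have W3y' : nbhd y W3 by split=> //; case: W3x.
  have [|S hS [SE _ S'E]] := @vgerm_comb _ _ _ Pi y t W3 [seq (a i, f i) | i <- enum 'I_m] W3y' cW3.
    by move=> _ /mapP[i _ ->]; exact: rf.
  rewrite big_map big_enum /= in SE; rewrite -SE.
  apply: (vgerm_eq_triv (c3 y W3y) W3y') => //; first by apply: vsec_sub hsg => z [[]].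
  apply: nearS (near_nbhd (proj1 W3y') W3y) => z Wz phi h.
  by rewrite fE // S'E // big_map big_enum.
have [L [rL LE]] : ep_rep t W3 (fun y => \sum_(i < m) theta Pi t n (a i) (germ y (f i))).
  by apply: ep_rep_sum => i; apply: theta_rep.
exists W3, (size L), (fun i y => tgerm Pi t y (tnth (in_tuple L) i).1),
  (fun i => (tnth (in_tuple L) i).2.1), (fun i => (tnth (in_tuple L) i).2.2).
split=> // [i|y W3y].
  have [r1 r2] := rL _ (mem_tnth i (in_tuple L)).
  by split=> //; apply: vosec_tgerm => //; case: W3x.
have -> : conn n y (s y) = \sum_(i < m) theta Pi t n (a i) (germ y (f i)).
  rewrite sE' // conn_sum; apply: eq_bigr => i _; exact/conn_tgerm/c3.
by rewrite LE // /ep_comb big_tnth.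
Qed.

Lemma conn_pd : pd_connection (E := vsheaf C Pi) setT conn.
Proof.
split.
- by move=> n x _; exact: connD.
- by move=> n x _; exact: connZ.
- by move=> n W s oW _; exact: conn_sec.
- by move=> x _; exact: conn_id.
- by move=> m n x mn _ e; exact: conn_proj.
by move=> m n x _; exact: conn_cocycle.
Qed.

(** Taylor's formula for d_1(f) gives terms indexed by a square. Nilpotency of delta t cuts it down
    to a triangle, whose antidiagonals are the inner sums of the stated formula. *)
Lemma conn_defines U t : zopen U -> coordinate U t -> defines_conn U t conn.
Proof.
move=> oU cU; split=> [n x _|n W a f oW WU rf x Wx]; first exact: connD.
have ct := coordinate_at cU (WU x Wx); have rfx := rf x Wx.
rewrite vgerm_triv // conn_tgerm // /theta.
pose g j i := EPp (Der t (germ x f) j *: tgerm Pi t x (transl i a)) (delta n (germ x t) ^+ (j + i)).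
transitivity (\sum_(j < n.+1) \sum_(i < (n - j).+1) g j i).
  transitivity (\sum_(j < n.+1) \sum_(i < n.+1) g j i).
    rewrite exchange_big; apply: eq_bigr => i _.
    rewrite (taylor_formula n ct) /taylor mulr_sumr EPp_sumr; apply: eq_bigr => j _.
    by rewrite /g EPpZ exprD [_ ^+ j * _]mulrC mulrCA.
  apply: eq_bigr => j _; apply: (@sum_ord_trunc _ _ _ (g j)) => [|i ji].
    by rewrite ltnS leq_subr.
  rewrite /g delta_nilp ?EPp0r //.
  by rewrite -ltn_subLR // -ltnS ltn_ord.
rewrite tri_sum; apply: eq_bigr => q _; apply: eq_bigr => i _.
rewrite /g subnK; last by rewrite -ltnS ltn_ord.
by rewrite Der_germ // -vgerm_triv //; exact: dpderiv_reg.
Qed.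

Lemma defines_conn_unique U t (Th : conn_maps (vsheaf C Pi)) : zopen U -> coordinate U t ->
  defines_conn U t Th -> forall n x, U x -> Th n x = conn n x.
Proof.
move=> oU cU [ThD ThE] n x Ux; apply/funext => e.
have ct := coordinate_at cU Ux; have [s [rs ->]] := tgerm_span e ct.
have [W [Wx WU rW]] := regular_common (conj oU Ux) rs.
have z : Th n x 0 = 0 by apply: (addrI (Th n x 0)); rewrite -ThD // !addr0.
rewrite (big_morph _ (ThD n x Ux) z) conn_sum big_seq [RHS]big_seq.
have [_ CE] := conn_defines oU cU.
apply: eq_bigr => p ps; have rp := rW p ps; rewrite -vgerm_triv; [|by []|exact: rs].
rewrite (ThE n W p.1 p.2 (proj1 Wx) WU rp x (proj2 Wx)).
by rewrite (CE n W p.1 p.2 (proj1 Wx) WU rp x (proj2 Wx)).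
Qed.

Lemma pd_connection_eq U (Th : conn_maps (vsheaf C Pi)) :
  (forall n x, U x -> Th n x = conn n x) -> pd_connection U Th.
Proof.
move=> E; split.
- by move=> n x Ux e e'; rewrite E //; exact: connD.
- by move=> n x Ux a e; rewrite E //; exact: connZ.
- move=> n W s oW WU hs x Wx.
  have [W' [m [s' [f [g [W'x H H']]]]]] := conn_sec n oW hs Wx.
  have W1x := nbhdI (conj oW Wx) W'x.
  exists (W `&` W'), m, s', f, g; split=> //.
    move=> i; have [h1 h2 h3] := H i; split.
    + move=> y [_ W'y]; have [W2 [s2 [W2y hs2 s2E]]] := h1 y W'y.
      by exists W2, s2; split=> // z [_ W'z]; exact: s2E.
    + by move=> y [_]; exact: h2.
    + by move=> y [_]; exact: h3.
  by move=> y [Wy W'y]; rewrite E; [exact: H'|exact: WU].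
- by move=> x Ux e; rewrite E //; exact: conn_id.
- by move=> m n x mn Ux e; rewrite !E //; exact: conn_proj.
by move=> m n x Ux e; rewrite !E //; exact: conn_cocycle.
Qed.

End Connection.

Arguments conn {k} C {V G} Pi n x e.

Theorem lemma6p18 (k : closedFieldType) (V : vertex_algebra k)
    (G : grading V) (Pi : autO_action G) (C : curve k) :
  (forall (U : set (pt C)) (t : pt C -> k),
     zopen U -> coordinate U t ->
     (exists Th : conn_maps (vsheaf C Pi), defines_conn U t Th) /\
     (forall Th : conn_maps (vsheaf C Pi),
        defines_conn U t Th -> pd_connection U Th)) /\
  (forall (U : set (pt C)) (t t' : pt C -> k)
      (Th Th' : conn_maps (vsheaf C Pi)),
     zopen U -> coordinate U t -> coordinate U t' ->
     defines_conn U t Th -> defines_conn U t' Th' ->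
     forall n x, U x -> forall e, Th n x e = Th' n x e) /\
  (exists Th : conn_maps (vsheaf C Pi),
     pd_connection setT Th /\
     forall (U : set (pt C)) (t : pt C -> k),
       zopen U -> coordinate U t -> defines_conn U t Th).
Proof.
split=> [U t oU cU|].
  split; first by exists (conn C Pi); exact: conn_defines.
  by move=> Th HTh; apply: pd_connection_eq => n x; exact: defines_conn_unique HTh n x.
split=> [U t t' Th Th' oU ct ct' HTh HTh' n x Ux e|].
  by rewrite (defines_conn_unique oU ct HTh) // (defines_conn_unique oU ct' HTh').
exists (conn C Pi); split; first exact: conn_pd.
by move=> U t; exact: conn_defines.
Qed.
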